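(* Let $M$ be a compact boundaryless surface and let $f\colon M\to M$ be a $2$-expansive homeomorphism whose nonwandering set satisfies $\Omega(f)=M$. Then $f$ is expansive.
   Context: For a homeomorphism $f\colon X\to X$ of a compact metric space $(X,d)$, $x\in X$ and $\epsilon>0$, put $\Gamma_\epsilon(x)=\{y\in X: d(f^n(x),f^n(y))\le \epsilon \text{ for all } n\in\mathbb{Z}\}$. For a positive integer $n$, $f$ is $n$-expansive if there is $\alpha>0$ such that $\Gamma_\alpha(x)$ has at most $n$ elements for every $x\in X$. The homeomorphism $f$ is expansive if there is $\alpha>0$ such that $\Gamma_\alpha(x)=\{x\}$ for every $x\in X$ (that is, $f$ is $1$-expansive). $\Omega(f)$ denotes the nonwandering set of $f$. *)

(* Defs.v *)
From mathcomp Require Import all_boot all_order all_algebra.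
From mathcomp Require Import all_classical all_reals all_analysis.
Import Order.TTheory GRing.Theory Num.Theory.
Import numFieldNormedType.Exports.

Set Implicit Arguments.
Unset Strict Implicit.
Unset Printing Implicit Defensive.

Local Open Scope classical_set_scope.
Local Open Scope card_scope.
Local Open Scope ring_scope.

(* The inverse is carried as data so that negative iterates are directly
   available; being a two-sided inverse, it is determined by the function. *)
Record homeo (X : topologicalType) := Homeo {
  homeo_fun :> X -> X;
  homeo_inv : X -> X;
  homeo_funK : cancel homeo_fun homeo_inv;
  homeo_invK : cancel homeo_inv homeo_fun;
  homeo_fun_continuous : continuous homeo_fun;
  homeo_inv_continuous : continuous homeo_inv
}.

(* [Negz k] denotes the integer -(k+1). *)
Definition ziter (X : topologicalType) (f : homeo X) (n : int) : X -> X :=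
  match n with
  | Posz k => iter k f
  | Negz k => iter k.+1 (homeo_inv f)
  end.

Definition Gamma (R : realType) (X : metricType R) (f : homeo X)
    (eps : R) (x : X) : set X :=
  [set y | forall n : int, mdist (ziter f n x) (ziter f n y) <= eps].

Definition n_expansive (R : realType) (X : metricType R) (n : nat)
    (f : homeo X) : Prop :=
  exists2 alpha : R, 0 < alpha & forall x : X, Gamma f alpha x #<= `I_n.

Definition expansive (R : realType) (X : metricType R) (f : homeo X) : Prop :=
  exists2 alpha : R, 0 < alpha & forall x : X, Gamma f alpha x = [set x].

Definition nonwandering (X : topologicalType) (f : homeo X) : set X :=
  [set x | forall U : set X, nbhs x U ->
     exists n : nat, (0 < n)%N /\ (iter n f @` U) `&` U !=set0].

(* [phi] restricts to a homeomorphism from the open set [U] onto the open set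
   [V], with inverse [psi]; values outside [U] and [V] are irrelevant. *)
Definition is_chart (X Y : topologicalType) (U : set X) (V : set Y)
    (phi : X -> Y) (psi : Y -> X) : Prop :=
  [/\ open U /\ open V,
      phi @` U `<=` V /\ psi @` V `<=` U,
      (forall x, U x -> psi (phi x) = x) /\ (forall y, V y -> phi (psi y) = y) &
      {within U, continuous phi} /\ {within V, continuous psi}].

(* Charts take values in open subsets of the plane (not of a half-plane), so
   there is no boundary. The Hausdorff and second countability axioms are
   automatic for the compact metric spaces considered here. Connectedness is
   not required. *)
Definition boundaryless_surface (R : realType) (M : metricType R) : Prop :=
  forall x : M, exists (U : set M) (V : set 'rV[R]_2)
    (phi : M -> 'rV[R]_2) (psi : 'rV[R]_2 -> M),
    U x /\ is_chart U V phi psi.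

(* Main.v *)
(* Stable (unstable) continua are those whose forward (backward) iterates stay
   small. In a small disc [D], the maximal stable continua form an upper
   semicontinuous decomposition into plaques, all of which reach the boundary:
   otherwise an open set would have small backward iterates and contract, which
   [Omega(f) = M] forbids. The same holds for unstable plaques, and by
   2-expansiveness a stable and an unstable plaque share at most two points.

   There is in fact no lens, i.e. no two points [x <> y] with the same stable and
   the same unstable plaque. A lens encloses a region, and every plaque through
   some open subset [G] of it has to cross the opposite side of the lens twice.
   Take [p] in [G] returning to [G] at a late time [m], and [u, u'] the two points
   where the stable plaque of [p] meets the unstable side. The unstable plaques of
   [f^m u] and [f^m u'] are distinct and each meets the stable side in two points;
   three of these points shadow one another for all times.

   Without lenses a stable continuum cannot fold back close to itself (a hairpin
   degenerates to a lens). Suppose the forward orbits of [x] and [y] stay close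
   while the stable plaques differ. Then some nondegenerate unstable continuum
   [K] is such that the stable plaque of every interior point of [K] separates
   [x] from [y]. This separation propagates to all forward iterates, and the
   plaques through [f^n K] pass close to [f^n x]; as forward iterates contract
   stable plaques, [f^n K] stays close to [f^n x], so all iterates of [K] are small
   and [K] is a point. Hence points with close forward orbits lie in the same
   stable plaque, points with close backward orbits lie in the same unstable
   plaque, and as there is no lens [f] is expansive. *)
Require Import Defs.
From mathcomp Require Import all_boot all_order all_algebra.
From mathcomp Require Import all_classical all_reals all_analysis.
From mathcomp Require Import ring lra.
Import Order.TTheory GRing.Theory Num.Theory.
Import numFieldNormedType.Exports.
Set Implicit Arguments.
Unset Strict Implicit.
Unset Printing Implicit Defensive.
Local Open Scope classical_set_scope.
Local Open Scope ring_scope.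

(** * Continua and components *)

Section Continua.
Variable T : topologicalType.
Implicit Types A B C K O X : set T.

(** Plaques are continua that need not be arcs or locally connected. Irreducible subcontinua
    therefore stand in for arcs, and the relation [psep] (a plaque separating two points) for the
    order along a transversal. The plane enters through three facts about the disc: it is
    unicoherent, continua with interlaced ends on the circle meet, and two continua with
    disconnected intersection enclose a point. All three rest on lifting the angle of a nowhere zero
    plane map. Compactness arguments use limits along an ultrafilter, under which continua have a
    continuum as limit. The constant [e] is a quarter of the expansivity constant: iterates of
    plaques have diameter at most [e], and the orbits to be compared are linked by up to three such
    steps. Plaques depend on the disc, and an orbit visits many discs: a plaque of a large disc may
    cross a small one in several strands. Excluding hairpins makes the plaques of discs of different
    sizes agree near the centre, without which separation could not be carried along an orbit. *)

Definition continuum C := compact C /\ connected C.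

Lemma connected_closed_meet C A B : connected C -> closed A -> closed B ->
  C `<=` A `|` B -> C `&` A !=set0 -> C `&` B !=set0 -> C `&` A `&` B !=set0.
Proof.
move=> cC cA cB CAB CA CB; apply: contrapT => CAB0.
have E : C `&` A = C.
  apply: cC => //; last by exists A.
  exists (~` B); first exact: closed_openC.
  apply/seteqP; split=> x [Cx xA]; split=> //.
    by move=> Bx; apply: CAB0; exists x.
  by have [] := CAB x Cx.
by case: CB => x [Cx Bx]; apply: CAB0; exists x; split=> //; rewrite E.
Qed.

Lemma connected_open_meet C A B : connected C -> open A -> open B ->
  C `<=` A `|` B -> C `&` A !=set0 -> C `&` B !=set0 -> C `&` A `&` B !=set0.
Proof.
move=> cC oA oB CAB CA CB; apply: contrapT => CAB0.
have E : C `&` A = C.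
  apply: cC => //; first by exists A.
  exists (~` B); first exact: open_closedC.
  apply/seteqP; split=> x [Cx xA]; split=> //.
    by move=> Bx; apply: CAB0; exists x.
  by have [] := CAB x Cx.
by case: CB => x [Cx Bx]; apply: CAB0; exists x; split=> //; rewrite E.
Qed.

Lemma connected_of_closed_split C :
  closed C ->
  (forall A B, closed A -> closed B -> C = A `|` B -> A `&` B = set0 ->
     A !=set0 -> B !=set0 -> False) -> connected C.
Proof.
move=> clC H B B0 [U oU BU] [F cF BF].
apply: contrapT => /eqP BC.
have cB : closed B by rewrite BF; exact: closedI.
have cB' : closed (C `\` B).
  rewrite (_ : _ `\` _ = C `&` ~` U); last first.
    apply/seteqP; split=> x [Cx nB]; split=> //; first by move=> Ux; apply: nB; rewrite BU.
    by rewrite BU => -[].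
  by apply: closedI => //; exact: open_closedC.
apply: (H _ _ cB cB') => //.
- apply/seteqP; split=> x; last by case=> [|[]//]; rewrite BU => -[].
  by move=> Cx; case: (pselect (B x)) => ?; [left|right].
- by apply/seteqP; split=> x // -[? []].
- apply: contrapT => E; move/eqP: BC; apply.
  apply/seteqP; split=> x; first by rewrite BU => -[].
  by move=> Cx; apply: contrapT => nB; apply: E; exists x.
Qed.

Lemma connected_sub_cover C A : connected C -> C `<=` A ->
  (forall x, A x -> exists2 E, connected E & E x /\ E `<=` A /\ E `&` C !=set0) ->
  C !=set0 -> connected A.
Proof.
move=> cC CA H [c Cc].
pose P E := connected E /\ E `<=` A /\ E c.
rewrite (_ : A = \bigcup_(E in P) E); last first.
  apply/seteqP; split=> x; last by case=> E [_ [EA _]] /EA.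
  move=> Ax; have [E cE [Ex [EA EC]]] := H x Ax.
  exists (E `|` C); last by left.
  split; first exact: connectedU.
  by split; [move=> y [/EA|/CA] | right].
apply: bigcup_connected; last by move=> E [].
by exists c => E [_ []].
Qed.

End Continua.

Section Compact.
Variables (R : realType) (T : pseudoMetricType R).
Hypothesis hT : hausdorff_space T.
Implicit Types A B C K O X : set T.

Lemma closed_separation A B : closed A -> closed B -> A `&` B = set0 ->
  exists U V, [/\ open U, open V, A `<=` U, B `<=` V & U `&` V = set0].
Proof. by have /(@normal_openP R T) := @pseudometric_normal R T; exact. Qed.

(* In a compact Hausdorff space components and quasi-components agree. *)
Lemma component_clopen_nbhd X z O : compact X -> X z -> open O ->
  connected_component X z `<=` O ->
  exists W, [/\ closed W, closed (X `\` W), W z, W `<=` X & W `<=` O].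
Proof.
move=> cX Xz oO KO.
have clX : closed X by exact: compact_closed.
pose P W := [/\ closed W, closed (X `\` W), W z & W `<=` X].
have PX : P X.
  by split=> //; rewrite setDv; exact: closed0.
have PI V W : P V -> P W -> P (V `&` W).
  move=> [cV cV' Vz VX] [cW cW' Wz WX]; split=> //; first exact: closedI.
  - rewrite (_ : _ `\` _ = (X `\` V) `|` (X `\` W)); first exact: closedU.
    apply/seteqP; split=> x; last by move=> [[Xx nV]|[Xx nW]]; split=> // -[].
    move=> [Xx nVW]; case: (pselect (V x)) => Vx; last by left.
    by right; split=> // Wx; apply: nVW.
  - by move=> x [/VX].
(* [Q] is the quasi-component of [z]. By compactness an open set around [Q] already contains some
   [W] with [P W], so a splitting of [Q] would yield a smaller member of [P]. *)
pose Q := \bigcap_(W in P) W.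
have cQ : closed Q by apply: closed_bigI => W [].
have QX : Q `<=` X by move=> x /(_ X PX).
have QO U : open U -> Q `<=` U -> exists2 W, P W & W `<=` U.
  move=> oU QU; apply: contrapT => nW.
  pose F := filter_from P (fun W => W `\` U).
  have FF : ProperFilter F.
    apply: filter_from_proper; last first.
      move=> W PW; apply: contrapT => E; apply: nW; exists W => // x Wx.
      by apply: contrapT => nU; apply: E; exists x.
    apply: filter_from_filter; first by exists X.
    move=> V W PV PW; exists (V `&` W); first exact: PI.
    by move=> x [[? ?] ?]; split; split.
  have FX : F X by exists X => // x [].
  have [q [Xq /= clq]] := cX F FF FX.
  have : Q q.
    move=> W PW; have [cW _ _ _] := PW; apply: cW => B Bq.
    have FW : F W by exists W => // x [].
    by have [y [Wy By]] := clq W B FW Bq; exists y.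
  move/QU => Uq.
  have FU : F (~` U) by exists X => // x [].
  have [y [nUy Uy]] := clq _ _ FU (open_nbhs_nbhs (conj oU Uq)).
  exact: nUy.
have Qz : Q z by move=> W [].
have sub A B : closed A -> closed B -> Q = A `|` B -> A `&` B = set0 ->
    A z -> B = set0.
  move=> cA cB QAB AB0 Az.
  have [U [V [oU oV AU BV UV]]] := closed_separation cA cB AB0.
  have QUV : Q `<=` U `|` V by rewrite QAB; exact: setUSS.
  have [W PW WUV] := QO _ (openU oU oV) QUV.
  have [cW cW' Wz WX] := PW.
  have PWV : P (W `&` ~` V).
    split=> //.
    - by apply: closedI => //; exact: open_closedC.
    - rewrite (_ : _ `\` _ = (X `\` W) `|` (W `&` ~` U)).
        by apply: closedU => //; apply: closedI => //; exact: open_closedC.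
      apply/seteqP; split=> x.
        move=> [Xx nWV]; case: (pselect (W x)) => Wx; last by left.
        right; split=> // Ux; apply: nWV; split=> // Vx.
        by have : (U `&` V) x by []; rewrite UV.
      move=> [[Xx nW]|[Wx nU]]; split=> //; [by case|exact: WX|].
      by move=> [_ nV]; case: (WUV x Wx).
    - split=> // Vz.
      by have : (U `&` V) z; [split=> //; exact: AU | rewrite UV].
    - by move=> x [/WX].
  apply/seteqP; split=> // x Bx.
  have Qx : Q x by rewrite QAB; right.
  by have [_] := Qx _ PWV; case; exact: BV.
have conQ : connected Q.
  apply: connected_of_closed_split => // A B cA cB QAB AB0 A0 B0.
  have : (A `|` B) z by rewrite -QAB.
  case=> [Az|Bz].
    by move: B0; rewrite (sub A B cA cB QAB AB0 Az) => -[].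
  by move: A0; rewrite (sub B A cB cA _ _ Bz) => [[]//||]; rewrite 1?setUC // setIC.
have QK : Q `<=` connected_component X z by exact: connected_component_max.
have [W [cW cW' Wz WX] WO] := QO O oO (subset_trans QK KO).
by exists W.
Qed.

Lemma component_continuum X z : compact X -> X z ->
  continuum (connected_component X z).
Proof.
move=> cX Xz; split; last exact: component_connected.
apply: (subclosed_compact _ cX); last exact: connected_component_sub.
by apply: component_closed; exact: compact_closed.
Qed.

(** Boundary bumping: a component inside [O] would have a relatively clopen neighbourhood inside
    [O], and this would split [C]. *)
Lemma component_exits C O z : continuum C -> open O -> C z -> O z -> ~ C `<=` O ->
  exists2 w, connected_component (C `&` closure O) z w & ~ O w.
Proof.
move=> [cC conC] oO Cz Oz nCO; apply: contrapT => E.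
have clC : closed C by exact: compact_closed.
have Xz : (C `&` closure O) z by split=> //; exact: subset_closure.
have cX : compact (C `&` closure O).
  by apply: (subclosed_compact _ cC) => [|x []//]; apply: closedI => //; exact: closed_closure.
have KO : connected_component (C `&` closure O) z `<=` O.
  by move=> w Kw; apply: contrapT => nOw; apply: E; exists w.
have [W [cW cW' Wz WX WO]] := component_clopen_nbhd cX Xz oO KO.
have cB : closed ((C `&` ~` O) `|` ((C `&` closure O) `\` W)).
  by apply: closedU => //; apply: closedI => //; exact: open_closedC.
have := connected_closed_meet conC cW cB.
have h1 : C `<=` W `|` ((C `&` ~` O) `|` ((C `&` closure O) `\` W)).
  move=> x Cx; case: (pselect (W x)) => Wx; [by left|right].
  case: (pselect (O x)) => Ox; [right|by left].
  by split=> //; split=> //; exact: subset_closure.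
have h2 : C `&` W !=set0 by exists z.
have h3 : C `&` ((C `&` ~` O) `|` ((C `&` closure O) `\` W)) !=set0.
  apply: contrapT => h; apply: nCO => x Cx; apply: contrapT => nOx.
  by apply: h; exists x; split=> //; left.
move=> /(_ h1 h2 h3) [x [[Cx Wx] [[_ nO]|[_ nW]]]] //.
by apply: nO; exact: WO.
Qed.

Lemma continuum_sub_exits C O z : continuum C -> open O -> C z -> O z -> ~ C `<=` O ->
  exists K, [/\ continuum K, K z, K `<=` C, K `<=` closure O & exists2 w, K w & ~ O w].
Proof.
move=> cC oO Cz Oz nCO.
have [w Kw nOw] := component_exits cC oO Cz Oz nCO.
have Xz : (C `&` closure O) z by split=> //; exact: subset_closure.
have cX : compact (C `&` closure O).
  case: cC => cC _; apply: (subclosed_compact _ cC) => [|x []//].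
  by apply: closedI; [exact: compact_closed | exact: closed_closure].
exists (connected_component (C `&` closure O) z); split.
- exact: component_continuum.
- exact: connected_component_refl.
- by move=> x /connected_component_sub [].
- by move=> x /connected_component_sub [].
- by exists w.
Qed.

Lemma continuumU A B : continuum A -> continuum B -> A `&` B !=set0 ->
  continuum (A `|` B).
Proof.
move=> [cA nA] [cB nB] AB; split; first exact: compactU.
exact: connectedU.
Qed.

Lemma continuum1 (x : T) : continuum [set x].
Proof. by split; [exact: compact_set1 | exact: connected1]. Qed.

(** The substitute for an arc from [a] to [b]: a part that can be removed without losing
    connectedness or an end must be empty. *)
Definition irreducible C a b := [/\ continuum C, C a, C b &
  forall C', continuum C' -> C' a -> C' b -> C' `<=` C -> C' = C].

Lemma irreducible_exists C a b : continuum C -> C a -> C b ->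
  exists2 I, irreducible I a b & I `<=` C.
Proof.
move=> cC Ca Cb.
pose P (A : set T) := [/\ continuum A, A a, A b & A `<=` C].
pose S := {A : set T | P A}.
pose rl (A B : S) := `[< sval B `<=` sval A >].
have PC : P C by split.
have [||||[I PI] Imax] := @Zorn S rl.
- by move=> A; apply/asboolP.
- by move=> A B D /asboolP AB /asboolP BD; apply/asboolP; exact: subset_trans BD AB.
- move=> [A PA] [B PB] /asboolP /= AB /asboolP /= BA; apply: eq_exist.
  by apply/seteqP.
- move=> F totF.
  have [[A0 FA0]|F0] := pselect (exists D, F D); last first.
    by exists (exist _ C PC) => A FA; case: F0; exists A.
  pose Q := \bigcap_(D in F) sval D.
  have cQ : closed Q.
    by apply: closed_bigI => A _; case: (svalP A) => -[cA _] _ _ _; exact: compact_closed.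
  have QC : Q `<=` C by move=> x /(_ A0 FA0); case: (svalP A0) => _ _ _; exact.
  have Qa : Q a by move=> A _; case: (svalP A).
  have Qb : Q b by move=> A _; case: (svalP A).
  have kQ : compact Q by apply: (subclosed_compact cQ _ QC); case: cC.
  (* If disjoint open sets [U], [V] split the intersection, each member of the chain has a point
     outside both, and by compactness such points cluster in the intersection. *)
  have nQ : connected Q.
    apply: connected_of_closed_split => // A B cA cB QAB AB0 A1 B1.
    have [U [V [oU oV AU BV UV]]] := closed_separation cA cB AB0.
    pose G := filter_from F (fun D => sval D `\` (U `|` V)).
    have FG : ProperFilter G.
      apply: filter_from_proper.
        apply: filter_from_filter; first by exists A0.
        move=> D E FD FE; case: (totF D E FD FE) => /asboolP h.
          by exists E => // x [Ex nx]; split; split=> //; exact: h.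
        by exists D => // x [Dx nx]; split; split=> //; exact: h.
      move=> D FD; apply: contrapT => h.
      have DUV : sval D `<=` U `|` V.
        by move=> x Dx; apply: contrapT => nx; apply: h; exists x.
      case: (svalP D) => -[_ nD] _ _ _.
      have D1 : sval D `&` U !=set0.
        case: A1 => x Ax; exists x; split; last exact: AU.
        by have : Q x; [rewrite QAB; left | exact].
      have D2 : sval D `&` V !=set0.
        case: B1 => x Bx; exists x; split; last exact: BV.
        by have : Q x; [rewrite QAB; right | exact].
      have [x [[_ Ux] Vx]] := connected_open_meet nD oU oV DUV D1 D2.
      by have : (U `&` V) x by []; rewrite UV.
    have GC : G C.
      by exists A0 => // x []; case: (svalP A0) => _ _ _ h /h.
    have kC : compact C by case: cC.
    have [q [Cq clq]] := kC G FG GC.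
    have Qq : Q q.
      move=> D FD; case: (svalP D) => -[cD _] _ _ _.
      apply: (compact_closed hT cD) => O Oq.
      have GD : G (sval D) by exists D => // x [].
      by have [y [Dy Oy]] := clq _ _ GD Oq; exists y.
    have UVq : (U `|` V) q by move: Qq; rewrite QAB => -[/AU|/BV]; [left|right].
    have GU : G (~` (U `|` V)) by exists A0 => // x [].
    have [y [ny Uy]] := clq _ _ GU (open_nbhs_nbhs (conj (openU oU oV) UVq)).
    exact: ny.
  have PQ : P Q by [].
  by exists (exist _ Q PQ) => A FA; apply/asboolP => x; apply.
case: (PI) => cI Ia Ib IC.
exists I => //; split=> // C' cC' C'a C'b C'I.
have PC' : P C' by split=> //; exact: subset_trans IC.
have /Imax : rl (exist _ I PI) (exist _ C' PC') by apply/asboolP.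
by case.
Qed.

End Compact.

(** * Components off closed sets, and unicoherence *)

Section Joined.
Variables (R : realType) (T : pseudoMetricType R).
Hypothesis hT : hausdorff_space T.
Implicit Types A B C D F K O V X : set T.

Lemma closure_sub_closed A D : closed D -> A `<=` D -> closure A `<=` D.
Proof. by move=> /closure_id {2}-> AD; exact: closureS. Qed.

(** Joining is by continua rather than paths, because plaques have to serve as connections. In a
    compact [locally_continuum] set the classes are relatively open, so they act as components. *)
Definition joined O a b := exists C, [/\ continuum C, C a, C b & C `<=` O].

Definition locally_continuum D := forall z O, D z -> open O -> O z ->
  exists C U, [/\ continuum C, C `<=` O `&` D, open U, U z & U `&` D `<=` C].

Definition unicoherent D := forall A B, closed A -> closed B -> connected A ->
  connected B -> A `|` B = D -> connected (A `&` B).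

Lemma joined_refl O a : O a -> joined O a a.
Proof. by move=> Oa; exists [set a]; split=> //; [exact: continuum1|move=> x ->]. Qed.

Lemma joined_sym O a b : joined O a b -> joined O b a.
Proof. by move=> [C [? ? ? ?]]; exists C. Qed.

Lemma joined_trans O b a c : joined O a b -> joined O b c -> joined O a c.
Proof.
move=> [C [cC Ca Cb CO]] [C' [cC' C'b C'c C'O]]; exists (C `|` C'); split.
- by apply: continuumU => //; exists b.
- by left.
- by right.
- by move=> x [/CO|/C'O].
Qed.

Lemma joined_mem O a b : joined O a b -> O a /\ O b.
Proof. by move=> [C [_ Ca Cb CO]]; split; exact: CO. Qed.

Lemma joined_sub O O' a b : O `<=` O' -> joined O a b -> joined O' a b.
Proof. by move=> OO [C [? ? ? CO]]; exists C; split=> // x /CO /OO. Qed.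

Lemma joined_continuum O C a b : continuum C -> C a -> C b -> C `<=` O -> joined O a b.
Proof. by exists C. Qed.

Lemma connected_joined O a : O a -> connected [set b | joined O a b].
Proof.
move=> Oa.
rewrite (_ : [set b | _] = \bigcup_(C in [set C | continuum C /\ C a /\ C `<=` O]) C).
  by apply: bigcup_connected; [exists a => C [_ []] | move=> C [[]]].
apply/seteqP; split=> b; first by move=> [C [? ? ? ?]]; exists C.
by move=> [C [? [? ?]] ?]; exists C.
Qed.

Section LC.
Variable D : set T.
Hypotheses (cD : compact D) (lD : locally_continuum D).

Let clD : closed D. Proof. exact: compact_closed. Qed.

Lemma joined_open O z : open O -> D z -> O z ->
  exists U, [/\ open U, U z & forall w, U w -> D w -> joined (D `&` O) z w].
Proof.
move=> oO Dz Oz; have [C [U [cC CO oU Uz UC]]] := lD Dz oO Oz.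
exists U; split=> // w Uw Dw; exists C; split=> //; first exact: UC.
  exact: UC.
by move=> x /CO [].
Qed.

Lemma joined_closure O a b : open O -> O b -> D b ->
  closure [set c | joined (D `&` O) a c] b -> joined (D `&` O) a b.
Proof.
move=> oO Ob Db clb; have [U [oU Ub UJ]] := joined_open oO Db Ob.
have [c [/= ac Uc]] := clb _ (open_nbhs_nbhs (conj oU Ub)).
apply: (joined_trans ac); apply: joined_sym; apply: UJ => //.
by have [_ []] := joined_mem ac.
Qed.

Lemma joined_rel_open O a : open O ->
  exists2 U, open U & [set b | joined (D `&` O) a b] = U `&` D.
Proof.
move=> oO.
pose P U := open U /\ forall w, U w -> D w -> joined (D `&` O) a w.
exists (\bigcup_(U in P) U); first by apply: bigcup_open => U [].
apply/seteqP; split=> b /=; last by move=> [[U [_ UJ] Ub] Db]; exact: UJ.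
move=> ab; have [_ [Db Ob]] := joined_mem ab; split=> //.
have [U [oU Ub UJ]] := joined_open oO Db Ob.
by exists U => //; split=> // w Uw Dw; apply: (joined_trans ab); exact: UJ.
Qed.

Hypothesis nD : connected D.

(** Otherwise the class of [b] would be open and closed in the connected set [D]. *)
Lemma joined_touch F b : closed F -> F `<=` D -> F !=set0 -> D b -> ~ F b ->
  closure [set c | joined (D `&` ~` F) b c] `&` F !=set0.
Proof.
move=> cF FD [f Ff] Db nFb; apply: contrapT => E.
have oO : open (~` F) by exact: closed_openC.
have [U oU UE] := joined_rel_open b oO.
have Wc : closed [set c | joined (D `&` ~` F) b c].
  move=> c Wc; apply: joined_closure => //; first by move=> Fc; apply: E; exists c.
  by move: c Wc; apply: closure_sub_closed => // x xc; have [_ []] := joined_mem xc.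
have := connected_closed_meet nD Wc (open_closedC oU).
case.
- move=> x Dx; have [Ux|nU] := pselect (U x); [left|by right].
  by rewrite UE.
- by exists b; split=> //; apply: joined_refl.
- exists f; split; [exact: FD | move=> Uf].
  have : [set c | joined (D `&` ~` F) b c] f by rewrite UE; split=> //; exact: FD.
  by move=> xc; have [_ []] := joined_mem xc.
- by move=> x [[Dx]]; rewrite UE => -[].
Qed.

Hypothesis uD : unicoherent D.

(** Let [V] be the class of [x] off [X] and [U'] the class of [y] off [closure V]. Then [closure U']
    and [D] minus [U'] are connected and cover [D], so by unicoherence the frontier they share is
    connected. It lies in [X] and separates, and the component of [X] containing it is the one
    sought. *)
Lemma separating_component X x y : closed X -> X `<=` D -> D x -> D y -> ~ X x -> ~ X y ->
  ~ joined (D `&` ~` X) x y ->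
  exists2 t, X t & ~ joined (D `&` ~` connected_component X t) x y.
Proof.
move=> cX XD Dx Dy nXx nXy nxy.
have oX : open (~` X) by exact: closed_openC.
pose V := [set b | joined (D `&` ~` X) x b].
have VD : V `<=` D by move=> b yb; have [_ []] := joined_mem yb.
have Vx : V x by apply: joined_refl.
have cVD : closure V `<=` D by exact: closure_sub_closed.
have cV : closed (closure V) by exact: closed_closure.
have oV : open (~` closure V) by exact: closed_openC.
have nVy : ~ closure V y by move=> /(joined_closure oX nXy Dy).
have ncx : closure V x by exact: subset_closure.
pose U' := [set b | joined (D `&` ~` closure V) y b].
have U'y : U' y by apply: joined_refl.
have U'D : U' `<=` D by move=> b yb; have [_ []] := joined_mem yb.
have [U oU U'E] := joined_rel_open y oV.
have [W oW WE] := joined_rel_open x oX.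
pose A := closure U'; pose B := D `&` ~` U.
have BE : B = D `\` U'.
  rewrite /U' U'E /B; apply/seteqP; split=> b [Db nb]; split=> //; first by case.
  by move=> Ub; apply: nb.
have cB : closed B by apply: closedI => //; exact: open_closedC.
have nA : connected A by apply: connected_closure; apply: connected_joined.
have AD : A `<=` D by exact: closure_sub_closed.
have cVB : closure V `<=` B.
  by rewrite BE => b Vb; split; [exact: cVD | move=> xc; have [_ [_]] := joined_mem xc].
(* Every class off [closure V] other than [U'] has a closure touching [closure V], so all of them
   hang on this connected set. *)
have nB : connected B.
  apply: (@connected_sub_cover _ (closure V)) => //; last by exists x.
    by apply: connected_closure; apply: connected_joined.
  move=> b Bb; have [Vb|nVb] := pselect (closure V b).
    exists (closure V); last by split=> //; split=> //; exists b.
    by apply: connected_closure; apply: connected_joined.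
  have Db : D b by case: Bb.
  exists (closure [set c | joined (D `&` ~` closure V) b c]).
    by apply: connected_closure; apply: connected_joined.
  split; first by apply: subset_closure; apply: joined_refl.
  split; last first.
    by apply: joined_touch => //; exists x.
  apply: closure_sub_closed => //.
  move=> c bc; rewrite BE; split; first by have [_ []] := joined_mem bc.
    move=> yc; move: Bb; rewrite BE => -[_]; apply.
    exact: joined_trans yc (joined_sym bc).
have ABD : A `|` B = D.
  apply/seteqP; split=> b; first by move=> [/AD|[]].
  move=> Db; have [Ub|nUb] := pselect (U' b); first by left; exact: subset_closure.
  by right; rewrite BE.
have nN := uD (@closed_closure _ U') cB nA nB ABD.
have NX : A `&` B `<=` X.
  move=> b [Ab Bb]; have Db : D b by case: Bb.
  have nU'b : ~ U' b by move: Bb; rewrite BE => -[].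
  have Vb : closure V b.
    by apply: contrapT => nVb; apply: nU'b; apply: joined_closure.
  apply: contrapT => nXb.
  have : V b by apply: joined_closure.
  rewrite /V WE => -[Wb _].
  have [c [U'c Wc]] := Ab _ (open_nbhs_nbhs (conj oW Wb)).
  have [_ [Dc nVc]] := joined_mem U'c; apply: nVc; apply: subset_closure.
  by rewrite /V WE.
have [t Nt] : A `&` B !=set0.
  have := connected_closed_meet nD (@closed_closure _ U') cB.
  case=> [|||t [[_ At] Bt]]; last by exists t.
  - by rewrite -ABD.
  - by exists y; split=> //; exact: subset_closure.
  - by exists x; split=> //; exact: cVB.
exists t; first exact: NX.
move=> [C [[_ nC] Cx Cy CO]].
have := connected_closed_meet nC (@closed_closure _ U') cB.
case=> [|||c [[Cc Ac] Bc]].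
- by move=> c /CO [Dc _]; rewrite -/A; have : (A `|` B) c by rewrite ABD.
- by exists y; split=> //; exact: subset_closure.
- by exists x; split=> //; exact: cVB.
have [_] := CO c Cc; apply.
by apply: (@connected_component_max _ X (A `&` B)).
Qed.

End LC.
End Joined.

(** * Plane topology *)

Section Angle.
Variable R : realType.
Implicit Types u v t : R.

(** [t] is an argument of the nonzero vector [(u, v)]; a relation, since it is determined only
    modulo a full turn. *)
Definition is_angle u v t := exists2 r, 0 < r & u = r * cos t /\ v = r * sin t.

Lemma is_angle_mul u v t u' v' t' : is_angle u v t -> is_angle u' v' t' ->
  is_angle (u * u' - v * v') (u * v' + v * u') (t + t').
Proof.
move=> [r r0 [-> ->]] [r' r'0 [-> ->]]; exists (r * r'); first exact: mulr_gt0.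
by rewrite cosD sinD; split; ring.
Qed.

Lemma is_angle_conj u v t : is_angle u v t -> is_angle u (- v) (- t).
Proof.
move=> [r r0 [-> ->]]; exists r => //.
by rewrite cosN sinN mulrN.
Qed.

Lemma is_angle_scale c u v t : 0 < c -> is_angle u v t -> is_angle (c * u) (c * v) t.
Proof.
by move=> c0 [r r0 [-> ->]]; exists (c * r); [exact: mulr_gt0|rewrite !mulrA].
Qed.

Lemma is_angle_atan u v : 0 < u -> is_angle u v (atan (v / u)).
Proof.
move=> u0; have [/andP[h1 h2] h3] := atan_def (v / u).
have c0 : 0 < cos (atan (v / u)) by apply: cos_gt0_pihalf; apply/andP.
exists (u / cos (atan (v / u))); first exact: divr_gt0.
split; first by rewrite divfK // gt_eqF.
by rewrite -mulrA [_^-1 * _]mulrC -/(tan _) h3 mulrC divfK // gt_eqF.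
Qed.

Lemma is_angle_exists u v : u != 0 \/ v != 0 -> exists t, is_angle u v t.
Proof.
have [u0 _|u0 _|-> []//] := ltgtP u 0; last first.
  move=> v0; have [h|h|h] := ltgtP v 0.
  - exists (- (pi / 2)); exists (- v); first by rewrite oppr_gt0.
    by rewrite cosN sinN cos_pihalf sin_pihalf mulr0 mulrNN mulr1.
  - by exists (pi / 2); exists v => //; rewrite cos_pihalf sin_pihalf mulr0 mulr1.
  - by rewrite h eqxx in v0.
- by exists (atan (v / u)); exact: is_angle_atan.
- exists (atan (- v / - u) + pi).
  have [r r0 [h1 h2]] : is_angle (- u) (- v) (atan (- v / - u)).
    by apply: is_angle_atan; rewrite oppr_gt0.
  exists r => //; rewrite (cosDpi _) (sinDpi _).
  by rewrite !mulrN -h1 -h2 !opprK.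
Qed.

Lemma is_angle_uniq u v t t' : is_angle u v t -> is_angle u v t' -> cos (t - t') = 1.
Proof.
move=> [r r0 [h1 h2]] [r' r'0 [h3 h4]].
have := is_angle_mul (ex_intro2 _ _ r r0 (conj h1 h2))
  (is_angle_conj (ex_intro2 _ _ r' r'0 (conj h3 h4))).
move=> [s s0 [e1 e2]].
have q : 0 < u * u - v * - v.
  rewrite mulrN opprK -!expr2 h1 h2 !exprMn -mulrDr cos2Dsin2 mulr1.
  by rewrite exprn_gt0.
have sin0 : sin (t - t') = 0.
  move: e2; rewrite mulrN [v * u]mulrC addrC subrr => /esym/eqP.
  by rewrite mulf_eq0 (gt_eqF s0) /= => /eqP.
have c2 := cos2Dsin2 (t - t'); move: c2; rewrite sin0 expr0n addr0 => c2.
have : 0 < cos (t - t') by rewrite -(pmulr_rgt0 _ s0) -e1.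
have /eqP := c2; rewrite sqrf_eq1 => /orP[/eqP //|/eqP ->].
by rewrite oppr_gt0 ltr10.
Qed.

Lemma cos_eq1_uniq t : 0 < t <= pi -> cos t < 1.
Proof.
move=> /andP[t0 tp]; rewrite lt_neqAle cos_le1 andbT; apply/eqP => c1.
have := @cos_inj R t 0; rewrite !in_itv /= lexx (ltW t0) tp pi_ge0 cos0 c1.
by move=> /(_ isT isT erefl) t00; rewrite t00 ltxx in t0.
Qed.

(** The values are multiples of a full turn, while the image of a connected set is an interval: two
    different values would force a value less than half a turn above one of them. *)
Lemma cos_eq1_constant (T : topologicalType) (A : set T) (f : T -> R) :
  connected A -> {within A, continuous f} -> (forall x, A x -> cos (f x) = 1) ->
  forall x y, A x -> A y -> f x = f y.
Proof.
move=> nA cf f1.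
suff H x y : A x -> A y -> ~ f x < f y.
  move=> x y Ax Ay; have := H _ _ Ax Ay; have := H _ _ Ay Ax.
  by case: ltgtP.
move=> Ax Ay xy.
pose d := Num.min (f y - f x) pi.
have d0 : 0 < d by rewrite /d lt_min subr_gt0 xy pi_gt0.
have dy : d <= f y - f x by rewrite /d ge_min lexx.
have dp : d <= pi by rewrite /d ge_min lexx orbT.
have : connected (f @` A) by exact: connected_continuous_connected.
move/connected_intervalP => I.
have : (f @` A) (f x + d / 2).
  apply: (I (f x) (f y)); [by exists x | by exists y|].
  by apply/andP; split; lra.
move=> [z Az fz]; have := f1 z Az; rewrite fz cosD (f1 x Ax) mul1r.
have s0 : sin (f x) = 0.
  have := cos2Dsin2 (f x); rewrite (f1 x Ax) expr1n => /eqP.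
  by rewrite -subr_eq0 addrAC subrr add0r sqrf_eq0 => /eqP.
rewrite s0 mul0r subr0 => c.
have : cos (d / 2) < 1 by apply: cos_eq1_uniq; apply/andP; split; lra.
by rewrite c ltxx.
Qed.

Lemma continuous_angle_diff_constant (T : topologicalType) (A : set T) (f g : T -> R)
    (u v : T -> R) :
  connected A -> {within A, continuous f} -> {within A, continuous g} ->
  (forall x, A x -> is_angle (u x) (v x) (f x)) ->
  (forall x, A x -> is_angle (u x) (v x) (g x)) ->
  forall x y, A x -> A y -> f x - g x = f y - g y.
Proof.
move=> nA cf cg af ag.
apply: (@cos_eq1_constant T A (fun x => f x - g x)) => //.
  by move=> x; apply: cvgB; [exact: cf|exact: cg].
by move=> x Ax; exact: is_angle_uniq (af x Ax) (ag x Ax).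
Qed.

End Angle.

(** * Lifting the angle of a nowhere zero plane map *)

Section Lift.
Variable R : realType.
Local Notation P := (R * R)%type.

(** Uniform continuity along rays over a compact square: with a fine enough subdivision, consecutive
    values have positive scalar product, so they differ by less than a quarter turn and [atan] gives
    the increment of the angle. *)
Lemma angle_lift_step (g : P -> P) : continuous g -> (forall z, g z != 0) ->
  forall r : R, exists n : nat, forall (z : P) (t s : R), `|z| <= r -> 0 <= t <= 1 ->
    `|s - t| <= n.+1%:R^-1 ->
    0 < (g (t *: z)).1 * (g (s *: z)).1 + (g (t *: z)).2 * (g (s *: z)).2.
Proof.
move=> cg g0 r.
pose h (w : P * R * R) := (g (w.1.2 *: w.1.1)).1 * (g (w.2 *: w.1.1)).1
   + (g (w.1.2 *: w.1.1)).2 * (g (w.2 *: w.1.1)).2.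
have ch : continuous h.
  move=> w.
  have c1 : continuous (fun w : P * R * R => g (w.1.2 *: w.1.1)).
    move=> x; apply: (@continuous_comp _ _ _ (fun w : P * R * R => w.1.2 *: w.1.1) g).
      apply: (@cvgZ _ _ _ _ _ (fun w : P * R * R => w.1.2) (fun w => w.1.1)).
        by apply: (@continuous_comp _ _ _ fst snd); [exact: cvg_fst|exact: cvg_snd].
      by apply: (@continuous_comp _ _ _ fst fst); [exact: cvg_fst|exact: cvg_fst].
    exact: cg.
  have c2 : continuous (fun w : P * R * R => g (w.2 *: w.1.1)).
    move=> x; apply: (@continuous_comp _ _ _ (fun w : P * R * R => w.2 *: w.1.1) g).
      apply: (@cvgZ _ _ _ _ _ (fun w : P * R * R => w.2) (fun w => w.1.1)).
        exact: cvg_snd.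
      by apply: (@continuous_comp _ _ _ fst fst); [exact: cvg_fst|exact: cvg_fst].
    exact: cg.
  apply: cvgD; apply: cvgM.
  - by apply: (@continuous_comp _ _ _ _ fst); [exact: c1|exact: cvg_fst].
  - by apply: (@continuous_comp _ _ _ _ fst); [exact: c2|exact: cvg_fst].
  - by apply: (@continuous_comp _ _ _ _ snd); [exact: c1|exact: cvg_snd].
  - by apply: (@continuous_comp _ _ _ _ snd); [exact: c2|exact: cvg_snd].
have hpos z t : 0 < h (z, t, t).
  rewrite /h /= -!expr2.
  have := g0 (t *: z); case: (g _) => a b /=.
  rewrite -pair_eqE /pair_eq /= negb_and => ab.
  rewrite lt_neqAle addr_ge0 ?sqr_ge0 // andbT eq_sym paddr_eq0 ?sqr_ge0 //.
  by rewrite !sqrf_eq0 negb_and.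
pose K := ((`[- r, r] `*` `[- r, r]) `*` `[0, 1] : set (P * R))%classic.
have cK : compact K.
  by apply: compact_setX; [apply: compact_setX|]; exact: segment_compact.
pose Q (n : nat) (w : P * R) :=
  forall s, `|s - w.2| <= n.+1%:R^-1 -> 0 < h (w, s).
have : \forall n \near \oo, K `<=` Q n.
  apply: ((compact_near_coveringP K).1 cK nat \oo Q _) => -[z t] Kzt.
  have [e e0 He] : exists2 e : R, 0 < e &
      forall z' t' s, `|z - z'| < e -> `|t - t'| < e -> `|t - s| < e -> 0 < h (z', t', s).
    have : \forall w \near (z, t, t), 0 < h w.
      apply: (ch (z, t, t) [set x | 0 < x]); apply: open_nbhs_nbhs.
      by split; [exact: open_gt | exact: hpos].
    move=> /nbhs_ballP [e /= e0 He]; exists e => // z' t' s h1 h2 h3.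
    by apply: He; split; [split|]; rewrite -?ball_normE.
  have e2 : 0 < e / 2 by rewrite divr_gt0.
  exists ([set w | `|z - w.1| < e /\ `|t - w.2| < e / 2],
          [set n | n.+1%:R^-1 < e / 2]).
    split; last exact: near_infty_natSinv_lt (PosNum e2).
    apply/nbhs_ballP; exists (e / 2) => //= w [/= h1 h2].
    rewrite -ball_normE /= in h1; rewrite -ball_normE /= in h2.
    by split => //; apply: (lt_le_trans h1); lra.
  move=> [w n] /= [[h1 h2] h3] s sw; case: w h1 h2 sw => z' t' /= h1 h2 sw.
  apply: He => //; first by apply: (lt_le_trans h2); lra.
  rewrite (_ : t - s = (t - t') - (s - t')); last by ring.
  apply: (le_lt_trans (ler_normB _ _)).
  by rewrite (splitr e) ltrD // (le_lt_trans sw).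
move=> [n _ Hn]; exists n => z t s zr t01 st.
have := Hn n (leqnn n) (z, t); apply => //.
split; last by rewrite /= in_itv.
case: z zr => a b /=; rewrite /Num.norm /= ge_max => /andP[h1 h2].
by split => /=; rewrite in_itv /= -ler_norml.
Qed.

Lemma continuous_scale_arg (g : P -> P) (c : R) : continuous g ->
  continuous (fun z : P => g (c *: z)).
Proof.
move=> cg x; apply: (@continuous_comp _ _ _ (fun z : P => c *: z) g); last exact: cg.
by apply: cvgZr; exact: cvg_id.
Qed.

Lemma continuous_fst (T : topologicalType) (g : T -> P) : continuous g ->
  continuous (fun z => (g z).1).
Proof. by move=> cg x; apply: (@continuous_comp _ _ _ g fst); [exact: cg | exact: cvg_fst]. Qed.

Lemma continuous_snd (T : topologicalType) (g : T -> P) : continuous g ->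
  continuous (fun z => (g z).2).
Proof. by move=> cg x; apply: (@continuous_comp _ _ _ g snd); [exact: cg | exact: cvg_snd]. Qed.

(** The angle at [z] is the one at the origin plus the increments along a subdivision of the segment
    from the origin to [z]. Each increment is the arctangent of cross product over scalar product,
    hence continuous in [z]. *)
Lemma angle_lift (g : P -> P) : continuous g -> (forall z, g z != 0) ->
  forall r : R, exists th : P -> R, forall z, `|z| <= r ->
    is_angle (g z).1 (g z).2 (th z) /\ {for z, continuous th}.
Proof.
move=> cg g0 r; have [n Hn] := angle_lift_step cg g0 r.
pose N : R := n.+1%:R.
have N0 : 0 < N by rewrite ltr0n.
pose p (k : nat) (z : P) := g ((k%:R / N) *: z).
pose dot k z := (p k z).1 * (p k.+1 z).1 + (p k z).2 * (p k.+1 z).2.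
pose cross k z := (p k z).1 * (p k.+1 z).2 - (p k z).2 * (p k.+1 z).1.
have [t0 Ht0] : exists t0, is_angle (g 0).1 (g 0).2 t0.
  apply: is_angle_exists; apply/orP; have := g0 0.
  by case: (g 0) => a b; rewrite -pair_eqE /pair_eq /= negb_and.
pose th k z := t0 + \sum_(i < k) atan (cross i z / dot i z).
have dot0 k z : (k < n.+1)%N -> `|z| <= r -> 0 < dot k z.
  move=> kn zr; apply: Hn => //.
    rewrite divr_ge0 ?ler0n // ?(ltW N0) //= ler_pdivrMr // mul1r ler_nat.
    exact: ltnW.
  rewrite -mulrBl -natr1 addrAC subrr add0r mul1r ger0_norm //.
  by rewrite invr_ge0 ltW.
have Hth k z : (k <= n.+1)%N -> `|z| <= r -> is_angle (p k z).1 (p k z).2 (th k z).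
  move=> + zr; elim: k => [|k IH] kn.
    by rewrite /p /th mul0r scale0r big_ord0 addr0.
  have d0 := dot0 k z kn zr.
  rewrite /th big_ord_recr /= addrA -/(th k z).
  (* In complex notation [dot + i cross] is the conjugate of the current value times the next one.
     Multiplying by the current value gives the next one up to the squared modulus, which is divided
     out. *)
  have := is_angle_mul (IH (ltnW kn)) (is_angle_atan (cross k z) d0).
  have q0 : 0 < (p k z).1 ^+ 2 + (p k z).2 ^+ 2.
    rewrite lt_neqAle addr_ge0 ?sqr_ge0 // andbT eq_sym paddr_eq0 ?sqr_ge0 //.
    rewrite !sqrf_eq0; have := g0 ((k%:R / N) *: z).
    by rewrite -/(p k z); case: (p k z) => a b.
  have qi : 0 < ((p k z).1 ^+ 2 + (p k z).2 ^+ 2)^-1 by rewrite invr_gt0.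
  move/(is_angle_scale qi); congr is_angle.
    rewrite mulrC; apply: (canLR (mulfK _)); first by rewrite gt_eqF.
    by rewrite /dot /cross; ring.
  rewrite mulrC; apply: (canLR (mulfK _)); first by rewrite gt_eqF.
  by rewrite /dot /cross; ring.
exists (th n.+1) => z zr; split.
  by have := Hth n.+1 z (leqnn _) zr; rewrite /p divff ?gt_eqF // scale1r.
have cp k : continuous (p k) by exact: continuous_scale_arg.
suff H k : (k <= n.+1)%N -> {for z, continuous (th k)} by exact: H.
elim: k => [|k IH] kn.
  rewrite (_ : th 0%N = cst t0); first exact: cvg_cst.
  by apply/funext => w; rewrite /th big_ord0 addr0.
rewrite (_ : th k.+1 = (fun w => th k w + atan (cross k w / dot k w))); last first.
  by apply/funext => w; rewrite /th big_ord_recr /= addrA.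
apply: cvgD; first exact: IH (ltnW kn).
apply: (@continuous_comp _ _ _ (fun z => cross k z / dot k z) (@atan R)); last first.
  exact: continuous_atan.
apply: cvgM.
  apply: cvgB; apply: cvgM.
  - exact: continuous_fst.
  - exact: continuous_snd.
  - exact: continuous_snd.
  - exact: continuous_fst.
apply: cvgV; first by rewrite gt_eqF // dot0.
apply: cvgD; apply: cvgM.
- exact: continuous_fst.
- exact: continuous_fst.
- exact: continuous_snd.
- exact: continuous_snd.
Qed.

End Lift.

Section Glue.
Variables (R : realType).

Lemma urysohn_function (T : pseudoMetricType R) (A B : set T) :
  closed A -> closed B -> A `&` B = set0 ->
  exists f : T -> R, [/\ continuous f, forall x, 0 <= f x <= 1,
    forall x, A x -> f x = 0 & forall x, B x -> f x = 1].
Proof.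
move=> cA cB AB.
have /(@uniform_separatorP T R) [f [cf f01 fA fB]] : uniform_separator A B.
  by apply: normal_uniform_separator => //; exact: (@pseudometric_normal R T).
exists f; split=> //.
- by move=> x; have : range f (f x) by []; move/f01; rewrite /= in_itv.
- by move=> x Ax; apply: fA; exists x.
- by move=> x Bx; apply: fB; exists x.
Qed.

Lemma closed_glue_continuous (T U : topologicalType) (A B : set T) (f g : T -> U) :
  closed A -> closed B -> A `|` B = setT -> continuous f -> continuous g ->
  (forall x, A x -> B x -> f x = g x) ->
  continuous (fun x => if `[< A x >] then f x else g x).
Proof.
move=> cA cB AB cf cg fg.
set h := fun x => _.
have : {within A `|` B, continuous h}.
  apply: withinU_continuous => //.
    apply: (@subspace_eq_continuous T A U f h); last exact: continuous_subspaceT.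
    by move=> x /set_mem Ax; rewrite /h; case: asboolP.
  apply: (@subspace_eq_continuous T B U g h); last exact: continuous_subspaceT.
  by move=> x /set_mem Bx; rewrite /h; case: asboolP => // Ax; rewrite fg.
by rewrite AB => H; apply/continuous_subspace_setT.
Qed.

End Glue.

(** * Unicoherence of the disc and of the square *)

Section UnitDisc.
Variable R : realType.
Local Notation P := (R * R)%type.
Implicit Types z w : P.

(** The norm on [R * R] is the sup norm, so the round disc is defined by the sum of squares. *)
Definition sqn z : R := z.1 ^+ 2 + z.2 ^+ 2.
Definition disc : set P := [set z | sqn z <= 1].
Definition retract z : P := (Num.sqrt (Num.max 1 (sqn z)))^-1 *: z.

Lemma plane_hausdorff : hausdorff_space P.
Proof. exact: norm_hausdorff. Qed.

Lemma sqn_continuous : continuous sqn.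
Proof.
move=> z; apply: cvgD; apply: (@continuous_comp _ _ _ _ (fun x : R => x ^+ 2)).
- exact: cvg_fst.
- exact: exprn_continuous.
- exact: cvg_snd.
- exact: exprn_continuous.
Qed.

Lemma sqn_ge0 z : 0 <= sqn z.
Proof. by rewrite addr_ge0 ?sqr_ge0. Qed.

Lemma sqn_gt0 z : z != 0 -> 0 < sqn z.
Proof.
move=> z0; rewrite lt_neqAle sqn_ge0 andbT eq_sym /sqn paddr_eq0 ?sqr_ge0 //.
by move: z0; case: z => a b; rewrite -pair_eqE /pair_eq /= !sqrf_eq0.
Qed.

Lemma disc_closed : closed disc.
Proof.
have : closed (sqn @^-1` [set x | x <= 1]).
  by apply: (continuous_closedP _).1; [exact: sqn_continuous | exact: closed_le].
by [].
Qed.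

Lemma sup_box_compact (r : R) : compact ((`[- r, r] `*` `[- r, r])%classic : set P).
Proof. by apply: compact_setX; exact: segment_compact. Qed.

Lemma disc_box : disc `<=` ((`[-1, 1] `*` `[-1, 1])%classic : set P).
Proof.
move=> [a b]; rewrite /disc /sqn /= => h.
by split => /=; rewrite in_itv /=; apply/andP; split; nra.
Qed.

Lemma disc_norm z : disc z -> `|z| <= 1.
Proof.
move/disc_box; case: z => a b [/=]; rewrite !in_itv /= => h1 h2.
by rewrite /Num.norm /= ge_max !ler_norml h1 h2.
Qed.

Lemma disc_compact : compact disc.
Proof.
apply: (subclosed_compact _ (@sup_box_compact 1)); first exact: disc_closed.
exact: disc_box.
Qed.

Definition convex_subset (A : set P) := forall z w (t : R), A z -> A w -> 0 <= t <= 1 ->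
  A (z + t *: (w - z)).

Lemma disc_convex : convex_subset disc.
Proof.
move=> [a b] [c d] t; rewrite /disc /sqn /= => h1 h2 /andP[t0 t1].
rewrite /GRing.scale /=.
have : (a + t * (c - a)) ^+ 2 + (b + t * (d - b)) ^+ 2 =
  (1 - t) * (a ^+ 2 + b ^+ 2) + t * (c ^+ 2 + d ^+ 2)
   - t * (1 - t) * ((a - c) ^+ 2 + (b - d) ^+ 2) by ring.
move=> ->.
have : 0 <= t * (1 - t) * ((a - c) ^+ 2 + (b - d) ^+ 2).
  by rewrite mulr_ge0 // ?addr_ge0 ?sqr_ge0 // mulr_ge0 // subr_ge0.
nra.
Qed.

Lemma segment_continuum z w : continuum [set z + t *: (w - z) | t in `[0, 1]].
Proof.
have c : continuous (fun t : R => z + t *: (w - z)).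
  move=> t; apply: cvgD; first exact: cvg_cst.
  by apply: cvgZl; exact: cvg_id.
split.
  apply: continuous_compact; last exact: segment_compact.
  exact: continuous_subspaceT.
apply: connected_continuous_connected; last exact: continuous_subspaceT.
exact: segment_connected.
Qed.

Lemma convex_connected A : convex_subset A -> connected A.
Proof.
move=> cA; have [[z Az]|A0] := pselect (A !=set0); last first.
  rewrite (_ : A = set0); first exact: connected0.
  by apply/seteqP; split=> // x Ax; case: A0; exists x.
apply: (@connected_sub_cover _ [set z]) => //; last by exists z.
- exact: connected1.
- by move=> x ->.
move=> w Aw; exists [set z + t *: (w - z) | t in `[0, 1]].
  by case: (segment_continuum z w).
split.
  by exists 1; rewrite /= ?in_itv /= ?ler01 ?lexx // scale1r addrC subrK.
split.
  by move=> _ [t /= t01 <-]; apply: cA => //; move: t01; rewrite in_itv.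
exists z; split=> //; exists 0; rewrite /= ?in_itv /= ?ler01 ?lexx //.
by rewrite scale0r addr0.
Qed.

Lemma box_convex z (e : R) : convex_subset [set w | `|z - w| <= e].
Proof.
move=> u v t /= h1 h2 /andP[t0 t1].
have -> : z - (u + t *: (v - u)) = (1 - t) *: (z - u) + t *: (z - v).
  have E : (z - v) - (z - u) = u - v by rewrite opprB addrC addrA subrK.
  rewrite opprD addrA -scalerN opprB -E scalerBl scale1r [t *: (_ - _)]scalerBr.
  by rewrite addrA addrAC.
apply: (le_trans (ler_normD _ _)); rewrite !normrZ (ger0_norm t0) ger0_norm ?subr_ge0 //.
nra.
Qed.

Lemma convex_locally_continuum (K : set P) : compact K -> convex_subset K ->
  locally_continuum K.
Proof.
move=> cK vK.
move=> z O Dz oO Oz.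
have /nbhs_ballP [e /= e0 He] : nbhs z O by exact: open_nbhs_nbhs.
exists ([set w | `|z - w| <= e / 2] `&` K), (ball z (e / 2)).
have e2 : 0 < e / 2 by rewrite divr_gt0.
have cB : closed [set w : P | `|z - w| <= e / 2].
  have c : continuous (fun w : P => `|z - w|).
    move=> w; apply: (@continuous_comp _ _ _ (fun w => z - w) Num.norm).
      by apply: cvgB; [exact: cvg_cst | exact: cvg_id].
    exact: norm_continuous.
  exact: ((continuous_closedP _).1 c _ (@closed_le _ (e / 2))).
split.
- split.
    apply: (subclosed_compact _ cK); last by move=> x [].
    by apply: closedI => //; apply: compact_closed => //; exact: plane_hausdorff.
  apply: convex_connected => u v t [h1 h2] [h3 h4] t01; split.
    exact: (@box_convex z (e / 2)).
  exact: vK.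
- move=> w [/= h1 h2]; split=> //; apply: He; rewrite -ball_normE /=.
  by apply: (le_lt_trans h1); lra.
- exact: ball_open.
- exact: ballxx.
- by move=> w [+ h2]; rewrite -ball_normE /= => h1; split=> //=; exact: ltW.
Qed.

Lemma disc_locally_continuum : locally_continuum disc.
Proof. exact: convex_locally_continuum disc_compact disc_convex. Qed.

Lemma disc_connected : connected disc.
Proof. exact/convex_connected/disc_convex. Qed.

Lemma retract_continuous : continuous retract.
Proof.
move=> z; apply: cvgZ; last exact: cvg_id.
apply: cvgV.
  by rewrite sqrtr_eq0 -ltNge lt_max ltr01.
apply: (@continuous_comp _ _ _ (fun z => Num.max 1 (sqn z)) Num.sqrt); last first.
  exact: sqrt_continuous.
apply: continuous_max; [exact: cvg_cst | exact: sqn_continuous].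
Qed.

Lemma retract_disc z : disc (retract z).
Proof.
rewrite /disc /retract /sqn /= /GRing.scale /= !exprMn -mulrDr -/(sqn z).
rewrite exprVn sqr_sqrtr; last by rewrite le_max ler01.
by rewrite ler_pdivrMl ?lt_max ?ltr01 // mulr1 le_max lexx orbT.
Qed.

Lemma retract_id z : disc z -> retract z = z.
Proof.
by move=> Dz; rewrite /retract max_l // sqrtr1 invr1 scale1r.
Qed.

(** Suppose the intersection of [A] and [B] splits into [X] and [Y], and let [tau] be 0 on [X] and 1
    on [Y]. The map of angle [pi * tau] on [A] and [- (pi * tau)] on [B] is well defined, as the
    sine vanishes on the intersection. A lift differs from each of these functions by a constant, so
    from [X] to [Y] it would both gain and lose [pi]. *)
Lemma retract_unicoherent (K : set P) (rho : P -> P) : continuous rho ->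
  (forall z, K (rho z)) -> (forall z, K z -> rho z = z) ->
  (forall z, K z -> `|z| <= 1) -> unicoherent K.
Proof.
move=> crho rhoK rhoid K1.
move=> A B cA cB nA nB AB.
have AD : A `<=` K by rewrite -AB; left.
have BD : B `<=` K by rewrite -AB; right.
apply: connected_of_closed_split; first exact: closedI.
move=> X Y cX cY XY XY0 [x Xx] [y Yy].
have [tau [ct t01 tX tY]] := urysohn_function cX cY XY0.
pose s (z : P) := sin (pi * tau (rho z)).
have cs : continuous s.
  move=> z; apply: (@continuous_comp _ _ _ (fun z => pi * tau (rho z)) sin); last exact: continuous_sin.
  apply: cvgM; first exact: cvg_cst.
  by apply: (@continuous_comp _ _ _ rho tau); [exact: crho | exact: ct].
pose A' := (rho @^-1` A); pose B' := (rho @^-1` B).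
have cA' : closed A' by apply: (continuous_closedP _).1 => //; exact: crho.
have cB' : closed B' by apply: (continuous_closedP _).1 => //; exact: crho.
have AB' : A' `|` B' = setT.
  by apply/seteqP; split=> // z _; have := rhoK z; rewrite -AB.
pose g (z : P) := (cos (pi * tau (rho z)), if `[< A' z >] then s z else - s z).
have cg : continuous g.
  move=> z; apply: (@cvg_pair _ _ _ (nbhs z) (nbhs (g z).1) (nbhs (g z).2) _ _ _ (fun z => (g z).1) (fun z => (g z).2)).
    apply: (@continuous_comp _ _ _ (fun z => pi * tau (rho z)) cos); last exact: continuous_cos.
    apply: cvgM; first exact: cvg_cst.
    by apply: (@continuous_comp _ _ _ rho tau); [exact: crho | exact: ct].
  apply: (closed_glue_continuous cA' cB' AB' cs).
    by move=> w; apply: cvgN; exact: cs.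
  move=> w A'w B'w; have : (A `&` B) (rho w) by [].
  rewrite XY /s => -[/tX -> | /tY ->]; rewrite ?mulr0 ?mulr1 ?sin0 ?sinpi ?oppr0 //.
have g0 z : g z != 0.
  rewrite /g -pair_eqE /pair_eq /= negb_and.
  have := cos2Dsin2 (pi * tau (rho z)); rewrite -/(s z) => h.
  apply/orP; have [E|] := eqVneq (cos (pi * tau (rho z))) 0; [right|by left].
  move: h; rewrite E expr0n add0r => h.
  have s0 : s z != 0 by rewrite -sqrf_eq0 h oner_eq0.
  by case: asboolP => _; rewrite ?oppr_eq0.
have [th Hth] := angle_lift cg g0 1.
have cth C : C `<=` K -> {within C, continuous th}.
  move=> CD; apply: continuous_in_subspaceT => z /set_mem /CD /K1.
  by move/Hth => [].
have pt C : {within C, continuous (fun z => pi * tau z)}.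
  by apply: continuous_subspaceT => z; apply: cvgM; [exact: cvg_cst | exact: ct].
have pnt C : {within C, continuous (fun z => - (pi * tau z))}.
  by apply: continuous_subspaceT => z; apply: cvgN; apply: cvgM; [exact: cvg_cst | exact: ct].
have aA z : A z -> is_angle (g z).1 (g z).2 (pi * tau z).
  move=> Az; exists 1 => //; rewrite !mul1r /g /=.
  have rz : rho z = z by apply: rhoid; exact: AD.
  by case: asboolP; rewrite /A' /= rz // /s rz.
have aB z : B z -> is_angle (g z).1 (g z).2 (- (pi * tau z)).
  move=> Bz; exists 1 => //; rewrite !mul1r /g /= cosN sinN.
  have rz : rho z = z by apply: rhoid; exact: BD.
  case: asboolP; rewrite /A' /= rz /s rz // => Az.
  have : (A `&` B) z by [].
  by rewrite XY => -[/tX -> | /tY ->]; rewrite ?mulr0 ?mulr1 ?sin0 ?sinpi ?oppr0.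
have Xsub z : X z -> A z /\ B z by move=> Xz; have : (A `&` B) z by rewrite XY; left.
have Ysub z : Y z -> A z /\ B z by move=> Yz; have : (A `&` B) z by rewrite XY; right.
have [Ax Bx] := Xsub x Xx; have [Ay By] := Ysub y Yy.
have at_ C z : C `<=` K -> C z -> is_angle (g z).1 (g z).2 (th z).
  by move=> CD /CD /K1 /Hth [].
have := continuous_angle_diff_constant nA (cth A AD) (pt A) (fun z => at_ A z AD) aA Ax Ay.
have := continuous_angle_diff_constant nB (cth B BD) (pnt B) (fun z => at_ B z BD) aB Bx By.
rewrite (tX x Xx) (tY y Yy) !mulr0 !mulr1 oppr0 opprK !subr0.
move=> -> h; have := pi_gt0 R; move: h; lra.
Qed.

Lemma disc_unicoherent : unicoherent disc.
Proof.
exact: (retract_unicoherent retract_continuous retract_disc retract_id disc_norm).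
Qed.

Definition box : set P := [set z | `|z| <= 1].
Definition clamp1 (x : R) : R := Num.min 1 (Num.max (- 1) x).
Definition clamp z : P := (clamp1 z.1, clamp1 z.2).

Lemma boxE z : box z <-> (-1 <= z.1 <= 1) /\ (-1 <= z.2 <= 1).
Proof.
case: z => a b; rewrite /box /= /Num.norm /= ge_max !ler_norml.
by split => [/andP|] [-> ->].
Qed.

Lemma clamp1_continuous : continuous clamp1.
Proof.
move=> x.
have h : {for x, continuous ((cst (- 1) : R -> R^o) \max (id : R -> R^o))}.
  by apply: continuous_max; [exact: cvg_cst | exact: cvg_id].
have := @continuous_min R _ (cst 1 : R -> R^o) _ x (@cvg_cst _ _ _ _ _) h.
exact.
Qed.

Lemma clamp_continuous : continuous clamp.
Proof.
move=> z; apply: (@cvg_pair _ _ _ (nbhs z) (nbhs (clamp z).1) (nbhs (clamp z).2) _ _ _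
  (fun z : P => clamp1 z.1) (fun z : P => clamp1 z.2)).
  by apply: (@continuous_comp _ _ _ fst clamp1); [exact: cvg_fst | exact: clamp1_continuous].
by apply: (@continuous_comp _ _ _ snd clamp1); [exact: cvg_snd | exact: clamp1_continuous].
Qed.

Lemma clamp_box z : box (clamp z).
Proof.
apply/boxE; rewrite /clamp /clamp1 /=; have h : -1 <= 1 :> R by lra.
by rewrite !ge_min !le_min !le_max !lexx !h.
Qed.

Lemma clamp_id z : box z -> clamp z = z.
Proof.
move=> /boxE [/andP[h1 h2] /andP[h3 h4]]; case: z h1 h2 h3 h4 => a b /= *.
by rewrite /clamp /clamp1 /= !max_r // !min_r.
Qed.

Lemma box_unicoherent : unicoherent box.
Proof.
exact: (retract_unicoherent clamp_continuous clamp_box clamp_id).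
Qed.

Lemma box_compact : compact box.
Proof.
have -> : box = ((`[-1, 1] `*` `[-1, 1])%classic : set P).
  apply/seteqP; split=> z; first by move/boxE => [h1 h2]; split => /=; rewrite in_itv.
  by move=> [/=]; rewrite !in_itv /= => h1 h2; apply/boxE.
exact: sup_box_compact.
Qed.

Lemma box_is_convex : convex_subset box.
Proof.
move=> z w t; have := @box_convex 0 1 z w t; rewrite /= !sub0r !normrN; exact.
Qed.

End UnitDisc.

(** * Crossing of continua in the disc *)

Section Crossing.
Variable R : realType.
Local Notation P := (R * R)%type.
Local Notation Box := (@box R).
Local Notation Disc := (@disc R).
Implicit Types (z w p q a b : P) (S O X Y : set P).

Lemma connected_zero (T : topologicalType) (C : set T) (u : T -> R) x y :
  connected C -> continuous u -> C x -> C y -> u x < 0 -> 0 < u y ->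
  exists2 z, C z & u z = 0.
Proof.
move=> nC cu Cx Cy ux uy; apply: contrapT => nz.
have o1 : open (u @^-1` [set t | t < 0]) by apply: open_comp => // *; exact: cu.
have o2 : open (u @^-1` [set t | 0 < t]).
  by apply: open_comp; [move=> *; exact: cu | exact: open_gt].
have := connected_open_meet nC o1 o2.
case=> [|||z [[_ /= h1] h2]].
- move=> z Cz; have [h|h|h] := ltgtP (u z) 0; [by left|by right|].
  by case: nz; exists z.
- by exists x.
- by exists y.
- by move: (lt_trans h1 h2); rewrite ltxx.
Qed.

(** The zero set of [u] separates the left side from the right side, hence by unicoherence one of
    its components does. This component must meet the lower and the upper edge, so [v] changes sign
    on it. *)
Lemma poincare_miranda (u v : P -> R) : continuous u -> continuous v ->
  (forall y : R, -1 <= y <= 1 -> u (-1, y) < 0) -> (forall y : R, -1 <= y <= 1 -> 0 < u (1, y)) ->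
  (forall x : R, -1 <= x <= 1 -> v (x, -1) < 0) -> (forall x : R, -1 <= x <= 1 -> 0 < v (x, 1)) ->
  exists z, [/\ Box z, u z = 0 & v z = 0].
Proof.
move=> cu cv ul ur vb vt.
have m1 : -1 <= (-1 : R) <= 1 by apply/andP; lra.
have p1 : -1 <= (1 : R) <= 1 by apply/andP; lra.
have m0 : -1 <= (0 : R) <= 1 by apply/andP; lra.
pose X := Box `&` u @^-1` [set 0].
have hP := @plane_hausdorff R.
have cX : closed X.
  apply: closedI; first by apply: compact_closed => //; exact: box_compact.
  by apply: (continuous_closedP _).1 => //; exact: closed_eq.
have Xbox : X `<=` Box by move=> z [].
have lbox := convex_locally_continuum (@box_compact R) (@box_is_convex R).
have bl : Box (-1, 0) by apply/boxE.
have br : Box (1, 0) by apply/boxE.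
have nl y : -1 <= y <= 1 -> ~ X (-1, y).
  by move=> hy [_ /= E]; have := ul y hy; rewrite E ltxx.
have nr y : -1 <= y <= 1 -> ~ X (1, y).
  by move=> hy [_ /= E]; have := ur y hy; rewrite E ltxx.
have nj : ~ joined (Box `&` ~` X) (-1, 0) (1, 0).
  move=> [C [[_ nC] Cl Cr CX]].
  have [z Cz uz] := connected_zero nC cu Cl Cr (ul 0 m0) (ur 0 m0).
  by have [bz] := CX z Cz; apply.
have [t Xt nt] := separating_component hP (@box_compact R) lbox
  (convex_connected (@box_is_convex R)) (@box_unicoherent R) cX Xbox bl br
  (nl 0 m0) (nr 0 m0) nj.
pose K := connected_component X t.
have KX : K `<=` X by exact: connected_component_sub.
(* a horizontal edge missed by K would join the two sides *)
have edge y : -1 <= y <= 1 -> exists2 x, -1 <= x <= 1 & K (x, y).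
  move=> hy; apply: contrapT => ne; apply: nt.
  have seg z w : Box z -> Box w ->
      (forall s, 0 <= s <= 1 -> ~ K (z + s *: (w - z))) -> joined (Box `&` ~` K) z w.
    move=> bz bw h; exists [set z + s *: (w - z) | s in `[0, 1]]; split.
    - exact: segment_continuum.
    - by exists 0; rewrite /= ?in_itv /= ?lexx ?ler01 // scale0r addr0.
    - by exists 1; rewrite /= ?in_itv /= ?lexx ?ler01 // scale1r addrC subrK.
    - move=> _ [s /= + <-]; rewrite in_itv /= => hs; split; last exact: h.
      exact: box_is_convex.
  have j1 : joined (Box `&` ~` K) (-1, 0) (-1, y).
    apply: seg => //; first exact/boxE.
    move=> s hs /KX [bz h].
    apply: (nl (0 + s * (y - 0))); first by move: bz => /boxE [_].
    have E : (-1, 0) + s *: ((-1, y) - (-1, 0)) = (-1, 0 + s * (y - 0)) :> P.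
      by apply: injective_projections => /=; rewrite /GRing.scale /=; ring.
    by rewrite -E.
  have j2 : joined (Box `&` ~` K) (-1, y) (1, y).
    apply: seg; [exact/boxE|exact/boxE|] => s hs Ks; apply: ne.
    have /KX [/boxE [h _] _] := Ks.
    exists (-1 + s * (1 - -1)) => //.
    have E : (-1, y) + s *: ((1, y) - (-1, y)) = (-1 + s * (1 - -1), y) :> P.
      by apply: injective_projections => /=; rewrite /GRing.scale /=; ring.
    by rewrite -E.
  have j3 : joined (Box `&` ~` K) (1, y) (1, 0).
    apply: seg => //; first exact/boxE.
    move=> s hs /KX [bz h].
    apply: (nr (y + s * (0 - y))); first by move: bz => /boxE [_].
    have E : (1, y) + s *: ((1, 0) - (1, y)) = (1, y + s * (0 - y)) :> P.
      by apply: injective_projections => /=; rewrite /GRing.scale /=; ring.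
    by rewrite -E.
  exact: joined_trans j1 (joined_trans j2 j3).
have [x1 h1 K1] := edge _ m1; have [x2 h2 K2] := edge _ p1.
have [z Kz vz] := connected_zero (@component_connected _ X t) cv K1 K2 (vb _ h1) (vt _ h2).
by have [bz uz] := KX z Kz; exists z.
Qed.

(** The parameter interval is [[-1, 1]], so that a pair of paths gives a map on the square of
    [poincare_miranda]. Continuity is asked on all of [R], which costs nothing and avoids subspace
    topologies. *)
Definition pathin S a b := exists f : R -> P,
  [/\ continuous f, f (-1) = a, f 1 = b & forall t, -1 <= t <= 1 -> S (f t)].

Lemma pathin_sub S S' a b : S `<=` S' -> pathin S a b -> pathin S' a b.
Proof. by move=> SS [f [cf fa fb fS]]; exists f; split=> // t /fS /SS. Qed.

Lemma pathin_sym S a b : pathin S a b -> pathin S b a.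
Proof.
have aux (t : R) : -1 <= t <= 1 -> -1 <= - t <= 1 by move=> /andP[? ?]; apply/andP; lra.
move=> [f [cf fa fb fS]]; exists (fun t => f (- t)); rewrite opprK; split=> //.
  move=> t; apply: (@continuous_comp _ _ _ (fun t : R => - t) f); last exact: cf.
  exact: opp_continuous.
by move=> t /aux; exact: fS.
Qed.

Lemma pathin_trans S b a c : pathin S a b -> pathin S b c -> pathin S a c.
Proof.
have aux1 (t : R) : -1 <= t -> t <= 0 -> -1 <= 2 * t + 1 <= 1.
  by move=> *; apply/andP; lra.
have aux2 (t : R) : 0 < t -> t <= 1 -> -1 <= 2 * t - 1 <= 1.
  by move=> *; apply/andP; lra.
move=> [f [cf fa fb fS]] [g [cg gb gc gS]].
pose F (t : R) := f (2 * t + 1); pose G (t : R) := g (2 * t - 1).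
have cF : continuous F.
  move=> t; apply: (@continuous_comp _ _ _ (fun t : R => 2 * t + 1) f); last exact: cf.
  by apply: cvgD; [apply: cvgMl_tmp; exact: cvg_id | exact: cvg_cst].
have cG : continuous G.
  move=> t; apply: (@continuous_comp _ _ _ (fun t : R => 2 * t - 1) g); last exact: cg.
  by apply: cvgD; [apply: cvgMl_tmp; exact: cvg_id | exact: cvg_cst].
exists (fun t => if `[< [set t : R | t <= 0] t >] then F t else G t); split.
- apply: (closed_glue_continuous (B := [set t : R | 0 <= t])) => //.
  + by apply/seteqP; split=> // t _; case: (leP t 0) => h; [left|right => /=; exact: ltW].
  + move=> t /= h1 h2; have -> : t = 0 by apply/eqP; rewrite eq_le h1 h2.
    by rewrite /F /G mulr0 add0r sub0r fb gb.
- case: asboolP => /= h; last by case: h; rewrite lerN10.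
  by rewrite /F -fa; congr f; ring.
- case: asboolP => /= h; first by move: h; rewrite ler10.
  by rewrite /G -gc; congr g; ring.
- move=> t /andP[h1 h2]; case: asboolP => /= h; first by apply: fS; exact: aux1.
  by move/negP: h; rewrite -ltNge => h; apply: gS; exact: aux2.
Qed.

Lemma pathin_segment S a b : (forall t, 0 <= t <= 1 -> S (a + t *: (b - a))) -> pathin S a b.
Proof.
move=> H; exists (fun t : R => a + ((t + 1) / 2) *: (b - a)); split.
- move=> t; apply: cvgD; first exact: cvg_cst.
  apply: cvgZl; apply: cvgMr_tmp.
  by apply: cvgD; [exact: cvg_id | exact: cvg_cst].
- by rewrite addNr mul0r scale0r addr0.
- by rewrite -mulr2n -[1 *+ 2]/(2%:R) divff // scale1r addrC subrK.
- by move=> t /andP[h1 h2]; apply: H; apply/andP; lra.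
Qed.

Lemma pathin_refl S a : S a -> pathin S a a.
Proof. by move=> Sa; apply: pathin_segment => t _; rewrite subrr scaler0 addr0. Qed.

Lemma pathin_open S X a b : open S -> connected X -> X `<=` S -> X a -> X b -> pathin S a b.
Proof.
have m1 : -1 <= (1 : R) by lra.
move=> oS nX XS Xa Xb; apply: contrapT => nab.
have near_path z : S z -> exists2 e, 0 < e & forall w, ball z e w -> pathin S z w.
  move=> Sz; have /nbhs_ballP [e /= e0 He] : nbhs z S by exact: open_nbhs_nbhs.
  exists e => // w zw; apply: pathin_segment => t /andP[t0 t1]; apply: He.
  move: zw; rewrite -!ball_normE /= => zw; rewrite opprD addrA subrr sub0r normrN.
  rewrite normrZ ger0_norm // distrC.
  apply: le_lt_trans zw; rewrite -[leRHS]mul1r; exact: ler_wpM2r.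
have H (Q : set P) : (forall z w, Q z -> S w -> pathin S z w -> Q w) -> Q `<=` S -> open Q.
  move=> HQ QS; rewrite openE => z Qz; have [e e0 He] := near_path z (QS z Qz).
  apply/nbhs_ballP; exists e => // w /He zw; apply: (HQ z w Qz _ zw).
  by case: zw => f [_ _ <-]; apply; rewrite lexx m1.
have oA : open [set z | S z /\ pathin S a z].
  apply: H => [z w [_ az] Sw zw|z []//]; split=> //; exact: pathin_trans az zw.
have oB : open [set z | S z /\ ~ pathin S a z].
  apply: H => [z w [_ az] Sw zw|z []//]; split=> // aw; apply: az.
  exact: pathin_trans aw (pathin_sym zw).
have := connected_open_meet nX oA oB.
case=> [|||z [[_ [_ h1]] [_ h2]]] //.
- by move=> z Xz; case: (pselect (pathin S a z)); [left|right]; split=> //; exact: XS.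
- by exists a; split=> //; split; [exact: XS | apply: pathin_refl; exact: XS].
- by exists b; split=> //; split=> //; exact: XS.
Qed.

(** Up to the length of [q - p], [side] and [along] are the coordinates across and along the line
    from [p] to [q]; [side] is positive to its left. *)
Definition side p q z : R := (q.1 - p.1) * (z.2 - p.2) - (q.2 - p.2) * (z.1 - p.1).
Definition along p q z : R := (q.1 - p.1) * z.1 + (q.2 - p.2) * z.2.

Lemma side_continuous p q : continuous (side p q).
Proof.
move=> z; apply: cvgB; apply: cvgMl_tmp; apply: cvgB; try exact: cvg_cst.
- exact: cvg_snd.
- exact: cvg_fst.
Qed.

Lemma along_continuous p q : continuous (along p q).
Proof.
move=> z; apply: cvgD; apply: cvgMl_tmp; [exact: cvg_fst | exact: cvg_snd].
Qed.

Lemma side_disc_bound p q z : Disc p -> Disc q -> Disc z -> `|side p q z| <= 8.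
Proof.
move=> /disc_box [/=]; rewrite !in_itv /= => h1 h2.
move=> /disc_box [/=]; rewrite !in_itv /= => h3 h4.
move=> /disc_box [/=]; rewrite !in_itv /= => h5 h6.
have B (x y : R) : -1 <= x <= 1 -> -1 <= y <= 1 -> `|x - y| <= 2.
  by move=> /andP[? ?] /andP[? ?]; rewrite ler_norml; apply/andP; lra.
apply: (le_trans (ler_normB _ _)); rewrite !normrM.
have -> : 8 = 2 * 2 + 2 * 2 :> R by ring.
by apply: lerD; apply: ler_pM => //; exact: B.
Qed.

Lemma same_point p q z w : p != q -> side p q z = side p q w ->
  along p q z = along p q w -> z = w.
Proof.
move=> pq hs ha.
have pos : 0 < (q.1 - p.1) ^+ 2 + (q.2 - p.2) ^+ 2.
  rewrite lt_neqAle addr_ge0 ?sqr_ge0 // andbT eq_sym paddr_eq0 ?sqr_ge0 //.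
  rewrite !sqrf_eq0 !subr_eq0; apply/negP => /andP[/eqP h1 /eqP h2].
  by move/eqP: pq; apply; apply: injective_projections.
have nz : (q.1 - p.1) ^+ 2 + (q.2 - p.2) ^+ 2 != 0 by rewrite gt_eqF.
have e1 : ((q.1 - p.1) ^+ 2 + (q.2 - p.2) ^+ 2) * (z.1 - w.1) = 0.
  transitivity ((q.1 - p.1) * (along p q z - along p q w)
     - (q.2 - p.2) * (side p q z - side p q w)); first by rewrite /side /along; ring.
  by rewrite hs ha !subrr !mulr0 subrr.
have e2 : ((q.1 - p.1) ^+ 2 + (q.2 - p.2) ^+ 2) * (z.2 - w.2) = 0.
  transitivity ((q.2 - p.2) * (along p q z - along p q w)
     + (q.1 - p.1) * (side p q z - side p q w)); first by rewrite /side /along; ring.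
  by rewrite hs ha !subrr !mulr0 addr0.
move/eqP: e1; rewrite mulf_eq0 (negbTE nz) /= subr_eq0 => /eqP e1.
move/eqP: e2; rewrite mulf_eq0 (negbTE nz) /= subr_eq0 => /eqP e2.
exact: injective_projections.
Qed.

Lemma dot_le1 z w : sqn z <= 1 -> sqn w <= 1 -> z.1 * w.1 + z.2 * w.2 <= 1.
Proof.
rewrite /sqn => h1 h2.
have : 0 <= (z.1 - w.1) ^+ 2 + (z.2 - w.2) ^+ 2 by rewrite addr_ge0 ?sqr_ge0.
nra.
Qed.

Lemma outward_ray a m (s : R) : sqn a = 1 -> a.1 * m.1 + a.2 * m.2 <= 1 -> a != m ->
  0 < s -> ~ Disc (a + s *: (a - m)).
Proof.
move=> a1 am ne s0; rewrite /disc /= /sqn /=; apply/negP; rewrite -ltNge.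
have pos : 0 < (a.1 - m.1) ^+ 2 + (a.2 - m.2) ^+ 2.
  rewrite lt_neqAle addr_ge0 ?sqr_ge0 // andbT eq_sym paddr_eq0 ?sqr_ge0 //.
  rewrite !sqrf_eq0 !subr_eq0; apply/negP => /andP[/eqP h1 /eqP h2].
  by move/eqP: ne; apply; apply: injective_projections.
rewrite /GRing.scale /=; rewrite /sqn in a1.
have -> : (a.1 + s * (a.1 - m.1)) ^+ 2 + (a.2 + s * (a.2 - m.2)) ^+ 2 =
  (a.1 ^+ 2 + a.2 ^+ 2) + 2 * s * ((a.1 ^+ 2 + a.2 ^+ 2) - (a.1 * m.1 + a.2 * m.2)) +
   s ^+ 2 * ((a.1 - m.1) ^+ 2 + (a.2 - m.2) ^+ 2) by ring.
rewrite a1.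
have : 0 < s ^+ 2 * ((a.1 - m.1) ^+ 2 + (a.2 - m.2) ^+ 2).
  by rewrite mulr_gt0 // exprn_gt0.
have : 0 <= 2 * s * (1 - (a.1 * m.1 + a.2 * m.2)).
  by rewrite mulr_ge0 // ?subr_ge0 // mulr_ge0 // ltW.
by move: (_ * _) => x; move: (_ * _) => y; clear; lra.
Qed.

(** The set is not open in the plane; the path is found in the open preimage of [U] under [retract]
    and then retracted. *)
Lemma path_retract U p q X : open U -> connected X -> X `<=` U `&` Disc -> X p -> X q ->
  pathin (U `&` Disc) p q.
Proof.
move=> oU nX XU Xp Xq.
have o : open (@retract R @^-1` U) by apply: open_comp => // z _; exact: (@retract_continuous R z).
have [|f [cf fp fq fU]] := pathin_open o nX _ Xp Xq.
  by move=> z /XU [Uz Dz]; rewrite /= retract_id.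
exists (fun t => retract (f t)); split.
- by move=> t; apply: (@continuous_comp _ _ _ f (@retract R)); [exact: cf | exact: retract_continuous].
- by rewrite fp retract_id //; case: (XU p Xp).
- by rewrite fq retract_id //; case: (XU q Xq).
- by move=> t /fU /= h; split=> //; exact: retract_disc.
Qed.

Lemma side_affine p q z m (s : R) :
  side p q (z + s *: (z - m)) = (1 + s) * side p q z - s * side p q m.
Proof.
have E1 : (z + s *: (z - m)).1 = z.1 + s * (z.1 - m.1) by [].
have E2 : (z + s *: (z - m)).2 = z.2 + s * (z.2 - m.2) by [].
by rewrite /side E1 E2; ring.
Qed.

Lemma along_affine p q z m (s : R) :
  along p q (z + s *: (z - m)) = along p q z + s * (along p q z - along p q m).
Proof.
have E1 : (z + s *: (z - m)).1 = z.1 + s * (z.1 - m.1) by [].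
have E2 : (z + s *: (z - m)).2 = z.2 + s * (z.2 - m.2) by [].
by rewrite /along E1 E2; ring.
Qed.

Lemma path_ray S a m (T : R) : S a -> sqn a = 1 -> a.1 * m.1 + a.2 * m.2 <= 1 -> a != m ->
  0 <= T -> (forall s, 0 < s -> ~ Disc (a + s *: (a - m)) -> S (a + s *: (a - m))) ->
  pathin S a (a + T *: (a - m)).
Proof.
move=> Sa a1 am ne T0 H; apply: pathin_segment => t /andP[t0 _].
have -> : a + t *: (a + T *: (a - m) - a) = a + (t * T) *: (a - m).
  by rewrite addrAC subrr add0r scalerA.
have [->|n0] := eqVneq (t * T) 0; first by rewrite scale0r addr0.
have s0 : 0 < t * T by rewrite lt_neqAle eq_sym n0 mulr_ge0.
by apply: H => //; exact: outward_ray.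
Qed.

(** If [X] and [Y] are disjoint, they are replaced by paths in disjoint neighbourhoods and prolonged
    outside the disc, the first one along the line through [p] and [q], the second one away from
    this line. Far enough out, the coordinates [along] and [side] have the boundary signs of
    [poincare_miranda], so the disjoint paths would meet. *)
Lemma disc_crossing p q a b X Y : sqn p = 1 -> sqn q = 1 -> sqn a = 1 -> sqn b = 1 ->
  0 < side p q a -> side p q b < 0 ->
  continuum X -> X `<=` Disc -> X p -> X q ->
  continuum Y -> Y `<=` Disc -> Y a -> Y b -> X `&` Y !=set0.
Proof.
move=> p1 q1 a1 b1 sa sb [kX nX] XD Xp Xq [kY nY] YD Ya Yb.
apply: contrapT => XY.
have hP := @plane_hausdorff R.
have XY0 : X `&` Y = set0.
  by apply/seteqP; split=> // z XYz; apply: XY; exists z.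
have [U [V [oU oV XU YV UV]]] := closed_separation (compact_closed hP kX)
  (compact_closed hP kY) XY0.
have UVn z : U z -> V z -> False.
  by move=> Uz Vz; have : (U `&` V) z by []; rewrite UV.
have Dp := XD p Xp; have Dq := XD q Xq; have Da := YD a Ya; have Db := YD b Yb.
have pq : p != q.
  by apply/eqP => E; move: sa; rewrite E /side !subrr !mul0r subrr ltxx.
pose m : P := ((p.1 + q.1) / 2, (p.2 + q.2) / 2).
have sm : side p q m = 0 by rewrite /side /m /=; field.
have dm z : sqn z = 1 -> z.1 * m.1 + z.2 * m.2 <= 1.
  move=> z1.
  have h1 : z.1 * p.1 + z.2 * p.2 <= 1 by apply: dot_le1; rewrite ?z1 ?p1.
  have h2 : z.1 * q.1 + z.2 * q.2 <= 1 by apply: dot_le1; rewrite ?z1 ?q1.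
  have -> : z.1 * m.1 + z.2 * m.2 = ((z.1 * p.1 + z.2 * p.2) + (z.1 * q.1 + z.2 * q.2)) / 2.
    by rewrite /m /=; field.
  by move: h1 h2; move: (_ + _) => x; move: (_ + _) => y; clear; lra.
have ne z : side p q z != 0 -> z != m by apply: contraNneq => ->; rewrite sm.
have side_ray z s : side p q (z + s *: (z - m)) = (1 + s) * side p q z.
  transitivity ((1 + s) * side p q z - s * side p q m); last by rewrite sm mulr0 subr0.
  exact: side_affine.
(* Outside the disc [S1] keeps to the line through [p] and [q] and [S2] keeps off it, so the two
   sets stay disjoint. *)
pose S1 := (U `&` Disc) `|` [set z | ~ Disc z /\ side p q z = 0].
pose S2 := (V `&` Disc) `|` [set z | ~ Disc z /\ side p q z != 0].
have S12 z : S1 z -> S2 z -> False.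
  move=> [[Uz Dz]|[nDz z0]] [[Vz Dz']|[nDz' z1]] //; first exact: (UVn z).
  by rewrite z0 eqxx in z1.
have S1b z : S1 z -> `|side p q z| <= 8.
  by move=> [[_ Dz]|[_ ->]]; [exact: side_disc_bound | rewrite normr0].
(* On the ray from [m] through [z] the value of [side] is only multiplied by a positive factor, so
   it never vanishes. With 9 in the length it ends beyond the bound 8 that holds for [side] on the
   disc, hence on [S1]. *)
have ray2 z : V z -> Disc z -> sqn z = 1 -> side p q z != 0 ->
    exists2 w, pathin S2 z w & side p q w = (1 + 9 / `|side p q z|) * side p q z.
  move=> Vz Dz z1 z0; exists (z + (9 / `|side p q z|) *: (z - m)); last exact: side_ray.
  have T0 : 0 <= 9 / `|side p q z| by rewrite divr_ge0.
  apply: path_ray => //; [by left | exact: dm | exact: ne |].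
  - move=> s s0 nD; right; split=> //; rewrite side_ray mulf_neq0 // gt_eqF //.
    by rewrite addr_gt0.
have [a' pa sa'] := ray2 a (YV a Ya) Da a1 (lt0r_neq0 sa).
have [b' pb sb'] := ray2 b (YV b Yb) Db b1 (ltr0_neq0 sb).
have sa9 : 8 < side p q a'.
  rewrite sa' gtr0_norm // mulrDl mul1r divfK ?gt_eqF //.
  by move: sa; move: (side _ _ _) => x; clear; lra.
have sb9 : side p q b' < - 8.
  rewrite sb' ltr0_norm // mulrDl mul1r invrN mulrN mulNr divfK ?lt_eqF //.
  by move: sb; move: (side _ _ _) => x; clear; lra.
have YVD : Y `<=` V `&` Disc by move=> z Yz; split; [exact: YV | exact: YD].
have XUD : X `<=` U `&` Disc by move=> z Xz; split; [exact: XU | exact: XD].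
have pS2 : pathin S2 b' a'.
  apply: (pathin_trans (pathin_sym pb)); apply: (pathin_trans _ pa).
  by apply: pathin_sub (path_retract oV nY YVD Yb Ya) => z; left.
have [g [cg gb ga gS]] := pS2.
have m1 : -1 <= (1 : R) by clear; lra.
have cag : continuous (fun t => along p q (g t)).
  by move=> t; apply: (@continuous_comp _ _ _ g (along p q)); [exact: cg | exact: along_continuous].
have [c0 _ Hc] := EVT_max m1 (continuous_subspaceT cag).
have [c1 _ Hc'] := EVT_min m1 (continuous_subspaceT cag).
pose n2 := (q.1 - p.1) ^+ 2 + (q.2 - p.2) ^+ 2.
have n20 : 0 < n2.
  rewrite lt_neqAle addr_ge0 ?sqr_ge0 // andbT eq_sym paddr_eq0 ?sqr_ge0 //.
  rewrite !sqrf_eq0 !subr_eq0; apply/negP => /andP[/eqP h1 /eqP h2].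
  by move/eqP: pq; apply; apply: injective_projections.
have ray1 z w : U z -> Disc z -> sqn z = 1 -> sqn w = 1 -> side p q z = 0 -> side p q w = 0 ->
    z != w -> forall T, 0 <= T -> pathin S1 z (z + T *: (z - w)).
  move=> Uz Dz z1 w1 z0 w0 zw T T0; apply: path_ray => //; first by left.
    by apply: dot_le1; rewrite ?z1 ?w1.
  move=> s s0 nD; right; split=> //.
  transitivity ((1 + s) * side p q z - s * side p q w); last by rewrite z0 w0 !mulr0 subrr.
  exact: side_affine.
have sp0 : side p q p = 0 by rewrite /side !subrr !mulr0 subrr.
have sq0 : side p q q = 0 by rewrite /side mulrC subrr.
(* Lengths that carry the ends of the first path past all values of [along] on the second path [g];
   the summand 1 makes the inequalities strict. *)
pose T1 := (`|along p q p| + `|along p q (g c1)| + 1) / n2.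
pose T2 := (`|along p q q| + `|along p q (g c0)| + 1) / n2.
have T10 : 0 <= T1 by rewrite divr_ge0 ?(ltW n20) // !addr_ge0.
have T20 : 0 <= T2 by rewrite divr_ge0 ?(ltW n20) // !addr_ge0.
have pp := ray1 p q (XU p Xp) Dp p1 q1 sp0 sq0 pq T1 T10.
have qp : q != p by rewrite eq_sym.
have pq' := ray1 q p (XU q Xq) Dq q1 p1 sq0 sp0 qp T2 T20.
set p' := p + _ in pp; set q' := q + _ in pq'.
have ap' : along p q p' < along p q (g c1).
  have -> : along p q p' = along p q p - T1 * n2.
    by rewrite /p' along_affine /along /n2; ring.
  rewrite /T1 divfK ?gt_eqF //.
  have := ler_norm (along p q p); have := ler_norm (- along p q (g c1)); rewrite normrN.
  move: (along p q (g c1)) => x; move: (along p q p) => y; move: `|x| `|y| => u v.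
  by clear; lra.
have aq' : along p q (g c0) < along p q q'.
  have -> : along p q q' = along p q q + T2 * n2.
    by rewrite /q' along_affine /along /n2; ring.
  rewrite /T2 divfK ?gt_eqF //.
  have := ler_norm (along p q (g c0)); have := ler_norm (- along p q q); rewrite normrN.
  move: (along p q (g c0)) => x; move: (along p q q) => y; move: `|x| `|y| => u v.
  by clear; lra.
have pS1 : pathin S1 p' q'.
  apply: (pathin_trans (pathin_sym pp)); apply: (pathin_trans _ pq').
  by apply: pathin_sub (path_retract oU nX XUD Xp Xq) => z; left.
have [f [cf fp fq fS]] := pS1.
(* A common zero of [u] and [v] is a pair of parameters at which the two paths have the same
   coordinates. *)
pose u (z : P) := along p q (f z.1) - along p q (g z.2).
pose v (z : P) := side p q (g z.2) - side p q (f z.1).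
have c_1 (h : P -> R) (k : R -> P) : continuous h -> continuous k ->
    continuous (fun z : P => h (k z.1)).
  move=> ch ck z; apply: (@continuous_comp _ _ _ (fun z : P => k z.1) h); last exact: ch.
  by apply: (@continuous_comp _ _ _ (fun z : P => z.1) k); [exact: cvg_fst | exact: ck].
have c_2 (h : P -> R) (k : R -> P) : continuous h -> continuous k ->
    continuous (fun z : P => h (k z.2)).
  move=> ch ck z; apply: (@continuous_comp _ _ _ (fun z : P => k z.2) h); last exact: ch.
  by apply: (@continuous_comp _ _ _ (fun z : P => z.2) k); [exact: cvg_snd | exact: ck].
have cu : continuous u.
  move=> z; apply: cvgB; [exact: (c_1 _ _ (@along_continuous p q) cf)|].
  exact: (c_2 _ _ (@along_continuous p q) cg).
have cv : continuous v.
  move=> z; apply: cvgB; [exact: (c_2 _ _ (@side_continuous p q) cg)|].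
  exact: (c_1 _ _ (@side_continuous p q) cf).
have [||||[s t] [bz uz vz]] := poincare_miranda cu cv.
- by move=> y hy; rewrite /u /= fp subr_lt0 (lt_le_trans ap') // Hc' // in_itv.
- by move=> y hy; rewrite /u /= fq subr_gt0 (le_lt_trans _ aq') // Hc // in_itv.
- move=> x hx; rewrite /v /= gb subr_lt0 (lt_le_trans sb9) //.
  by have := S1b _ (fS x hx); rewrite ler_norml => /andP[].
- move=> x hx; rewrite /v /= ga subr_gt0 (le_lt_trans _ sa9) //.
  by have := S1b _ (fS x hx); rewrite ler_norml => /andP[].
have [hs ht] := (@boxE R (s, t)).1 bz.
apply: (S12 (f s)); first exact: fS.
rewrite (_ : f s = g t); first exact: gS.
apply: (same_point pq).
  by move: vz; rewrite /v /= => /eqP; rewrite subr_eq0 => /eqP ->.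
by move: uz; rewrite /u /= => /eqP; rewrite subr_eq0 => /eqP ->.
Qed.

End Crossing.

(** * Arcs of the circle *)

Section Arcs.
Variable R : realType.
Local Notation P := (R * R)%type.
Implicit Types (z w p q a b : P).

Definition circle : set P := [set z | sqn z = 1].
Definition circle_arc p q : set P := [set z | sqn z = 1 /\ 0 <= side p q z].

Lemma circle_closed : closed circle.
Proof.
have : closed (@sqn R @^-1` [set x | x = 1]).
  by apply: (continuous_closedP _).1; [exact: sqn_continuous | exact: closed_eq].
by [].
Qed.

Lemma arc_closed p q : closed (circle_arc p q).
Proof.
have -> : circle_arc p q = circle `&` (side p q @^-1` [set x | 0 <= x]) by [].
apply: closedI; first exact: circle_closed.
by apply: (continuous_closedP _).1; [exact: side_continuous | exact: closed_ge].
Qed.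

Lemma sqn_sub_gt0 p q : p != q -> 0 < (q.1 - p.1) ^+ 2 + (q.2 - p.2) ^+ 2.
Proof.
move=> pq; rewrite lt_neqAle addr_ge0 ?sqr_ge0 // andbT eq_sym paddr_eq0 ?sqr_ge0 //.
rewrite !sqrf_eq0 !subr_eq0; apply/negP => /andP[/eqP h1 /eqP h2].
by move/eqP: pq; apply; apply: injective_projections.
Qed.

Lemma sideC p q z : side q p z = - side p q z.
Proof. by rewrite /side; ring. Qed.

Lemma circle_side0 p q z : p != q -> sqn p = 1 -> sqn q = 1 -> sqn z = 1 ->
  side p q z = 0 -> z = p \/ z = q.
Proof.
move=> pq p1 q1 z1 s0.
pose n2 := (q.1 - p.1) ^+ 2 + (q.2 - p.2) ^+ 2.
have n20 : 0 < n2 := sqn_sub_gt0 pq.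
pose t := ((q.1 - p.1) * (z.1 - p.1) + (q.2 - p.2) * (z.2 - p.2)) / n2.
have tn : t * n2 = (q.1 - p.1) * (z.1 - p.1) + (q.2 - p.2) * (z.2 - p.2).
  by rewrite /t divfK ?gt_eqF.
have e1 : z.1 = p.1 + t * (q.1 - p.1).
  apply: (mulfI (lt0r_neq0 n20)).
  transitivity (n2 * p.1 + (t * n2) * (q.1 - p.1) - (q.2 - p.2) * side p q z); last by rewrite s0; ring.
  by rewrite tn /n2 /side; ring.
have e2 : z.2 = p.2 + t * (q.2 - p.2).
  apply: (mulfI (lt0r_neq0 n20)).
  transitivity (n2 * p.2 + (t * n2) * (q.2 - p.2) + (q.1 - p.1) * side p q z); last by rewrite s0; ring.
  by rewrite tn /n2 /side; ring.
have : t * (t - 1) * n2 = 0.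
  transitivity (sqn z - (1 - t) * sqn p - t * sqn q); last by rewrite z1 p1 q1; ring.
  by rewrite /sqn e1 e2 /n2; ring.
move/eqP; rewrite mulf_eq0 (gt_eqF n20) orbF mulf_eq0 subr_eq0 => /orP[/eqP t0|/eqP t0]; [left|right].
  by apply: injective_projections; rewrite ?e1 ?e2 t0 mul0r addr0.
by apply: injective_projections; rewrite ?e1 ?e2 t0 mul1r addrC subrK.
Qed.

(** Projection from the midpoint of the chord: [c t] is the point where the ray in direction
    [t (q - p) + (1 - |t|) J (q - p)], with [J] the quarter turn, leaves the disc. The factor
    [lam t] is the positive root of a quadratic equation, hence continuous in [t], and the arc is
    the image of an interval. *)
Lemma arc_connected p q : p != q -> sqn p = 1 -> sqn q = 1 -> connected (circle_arc p q).
Proof.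
move=> pq p1 q1.
pose n2 := (q.1 - p.1) ^+ 2 + (q.2 - p.2) ^+ 2.
have n20 : 0 < n2 := sqn_sub_gt0 pq.
pose m1 := (p.1 + q.1) / 2; pose m2 := (p.2 + q.2) / 2.
pose mm := m1 ^+ 2 + m2 ^+ 2.
have mm1 : mm < 1.
  have -> : mm = 1 - n2 / 4.
    transitivity ((sqn p + sqn q) / 2 - n2 / 4); last by rewrite p1 q1; field.
    by rewrite /mm /m1 /m2 /n2 /sqn; field.
  by rewrite ltrBlDr ltrDl divr_gt0.
pose v1 (t : R) := t * (q.1 - p.1) - (1 - `|t|) * (q.2 - p.2).
pose v2 (t : R) := t * (q.2 - p.2) + (1 - `|t|) * (q.1 - p.1).
pose vv t := v1 t ^+ 2 + v2 t ^+ 2.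
pose mv t := m1 * v1 t + m2 * v2 t.
have vvE t : vv t = (t ^+ 2 + (1 - `|t|) ^+ 2) * n2 by rewrite /vv /v1 /v2 /n2; ring.
have vv0 t : 0 < vv t.
  rewrite vvE mulr_gt0 // lt_neqAle addr_ge0 ?sqr_ge0 // andbT eq_sym paddr_eq0 ?sqr_ge0 //.
  rewrite !sqrf_eq0; apply/negP => /andP[/eqP ->]; rewrite normr0 subr0 => /eqP.
  by apply/eqP; rewrite oner_eq0.
pose dis t := Num.sqrt (mv t ^+ 2 + vv t * (1 - mm)).
have rad0 t : 0 < vv t * (1 - mm) by rewrite mulr_gt0 ?subr_gt0.
have dis2 t : dis t ^+ 2 = mv t ^+ 2 + vv t * (1 - mm).
  by rewrite sqr_sqrtr // addr_ge0 ?sqr_ge0 // ltW.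
pose lam t := (- mv t + dis t) / vv t.
have lamE t : lam t * vv t = - mv t + dis t by rewrite /lam divfK ?gt_eqF.
have lam0 t : 0 < lam t.
  rewrite divr_gt0 // addrC subr_gt0.
  apply: (le_lt_trans (ler_norm _)).
  by rewrite -sqrtr_sqr ltr_sqrt ?ltrDl // (lt_le_trans (rad0 t)) // lerDr sqr_ge0.
pose c t : P := (m1 + lam t * v1 t, m2 + lam t * v2 t).
have cont_v1 : continuous v1.
  move=> t; apply: cvgB; first by apply: cvgMr_tmp; exact: cvg_id.
  apply: cvgMr_tmp; apply: cvgB; first exact: cvg_cst.
  exact: norm_continuous.
have cont_v2 : continuous v2.
  move=> t; apply: cvgD; first by apply: cvgMr_tmp; exact: cvg_id.
  apply: cvgMr_tmp; apply: cvgB; first exact: cvg_cst.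
  exact: norm_continuous.
have cont_vv : continuous vv.
  move=> t; apply: cvgD; rewrite /GRing.exp /=; apply: cvgM.
  - exact: cont_v1.
  - exact: cont_v1.
  - exact: cont_v2.
  - exact: cont_v2.
have cont_mv : continuous mv.
  by move=> t; apply: cvgD; apply: cvgMl_tmp; [exact: cont_v1 | exact: cont_v2].
have cont_lam : continuous lam.
  move=> t; apply: cvgM; last first.
    by apply: cvgV; [rewrite gt_eqF | exact: cont_vv].
  apply: cvgD; first by apply: cvgN; exact: cont_mv.
  apply: (@continuous_comp _ _ _ (fun t => mv t ^+ 2 + vv t * (1 - mm)) Num.sqrt); last exact: sqrt_continuous.
  apply: cvgD.
    by rewrite /GRing.exp /=; apply: cvgM; exact: cont_mv.
  by apply: cvgMr_tmp; exact: cont_vv.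
have cont_c : continuous c.
  move=> t; apply: (@cvg_pair _ _ _ (nbhs t) (nbhs (c t).1) (nbhs (c t).2) _ _ _
    (fun t => m1 + lam t * v1 t) (fun t => m2 + lam t * v2 t)).
    by apply: cvgD; [exact: cvg_cst | apply: cvgM; [exact: cont_lam | exact: cont_v1]].
  by apply: cvgD; [exact: cvg_cst | apply: cvgM; [exact: cont_lam | exact: cont_v2]].
have quad t : mm + 2 * lam t * mv t + lam t ^+ 2 * vv t = 1.
  apply: (mulfI (lt0r_neq0 (vv0 t))).
  transitivity (vv t * mm + 2 * (lam t * vv t) * mv t + (lam t * vv t) ^+ 2); first by ring.
  by rewrite lamE; transitivity (vv t * mm - mv t ^+ 2 + dis t ^+ 2); [ring | rewrite dis2; ring].
have -> : circle_arc p q = c @` `[-1, 1].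
  apply/seteqP; split; last first.
    move=> _ [t /= + <-]; rewrite in_itv /= => /andP[t1 t2]; split.
      transitivity (mm + 2 * lam t * mv t + lam t ^+ 2 * vv t); last exact: quad.
      by rewrite /sqn /mm /mv /vv /=; ring.
    have -> : side p q (c t) = lam t * (1 - `|t|) * n2.
      by rewrite /side /c /v1 /v2 /n2 /m1 /m2 /=; field.
    rewrite mulr_ge0 ?(ltW n20) // mulr_ge0 ?(ltW (lam0 t)) // subr_ge0 ler_norml.
    by rewrite t1 t2.
  move=> a [a1 sa].
  pose x := ((q.1 - p.1) * (a.1 - m1) + (q.2 - p.2) * (a.2 - m2)) / n2.
  pose y := side p q a / n2.
  have y0 : 0 <= y by rewrite divr_ge0 // ltW.
  have yE : y * n2 = (q.1 - p.1) * (a.2 - m2) - (q.2 - p.2) * (a.1 - m1).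
    by rewrite /y divfK ?gt_eqF // /side /m1 /m2; field.
  have xE : x * n2 = (q.1 - p.1) * (a.1 - m1) + (q.2 - p.2) * (a.2 - m2).
    by rewrite /x divfK ?gt_eqF.
  have e1 : a.1 - m1 = x * (q.1 - p.1) - y * (q.2 - p.2).
    apply: (mulfI (lt0r_neq0 n20)).
    transitivity ((x * n2) * (q.1 - p.1) - (y * n2) * (q.2 - p.2)); last by ring.
    by rewrite xE yE /n2; ring.
  have e2 : a.2 - m2 = x * (q.2 - p.2) + y * (q.1 - p.1).
    apply: (mulfI (lt0r_neq0 n20)).
    transitivity ((x * n2) * (q.2 - p.2) + (y * n2) * (q.1 - p.1)); last by ring.
    by rewrite xE yE /n2; ring.
  (* Dividing the coordinates [(x, y)] of [a] in the frame [q - p], [J (q - p)] by [|x| + y] puts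
     the direction in the normalised form. Then [d] and [lam t] solve the same quadratic equation
     and are both positive, so they are equal. *)
  pose d := `|x| + y.
  have d0 : 0 < d.
    rewrite lt_neqAle addr_ge0 // andbT eq_sym paddr_eq0 // normr_eq0.
    apply/negP => /andP[/eqP x0 /eqP y00].
    move: e1 e2; rewrite x0 y00 !mul0r subr0 addr0 => /eqP; rewrite subr_eq0 => /eqP e1.
    move=> /eqP; rewrite subr_eq0 => /eqP e2.
    by move: a1 mm1; rewrite /sqn e1 e2 /mm => ->; rewrite ltxx.
  have tE : 1 - `|x / d| = y / d.
    rewrite normrM normfV (gtr0_norm d0) -(divff (lt0r_neq0 d0)) -mulrBl /d addrAC subrr add0r //.
  exists (x / d).
    rewrite /= in_itv /= -ler_norml normrM normfV (gtr0_norm d0).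
    by rewrite ler_pdivrMr // mul1r lerDl.
  have w1 : d * v1 (x / d) = a.1 - m1.
    by rewrite /v1 tE e1; field; rewrite gt_eqF.
  have w2 : d * v2 (x / d) = a.2 - m2.
    by rewrite /v2 tE e2; field; rewrite gt_eqF.
  set t := x / d in tE w1 w2 *.
  have qd : mm + 2 * d * mv t + d ^+ 2 * vv t = 1.
    transitivity (mm + 2 * (m1 * (d * v1 t) + m2 * (d * v2 t)) + ((d * v1 t) ^+ 2 + (d * v2 t) ^+ 2)).
      by rewrite /mv /vv; ring.
    rewrite w1 w2; transitivity (sqn a); last exact: a1.
    by rewrite /sqn /mm; ring.
  have : (lam t - d) * (vv t * (lam t + d) + 2 * mv t) = 0.
    transitivity ((mm + 2 * lam t * mv t + lam t ^+ 2 * vv t) - (mm + 2 * d * mv t + d ^+ 2 * vv t)).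
      by ring.
    by rewrite quad qd subrr.
  have pos : 0 < vv t * (lam t + d) + 2 * mv t.
    have h : 0 < lam t * (vv t * lam t + 2 * mv t).
      have -> : lam t * (vv t * lam t + 2 * mv t) = 1 - mm.
        by apply/eqP; rewrite eq_sym subr_eq; apply/eqP; rewrite -[LHS](quad t); ring.
      by rewrite subr_gt0.
    rewrite mulrDr addrAC addr_gt0 ?mulr_gt0 //.
    by rewrite (pmulr_rgt0 _ (lam0 t)) in h.
  move/eqP; rewrite mulf_eq0 (gt_eqF pos) orbF subr_eq0 => /eqP ld.
  by rewrite /c ld w1 w2; apply: injective_projections => /=; rewrite addrC subrK.
apply: connected_continuous_connected; first exact: segment_connected.
exact: continuous_subspaceT.
Qed.

End Arcs.

(** * Continuous angles around points and off connected sets *)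

Section Separation.
Variable R : realType.
Local Notation P := (R * R)%type.
Implicit Types (z w p q a b : P) (A B C X : set P).

(** Along the circle the angle of [z - p] is [t] plus an arctangent that is the same at the start
    and at the end, so it gains a full turn. *)
Lemma circle_no_angle p (rho : R) : 0 < rho -> sqn p < rho ^+ 2 ->
  forall th : P -> R, (forall z, sqn z = rho ^+ 2 -> is_angle (z.1 - p.1) (z.2 - p.2) (th z)) ->
  {within [set z | sqn z = rho ^+ 2], continuous th} -> False.
Proof.
move=> rho0 prho th ath cth.
pose E (t : R) : P := (rho * cos t, rho * sin t).
have cE : continuous E.
  move=> t; apply: (@cvg_pair _ _ _ (nbhs t) (nbhs (E t).1) (nbhs (E t).2) _ _ _
    (fun t => rho * cos t) (fun t => rho * sin t)).
    by apply: cvgMl_tmp; exact: continuous_cos.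
  by apply: cvgMl_tmp; exact: continuous_sin.
have E2 t : sqn (E t) = rho ^+ 2.
  by rewrite /sqn /E /= !exprMn -mulrDr cos2Dsin2 mulr1.
pose u t := (rho * cos t - p.1) * cos t + (rho * sin t - p.2) * sin t.
pose v t := (rho * sin t - p.2) * cos t - (rho * cos t - p.1) * sin t.
have uE t : u t = rho - (p.1 * cos t + p.2 * sin t).
  transitivity (rho * (cos t ^+ 2 + sin t ^+ 2) - (p.1 * cos t + p.2 * sin t)).
    by rewrite /u; ring.
  by rewrite cos2Dsin2 mulr1.
have u0 t : 0 < u t.
  rewrite uE subr_gt0.
  have h : (p.1 * cos t + p.2 * sin t) ^+ 2 < rho ^+ 2.
    apply: le_lt_trans prho.
    have <- : sqn p * (cos t ^+ 2 + sin t ^+ 2) = sqn p by rewrite cos2Dsin2 mulr1.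
    rewrite -subr_ge0.
    have -> : sqn p * (cos t ^+ 2 + sin t ^+ 2) - (p.1 * cos t + p.2 * sin t) ^+ 2 =
      (p.1 * sin t - p.2 * cos t) ^+ 2 by rewrite /sqn; ring.
    exact: sqr_ge0.
  apply: (le_lt_trans (ler_norm _)).
  by rewrite -(@ltr_pXn2r _ 2) ?nnegrE ?(ltW rho0) // real_normK ?num_real.
have al t : is_angle ((E t).1 - p.1) ((E t).2 - p.2) (t + atan (v t / u t)).
  have e1 : is_angle (cos t) (sin t) t by exists 1 => //; rewrite !mul1r.
  have := is_angle_mul e1 (is_angle_atan (v t) (u0 t)); congr is_angle.
    transitivity ((rho * cos t - p.1) * (cos t ^+ 2 + sin t ^+ 2)); first by rewrite /u /v; ring.
    by rewrite cos2Dsin2 mulr1.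
  transitivity ((rho * sin t - p.2) * (cos t ^+ 2 + sin t ^+ 2)); first by rewrite /u /v; ring.
  by rewrite cos2Dsin2 mulr1.
have cth' : continuous (fun t => th (E t)).
  move/subspace_continuousP: cth => cth t S hS.
  have h : nbhs (E t) [set z | sqn z = rho ^+ 2 -> S (th z)] := cth (E t) (E2 t) S hS.
  have h1 : nbhs t [set s | sqn (E s) = rho ^+ 2 -> S (th (E s))] := cE t _ h.
  suff : nbhs t [set s | S (th (E s))] by [].
  by apply: filterS h1 => s; apply; exact: E2.
have cat : continuous (fun t => t + atan (v t / u t)).
  have cc : continuous (@cos R) by exact: continuous_cos.
  have ss : continuous (@sin R) by exact: continuous_sin.
  have c1 : continuous (fun t => rho * cos t - p.1).
    by move=> t; apply: cvgB; [apply: cvgMl_tmp; exact: cc | exact: cvg_cst].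
  have c2 : continuous (fun t => rho * sin t - p.2).
    by move=> t; apply: cvgB; [apply: cvgMl_tmp; exact: ss | exact: cvg_cst].
  move=> t; apply: cvgD; first exact: cvg_id.
  apply: (@continuous_comp _ _ _ (fun t => v t / u t) (@atan R)); last exact: continuous_atan.
  apply: cvgM.
    by apply: cvgB; apply: cvgM; [exact: c2|exact: cc|exact: c1|exact: ss].
  apply: cvgV; first by rewrite gt_eqF.
  by apply: cvgD; apply: cvgM; [exact: c1|exact: cc|exact: c2|exact: ss].
have nT : connected [set: R].
  by apply/connected_intervalP => x y _ _ z _.
have := @continuous_angle_diff_constant R R setT (fun t => th (E t)) (fun t => t + atan (v t / u t))
  (fun t => (E t).1 - p.1) (fun t => (E t).2 - p.2) nT (continuous_subspaceT cth')
  (continuous_subspaceT cat) (fun t _ => ath (E t) (E2 t)) (fun t _ => al t) 0 (pi *+ 2) I I.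
have c2 : cos (pi *+ 2) = cos 0 :> R by rewrite -(@cosD2pi R 0) add0r.
have s2 : sin (pi *+ 2) = sin 0 :> R by rewrite -(@sinD2pi R 0) add0r.
have -> : E (pi *+ 2) = E 0 by rewrite /E c2 s2.
have -> : u (pi *+ 2) = u 0 by rewrite /u c2 s2.
have -> : v (pi *+ 2) = v 0 by rewrite /v c2 s2.
move=> e; have := pi_gt0 R; move: e; rewrite mulr2n.
move: (th _) (atan _) (pi : R) => x y z; clear; lra.
Qed.

Lemma is_angle_shift (u v t k : R) : cos k = 1 -> is_angle u v t -> is_angle u v (t + k).
Proof.
move=> ck a; have e1 : is_angle 1 0 k.
  have : sin k ^+ 2 = 0.
    by have := cos2Dsin2 k; rewrite ck expr1n => /eqP; rewrite -subr_eq0 addrAC subrr add0r => /eqP.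
  move/eqP; rewrite sqrf_eq0 => /eqP sk.
  by exists 1; rewrite // ck sk mulr1 mulr0.
by have := is_angle_mul a e1; rewrite !mulr1 !mulr0 subr0 add0r.
Qed.

Lemma closed_compact_gap A X : closed A -> compact X -> A `&` X = set0 ->
  exists2 d : R, 0 < d & forall z x, A z -> X x -> d <= `|z - x|.
Proof.
move=> cA kX AX.
pose Q (n : nat) x := forall z, A z -> n.+1%:R^-1 <= `|z - x| :> R.
have : \forall n \near \oo, X `<=` Q n.
  apply: ((compact_near_coveringP X).1 kX nat \oo Q _) => x Xx.
  have : nbhs x (~` A).
    apply: open_nbhs_nbhs; split; first exact: closed_openC.
    by move=> Ax; have : (A `&` X) x by []; rewrite AX.
  move=> /nbhs_ballP [e /= e0 He].
  have e2 : 0 < e / 2 by rewrite divr_gt0.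
  exists (ball x (e / 2), [set n | n.+1%:R^-1 < e / 2]).
    by split; [exact: nbhsx_ballx | exact: near_infty_natSinv_lt (PosNum e2)].
  move=> [y n] /= [] ; rewrite -ball_normE /= => xy hn z Az.
  rewrite leNgt; apply/negP => zy; apply: (He z _ Az); rewrite -ball_normE /=.
  rewrite (_ : x - z = (x - y) - (z - y)); last by rewrite opprB addrA subrK.
  apply: (le_lt_trans (ler_normB _ _)); rewrite (splitr e) ltrD //.
  exact: lt_trans hn.
move=> [n _ Hn]; exists (n.+1%:R^-1); first by rewrite invr_gt0 ltr0n.
by move=> z x Az Xx; exact: (Hn n (leqnn n) x Xx z Az).
Qed.

Definition away A (d : R) : set P := [set z | forall a, A a -> d <= `|z - a|].

Lemma away_closed A d : closed (away A d).
Proof.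
have -> : away A d = \bigcap_(a in A) [set z | d <= `|z - a|] by [].
apply: closed_bigI => a Aa.
have c : continuous (fun z => `|z - a|).
  move=> z; apply: (@continuous_comp _ _ _ (fun z : P => z - a) Num.norm); last exact: norm_continuous.
  by apply: cvgB; [exact: cvg_id | exact: cvg_cst].
exact: ((continuous_closedP _).1 c _ (@closed_ge R d)).
Qed.

Lemma awayW A (d d' : R) : d' <= d -> away A d `<=` away A d'.
Proof. by move=> dd z h a /h; exact: le_trans. Qed.

Lemma sup_le_sqn z (d : R) : 0 <= d -> d <= `|z| -> d ^+ 2 <= sqn z.
Proof.
case: z => x y d0; rewrite /Num.norm /= le_max /sqn /= => /orP[h|h].
  rewrite (@le_trans _ _ (x ^+ 2)) ?lerDl ?sqr_ge0 // -(real_normK (num_real x)).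
  by rewrite ler_pXn2r ?nnegrE.
rewrite (@le_trans _ _ (y ^+ 2)) ?lerDr ?sqr_ge0 // -(real_normK (num_real y)).
by rewrite ler_pXn2r ?nnegrE.
Qed.

Lemma sqn_le_sup z (d : R) : `|z| <= d -> sqn z <= 2 * d ^+ 2.
Proof.
case: z => x y; rewrite /Num.norm /= ge_max /sqn /= => /andP[h1 h2].
have d0 : 0 <= d by exact: le_trans h1.
have e1 : x ^+ 2 <= d ^+ 2 by rewrite -(real_normK (num_real x)) ler_pXn2r ?nnegrE.
have e2 : y ^+ 2 <= d ^+ 2 by rewrite -(real_normK (num_real y)) ler_pXn2r ?nnegrE.
by move: e1 e2; move: (x ^+ 2) (y ^+ 2) (d ^+ 2) => X Y D; clear; lra.
Qed.

(* The argument is built by moving [p] to [q] inside the set by small steps. *)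
Lemma connected_angle A p q (d : R) : 0 < d -> connected A -> A p -> A q ->
  exists l : P -> R, forall z, away A d z ->
    is_angle ((z.1 - p.1) * (z.1 - q.1) + (z.2 - p.2) * (z.2 - q.2))
             ((z.2 - p.2) * (z.1 - q.1) - (z.1 - p.1) * (z.2 - q.2)) (l z)
    /\ {for z, continuous l}.
Proof.
move=> d0 nA Ap Aq.
pose Rel b := exists l : P -> R, forall z, away A d z ->
    is_angle ((z.1 - p.1) * (z.1 - b.1) + (z.2 - p.2) * (z.2 - b.2))
             ((z.2 - p.2) * (z.1 - b.1) - (z.1 - p.1) * (z.2 - b.2)) (l z)
    /\ {for z, continuous l}.
have step a b : A a -> A b -> `|a - b| < d / 2 -> Rel a -> Rel b.
  move=> Aa Ab ab [l Hl].
  pose u z := (z.1 - a.1) * (z.1 - b.1) + (z.2 - a.2) * (z.2 - b.2).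
  pose v z := (z.2 - a.2) * (z.1 - b.1) - (z.1 - a.1) * (z.2 - b.2).
  have u0 z : away A d z -> 0 < u z.
    move=> Zz; have h1 := sup_le_sqn (ltW d0) (Zz a Aa).
    have h2 := sup_le_sqn (ltW d0) (Zz b Ab).
    have h3 := sqn_le_sup (ltW ab).
    have -> : u z = (sqn (z - a) + sqn (z - b) - sqn (a - b)) / 2.
      by rewrite /u /sqn /=; field.
    move: h1 h2 h3; rewrite expr_div_n => h1 h2 h3.
    have h4 : 0 < d ^+ 2 by rewrite exprn_gt0.
    move: h1 h2 h3 h4; move: (sqn (z - a)) (sqn (z - b)) (sqn (a - b)) (d ^+ 2) => x y w D.
    by rewrite (_ : 2 ^+ 2 = 4) ?expr2 -?natrM //; clear; lra.
  exists (fun z => l z + atan (v z / u z)) => z Zz; have [al cl] := Hl z Zz; split.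
    have := is_angle_mul al (is_angle_atan (v z) (u0 z Zz)).
    have na : 0 < sqn (z - a).
      by apply: lt_le_trans (sup_le_sqn (ltW d0) (Zz a Aa)); rewrite exprn_gt0.
    have qi : 0 < (sqn (z - a))^-1 by rewrite invr_gt0.
    move/(is_angle_scale qi); congr is_angle; rewrite mulrC; apply: (canLR (mulfK _)).
    - by rewrite gt_eqF.
    - by rewrite /u /v /sqn /=; ring.
    - by rewrite gt_eqF.
    - by rewrite /u /v /sqn /=; ring.
  have f1 (c : R) : continuous (fun z : P => z.1 - c).
    by move=> x; apply: cvgB; [exact: cvg_fst | exact: cvg_cst].
  have f2 (c : R) : continuous (fun z : P => z.2 - c).
    by move=> x; apply: cvgB; [exact: cvg_snd | exact: cvg_cst].
  apply: cvgD; first exact: cl.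
  apply: (@continuous_comp _ _ _ (fun z => v z / u z) (@atan R)); last exact: continuous_atan.
  apply: cvgM.
    by apply: cvgB; apply: cvgM; [exact: f2|exact: f1|exact: f1|exact: f2].
  apply: cvgV; first by rewrite gt_eqF // u0.
  by apply: cvgD; apply: cvgM; [exact: f1|exact: f1|exact: f2|exact: f2].
suff : Rel q by [].
have Rp : Rel p.
  exists (fun=> 0) => z Zz; split; last exact: cvg_cst.
  exists (sqn (z - p)).
    by apply: lt_le_trans (sup_le_sqn (ltW d0) (Zz p Ap)); rewrite exprn_gt0.
  by rewrite cos0 sin0 mulr1 mulr0 /sqn /=; split; ring.
apply: contrapT => nRq.
pose U (S : set P) := \bigcup_(a in S) ball a (d / 2).
have oU S : open (U S) by apply: bigcup_open => a _; exact: ball_open.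
have d2 : 0 < d / 2 by rewrite divr_gt0.
have := connected_open_meet nA (oU [set a | A a /\ Rel a]) (oU [set a | A a /\ ~ Rel a]).
case=> [|||z [[Az [a [Aa Ra] az]] [b [Ab nRb] bz]]].
- move=> a Aa; case: (pselect (Rel a)) => h; [left|right]; exists a => //; exact: ballxx.
- by exists p; split=> //; exists p => //; exact: ballxx.
- by exists q; split=> //; exists q => //; exact: ballxx.
move: az bz; rewrite -!ball_normE /= => az bz.
apply: nRb; apply: (step z b) => //; first by rewrite distrC.
exact: (step a z).
Qed.

End Separation.

(** * Janiszewski's theorem in the disc *)

Section Janiszewski.
Variable R : realType.
Local Notation P := (R * R)%type.
Local Notation Disc := (@disc R).
Implicit Types (z w p q a b : P) (A B C X : set P).

Definition outer : set P := [set z | 2 <= `|z|].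

Lemma halfplane_convex (f : P -> R) (c : R) :
  (forall z w (t : R), f (z + t *: (w - z)) = (1 - t) * f z + t * f w) ->
  convex_subset [set z | c <= f z].
Proof.
move=> fE z w t /= h1 h2 /andP[t0 t1]; rewrite fE.
have e1 : (1 - t) * c <= (1 - t) * f z by rewrite ler_wpM2l // subr_ge0.
have e2 : t * c <= t * f w by rewrite ler_wpM2l.
by apply: le_trans (lerD e1 e2); rewrite -mulrDl subrK mul1r.
Qed.

Lemma outer_connected : connected outer.
Proof.
pose f1 z : R := z.1; pose f2 z : R := z.2; pose f3 z : R := - z.1; pose f4 z : R := - z.2.
have c1 : connected [set z | 2 <= f1 z].
  apply: convex_connected; apply: halfplane_convex => z w t.
  by have E : f1 (z + t *: (w - z)) = z.1 + t * (w.1 - z.1) by []; rewrite E /f1; ring.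
have c2 : connected [set z | 2 <= f2 z].
  apply: convex_connected; apply: halfplane_convex => z w t.
  by have E : f2 (z + t *: (w - z)) = z.2 + t * (w.2 - z.2) by []; rewrite E /f2; ring.
have c3 : connected [set z | 2 <= f3 z].
  apply: convex_connected; apply: halfplane_convex => z w t.
  by have E : f3 (z + t *: (w - z)) = - (z.1 + t * (w.1 - z.1)) by []; rewrite E /f3; ring.
have c4 : connected [set z | 2 <= f4 z].
  apply: convex_connected; apply: halfplane_convex => z w t.
  by have E : f4 (z + t *: (w - z)) = - (z.2 + t * (w.2 - z.2)) by []; rewrite E /f4; ring.
have -> : outer = (([set z | 2 <= f1 z] `|` [set z | 2 <= f2 z]) `|` [set z | 2 <= f3 z])
    `|` [set z | 2 <= f4 z].
  apply/seteqP; split=> -[x y]; rewrite /outer /f1 /f2 /f3 /f4 /= /Num.norm /= le_max.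
    rewrite !ler_normr => /orP[/orP[]|/orP[]] h.
    - by left; left; left.
    - by left; right.
    - by left; left; right.
    - by right.
  by move=> [[[h|h]|h]|h]; rewrite !ler_normr h ?orbT.
apply: connectedU => //; last apply: connectedU => //; last apply: connectedU => //.
- exists (-2, -2); split; last by rewrite /f4 /= opprK lexx.
  by right; rewrite /f3 /= opprK lexx.
- exists (-2, 2); split; last by rewrite /f3 /= opprK lexx.
  by right; rewrite /f2 /= lexx.
- by exists (2, 2); split; rewrite /f1 /f2 /= lexx.
Qed.

Lemma outer_away X : X `<=` Disc -> outer `<=` away X 1.
Proof.
move=> XD z /= z2 x /XD /disc_norm x1.
have : `|z| <= `|z - x| + `|x| by rewrite -{1}(subrK x z) ler_normD.
move: z2 x1; rewrite /outer /=; move: `|z| `|x| `|z - x| => a b c; clear; lra.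
Qed.

Lemma away_of_disjoint A X : closed A -> compact X -> A `&` X = set0 ->
  exists2 d : R, 0 < d & A `<=` away X d.
Proof.
by move=> cA kX AX; have [d d0 Hd] := closed_compact_gap cA kX AX; exists d => // z Az x; exact: Hd.
Qed.

Lemma outer_closed : closed outer.
Proof.
exact: ((continuous_closedP _).1 (@norm_continuous _ P) _ (@closed_ge R 2)).
Qed.

Lemma exterior_joined X z : X `<=` Disc -> ~ X z -> 1 <= sqn z ->
  exists C, [/\ closed C, connected C, C z, C (2, 0) & C `&` X = set0].
Proof.
move=> XD nXz z1.
pose S := [set z + t *: (4 *: z - z) | t in `[0, 1]]%classic : set P.
have [kS nS] := segment_continuum z (4 *: z).
have scl (t : R) : z + t *: (4 *: z - z) = (1 + t * 3) *: z.
  by rewrite -[X in _ *: z - X]scale1r -scalerBl scalerA -[X in X + _]scale1r -scalerDl;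
     congr (_ *: _); ring.
have o4 : outer (4 *: z).
  rewrite /outer /= normrZ ger0_norm //.
  rewrite leNgt; apply/negP => h.
  have : `|z| <= 1 / 2 by move: h; move: `|z| => x; clear; lra.
  by move/sqn_le_sup; move: z1; rewrite expr_div_n; move: (sqn z) => x;
     rewrite expr1n (_ : 2 ^+ 2 = 4) ?expr2 -?natrM //; clear; lra.
exists (S `|` outer); split.
- apply: closedU; last exact: outer_closed.
  by apply: compact_closed kS; exact: plane_hausdorff.
- apply: connectedU => //; last exact: outer_connected.
  exists (4 *: z); split=> //; exists 1; first by rewrite /= in_itv /= lexx ler01.
  by rewrite scale1r addrC subrK.
- by left; exists 0; [rewrite /= in_itv /= lexx ler01 | rewrite scale0r addr0].
- by right; rewrite /outer /= /Num.norm /= le_max ler_normr lexx.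
- apply/seteqP; split=> // x [[[t + <-]|ox] Xx].
    rewrite /= in_itv /= => /andP[t0 t1]; rewrite scl in Xx.
    have [t00|tn] := eqVneq t 0.
      by apply: nXz; rewrite t00 mul0r addr0 scale1r in Xx.
    have tp : 0 < t by rewrite lt_neqAle eq_sym tn.
    have := XD _ Xx; rewrite /disc /=.
    have -> : sqn ((1 + t * 3) *: z) = (1 + t * 3) ^+ 2 * sqn z.
      have E1 : ((1 + t * 3) *: z).1 = (1 + t * 3) * z.1 by [].
      have E2 : ((1 + t * 3) *: z).2 = (1 + t * 3) * z.2 by [].
      by rewrite /sqn E1 E2; ring.
    apply/negP; rewrite -ltNge; apply: (lt_le_trans _ (ler_peMr _ z1)); last exact: sqr_ge0.
    by rewrite expr2; move: tp; clear; nra.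
  have := outer_away XD ox Xx.
  by rewrite subrr normr0 ler10.
Qed.

Lemma half_away (x1 x2 x3 x4 d : R) : d <= x1 -> x2 <= x3 -> x1 <= x4 + x2 -> x3 < d / 2 ->
  d / 2 <= x4.
Proof. lra. Qed.

Lemma third_bounds : 2 / 3 < 1 :> R /\ 0 < 3^-1 :> R.
Proof. by split; lra. Qed.

Lemma rotate_quotient (u1 u2 w1 w2 t : R) :
  0 < u1 ^+ 2 + u2 ^+ 2 -> 0 < w1 ^+ 2 + w2 ^+ 2 ->
  is_angle (u1 * w1 + u2 * w2) (u2 * w1 - u1 * w2) t ->
  Num.sqrt (w1 ^+ 2 + w2 ^+ 2) / Num.sqrt (u1 ^+ 2 + u2 ^+ 2) * (u1 * cos t + u2 * sin t) = w1 /\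
  Num.sqrt (w1 ^+ 2 + w2 ^+ 2) / Num.sqrt (u1 ^+ 2 + u2 ^+ 2) * (u2 * cos t - u1 * sin t) = w2.
Proof.
move=> u0 w0 [r r0 [e1 e2]].
set nu := Num.sqrt (u1 ^+ 2 + u2 ^+ 2); set nw := Num.sqrt (w1 ^+ 2 + w2 ^+ 2).
have nu0 : 0 < nu by rewrite sqrtr_gt0.
have nw0 : 0 < nw by rewrite sqrtr_gt0.
have nu2 : nu ^+ 2 = u1 ^+ 2 + u2 ^+ 2 by rewrite sqr_sqrtr // ltW.
have nw2 : nw ^+ 2 = w1 ^+ 2 + w2 ^+ 2 by rewrite sqr_sqrtr // ltW.
have rE : r = nu * nw.
  apply/eqP; rewrite -(@eqrXn2 _ 2) ?mulr_ge0 ?(ltW r0) ?(ltW nu0) ?(ltW nw0) //; apply/eqP.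
  transitivity (r ^+ 2 * (cos t ^+ 2 + sin t ^+ 2)); first by rewrite cos2Dsin2 mulr1.
  transitivity ((r * cos t) ^+ 2 + (r * sin t) ^+ 2); first by ring.
  by rewrite -e1 -e2 exprMn nu2 nw2; ring.
have k x y : r * x = nu ^+ 2 * y -> nw / nu * x = y.
  move=> h; apply: (mulfI (lt0r_neq0 r0)); rewrite mulrCA h rE.
  by field; rewrite gt_eqF.
split; apply: k.
  transitivity (u1 * (r * cos t) + u2 * (r * sin t)); first by ring.
  by rewrite -e1 -e2 nu2; ring.
transitivity (u2 * (r * cos t) - u1 * (r * sin t)); first by ring.
by rewrite -e1 -e2 nu2; ring.
Qed.

Lemma clamp_high (t : R) : 2 / 3 <= t -> Num.min 1 (Num.max 0 (3 * t - 1)) = 1.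
Proof.
move=> h; have h1 : 1 <= 3 * t - 1 by lra.
by rewrite min_l // le_max h1 orbT.
Qed.

Lemma clamp_low (t : R) : t <= 3^-1 -> Num.min 1 (Num.max 0 (3 * t - 1)) = 0.
Proof.
move=> h; have h1 : 3 * t - 1 <= 0 by lra.
by rewrite (max_l h1) min_r // ler01.
Qed.

Lemma third_gap (t : R) : 2 / 3 <= t -> t <= 3^-1 -> False.
Proof. lra. Qed.

Lemma third_neg : 2 / 3 <= 0 :> R -> False.
Proof. lra. Qed.

Lemma third_neg' : 1 <= 3^-1 :> R -> False.
Proof. lra. Qed.

Lemma nine_eight : 3 ^+ 2 <= 2 * 2 ^+ 2 :> R -> False.
Proof. by rewrite !expr2 -!natrM ler_nat. Qed.

Section Twist.
Variables (p q : P) (lam : P -> R).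
Hypothesis clam : continuous lam.

Definition edist z w : R := Num.sqrt (sqn (z - w)).
Definition twist_scale z : R := (1 - lam z) + lam z * (edist z q / edist z p).
(** In complex notation this is a positive scale times [(z - p) exp(- i lam l)], to be used with [l]
    a branch of the argument of [(z - p) / (z - q)]. It deforms [z - p] (at [lam = 0]) into [z - q]
    (at [lam = 1]) through nonzero values. *)
Definition twist (l : P -> R) z : P :=
  (twist_scale z * ((z.1 - p.1) * cos (lam z * l z) + (z.2 - p.2) * sin (lam z * l z)),
   twist_scale z * ((z.2 - p.2) * cos (lam z * l z) - (z.1 - p.1) * sin (lam z * l z))).

Lemma edist_continuous w : continuous (edist^~ w).
Proof.
move=> z; apply: (@continuous_comp _ _ _ (fun z => sqn (z - w)) Num.sqrt); last exact: sqrt_continuous.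
apply: (@continuous_comp _ _ _ (fun z : P => z - w) (@sqn R)); last exact: sqn_continuous.
by apply: cvgB; [exact: cvg_id | exact: cvg_cst].
Qed.

Lemma edist_gt0 z w : z != w -> 0 < edist z w.
Proof. by move=> zw; rewrite sqrtr_gt0 sqn_gt0 // subr_eq0. Qed.

Lemma twist_continuous (l : P -> R) z : z != p -> {for z, continuous l} ->
  {for z, continuous (twist l)}.
Proof.
move=> zp cl.
have cs : {for z, continuous twist_scale}.
  apply: cvgD; first by apply: cvgB; [exact: cvg_cst | exact: clam].
  apply: cvgM; first exact: clam.
  apply: cvgM; first exact: edist_continuous.
  by apply: cvgV; [rewrite gt_eqF // edist_gt0 | exact: edist_continuous].
have f1 : {for z, continuous (fun z : P => z.1 - p.1)} by apply: cvgB; [exact: cvg_fst | exact: cvg_cst].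
have f2 : {for z, continuous (fun z : P => z.2 - p.2)} by apply: cvgB; [exact: cvg_snd | exact: cvg_cst].
have cc : {for z, continuous (fun z => cos (lam z * l z))}.
  apply: (@continuous_comp _ _ _ (fun z => lam z * l z) cos); last exact: continuous_cos.
  by apply: cvgM; [exact: clam | exact: cl].
have cn : {for z, continuous (fun z => sin (lam z * l z))}.
  apply: (@continuous_comp _ _ _ (fun z => lam z * l z) sin); last exact: continuous_sin.
  by apply: cvgM; [exact: clam | exact: cl].
apply: (@cvg_pair _ _ _ (nbhs z) (nbhs (twist l z).1) (nbhs (twist l z).2) _ _ _
  (fun z => (twist l z).1) (fun z => (twist l z).2)); rewrite /twist /=.
  by apply: cvgM => //; apply: cvgD; apply: cvgM.
by apply: cvgM => //; apply: cvgB; apply: cvgM.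
Qed.

Lemma twist0 l z : lam z = 0 -> twist l z = z - p.
Proof.
move=> l0; apply: injective_projections; rewrite /twist /twist_scale l0 /=.
  by rewrite !mul0r subr0 addr0 cos0 sin0 mulr1 mulr0 addr0 mul1r.
by rewrite !mul0r subr0 addr0 cos0 sin0 mulr1 mulr0 subr0 mul1r.
Qed.

Lemma twist1 l z : lam z = 1 -> z != p -> z != q ->
  is_angle ((z.1 - p.1) * (z.1 - q.1) + (z.2 - p.2) * (z.2 - q.2))
           ((z.2 - p.2) * (z.1 - q.1) - (z.1 - p.1) * (z.2 - q.2)) (l z) ->
  twist l z = z - q.
Proof.
move=> l1 zp zq a.
have h1 : 0 < sqn (z - p) by rewrite sqn_gt0 // subr_eq0.
have h2 : 0 < sqn (z - q) by rewrite sqn_gt0 // subr_eq0.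
have [e1 e2] := rotate_quotient h1 h2 a.
by apply: injective_projections; rewrite /twist /twist_scale l1 subrr add0r !mul1r.
Qed.

Lemma twist_scale_gt0 z : 0 <= lam z <= 1 -> z != p -> z != q -> 0 < twist_scale z.
Proof.
move=> /andP[h0 h1] zp zq; rewrite /twist_scale.
have d0 : 0 < edist z q / edist z p by rewrite divr_gt0 // edist_gt0.
have [E|n0] := eqVneq (lam z) 0; first by rewrite E subr0 mul0r addr0.
by rewrite addrC ltr_pwDl ?subr_ge0 // mulr_gt0 // lt_neqAle eq_sym n0.
Qed.

Lemma twist_neq0 l z : 0 <= lam z <= 1 -> z != p -> z != q -> twist l z != 0.
Proof.
move=> h zp zq; have s0 := twist_scale_gt0 h zp zq.
apply/eqP => E; have e1 : (twist l z).1 = 0 by rewrite E.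
have e2 : (twist l z).2 = 0 by rewrite E.
have : twist_scale z ^+ 2 * sqn (z - p) * (cos (lam z * l z) ^+ 2 + sin (lam z * l z) ^+ 2) = 0.
  transitivity ((twist l z).1 ^+ 2 + (twist l z).2 ^+ 2); last by rewrite e1 e2 expr0n addr0.
  by rewrite /twist /sqn /=; ring.
rewrite cos2Dsin2 mulr1 => /eqP; rewrite mulf_eq0 sqrf_eq0 (gt_eqF s0) /=.
by rewrite gt_eqF // sqn_gt0 // subr_eq0.
Qed.

Lemma twist_angle l z t : 0 <= lam z <= 1 -> z != p -> z != q ->
  is_angle (twist l z).1 (twist l z).2 t -> is_angle (z.1 - p.1) (z.2 - p.2) (t + lam z * l z).
Proof.
move=> h zp zq a; have s0 := twist_scale_gt0 h zp zq.
have e1 : is_angle (cos (lam z * l z)) (sin (lam z * l z)) (lam z * l z).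
  by exists 1 => //; rewrite !mul1r.
have si : 0 < (twist_scale z)^-1 by rewrite invr_gt0.
have := is_angle_scale si (is_angle_mul a e1); congr is_angle;
  rewrite mulrC; apply: (canLR (mulfK _)); rewrite ?gt_eqF // /twist /=.
  transitivity (twist_scale z * (z.1 - p.1) * (cos (lam z * l z) ^+ 2 + sin (lam z * l z) ^+ 2)).
    by ring.
  by rewrite cos2Dsin2 mulr1 mulrC.
transitivity (twist_scale z * (z.2 - p.2) * (cos (lam z * l z) ^+ 2 + sin (lam z * l z) ^+ 2)).
  by ring.
by rewrite cos2Dsin2 mulr1 mulrC.
Qed.

End Twist.

Section Proof.
Variables (A B X0 Y0 : set P).
Hypotheses (cA : continuum A) (cB : continuum B) (AD : A `<=` Disc) (BD : B `<=` Disc).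
Hypotheses (cX : closed X0) (cY : closed Y0) (ABE : A `&` B = X0 `|` Y0)
  (XY : X0 `&` Y0 = set0) (X0n : X0 !=set0) (Y0n : Y0 !=set0).
Let X := A `|` B.
Hypothesis nsep : forall z, Disc z -> ~ X z ->
  exists2 c, sqn c = 1 & joined (Disc `&` ~` X) z c.

Let kX : compact X. Proof. by apply: compactU; [case: cA | case: cB]. Qed.
Let XD : X `<=` Disc. Proof. by move=> z [/AD|/BD]. Qed.

Lemma complement_joined z : ~ X z ->
  exists C, [/\ closed C, connected C, C z, C (2, 0) & C `&` X = set0].
Proof.
move=> nXz; have [z1|z1] := leP 1 (sqn z); first exact: exterior_joined.
have [c c1 [C [[kC nC] Cz Cc CX]]] := nsep (ltW z1) nXz.
have [||C' [clC' nC' C'c C'w C'X]] := @exterior_joined X c XD.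
- by have [] := CX c Cc.
- by rewrite c1.
exists (C `|` C'); split.
- by apply: closedU => //; exact: compact_closed.
- by apply: connectedU => //; exists c.
- by left.
- by right.
- rewrite setIUl C'X setU0; apply/seteqP; split=> // w [Cw Xw].
  by have [_] := CX w Cw; apply.
Qed.

(** The branches of the argument are constructed only at a fixed distance from [A] and from [B];
    they can be compared along joining sets that keep a uniform distance as well. *)
Lemma complement_joined_uniform (d : R) : 0 < d ->
  exists2 e, 0 < e & forall z, away X d z ->
    exists C, [/\ connected C, C z, C (2, 0) & C `<=` away X e].
Proof.
move=> d0.
pose K := ((`[-2, 2] `*` `[-2, 2])%classic : set P) `&` away X d.
have kK : compact K.
  apply: (subclosed_compact _ (@sup_box_compact R 2)); last by move=> z [].
  by apply: closedI; [apply: compact_closed => //; exact: sup_box_compact | exact: away_closed].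
pose Q (n : nat) z := exists C, [/\ connected C, C z, C (2, 0) & C `<=` away X n.+1%:R^-1].
have : \forall n \near \oo, K `<=` Q n.
  apply: ((compact_near_coveringP K).1 kK nat \oo Q _) => z [_ Zz].
  have nXz : ~ X z by move=> Xz; have := Zz z Xz; rewrite subrr normr0 leNgt d0.
  have [C [clC nC Cz Cw CX]] := complement_joined nXz.
  have [e e0 Ce] := away_of_disjoint clC kX CX.
  pose f := Num.min e (d / 2).
  have f0 : 0 < f by rewrite lt_min e0 divr_gt0.
  have d2 : 0 < d / 2 by rewrite divr_gt0.
  exists (ball z (d / 2), [set n | n.+1%:R^-1 < f]).
    by split; [exact: nbhsx_ballx | exact: near_infty_natSinv_lt (PosNum f0)].
  move=> [y n] /= []; rewrite -ball_normE /= => zy hn.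
  pose S := [set z + t *: (y - z) | t in `[0, 1]]%classic : set P.
  have [_ nS] := segment_continuum z y.
  exists (C `|` S); split.
  - apply: connectedU => //; exists z; split=> //.
    by exists 0; [rewrite /= in_itv /= lexx ler01 | rewrite scale0r addr0].
  - right; exists 1; first by rewrite /= in_itv /= lexx ler01.
    by rewrite scale1r addrC subrK.
  - by left.
  - move=> w [/Ce wC|[t + <-]].
      by apply: awayW wC; rewrite (le_trans (ltW hn)) // ge_min lexx.
    rewrite /= in_itv /= => /andP[t0 t1] x Xx.
    apply: (le_trans (ltW hn)); apply: (@le_trans _ _ (d / 2)); first by rewrite ge_min lexx orbT.
    have h1 := Zz x Xx.
    have h2 : `|t *: (y - z)| <= `|z - y|.
      by rewrite normrZ ger0_norm // distrC -[leRHS]mul1r ler_wpM2r.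
    have h3 : `|z - x| <= `|z + t *: (y - z) - x| + `|t *: (y - z)|.
      by rewrite -(normrN (t *: _)) (le_trans _ (ler_normD _ _)) // addrAC addrK.
    exact: (half_away h1 h2 h3 zy).
move=> [n _ Hn]; exists (n.+1%:R^-1); first by rewrite invr_gt0 ltr0n.
move=> z Zz; have [z2|z2] := leP 2 `|z|.
  exists outer; split=> //; first exact: outer_connected.
    by rewrite /outer /= /Num.norm /= le_max ler_normr lexx.
  apply: subset_trans (outer_away XD) _; apply: awayW.
  by rewrite invf_le1 ?ltr0n // ler1n.
apply: (Hn n (leqnn n)); split=> //.
move: z2; case: {Zz} z => x y; rewrite /Num.norm /= gt_max !ltr_norml => /andP[h1 h2].
by split; rewrite /= in_itv /= !ltW //; [case/andP: h1|case/andP: h1|case/andP: h2|case/andP: h2].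
Qed.

(** A point close to both [A] and [B] would by compactness be close to their intersection, where
    [tau] is 0 or 1. *)
Lemma transition_away (tau : P -> R) : continuous tau ->
  (forall z, X0 z -> tau z = 1) -> (forall z, Y0 z -> tau z = 0) ->
  exists2 d, 0 < d & forall z, 3^-1 <= tau z <= 2 / 3 -> away A d z \/ away B d z.
Proof.
move=> ct tX tY.
pose Q (n : nat) a := forall z, `|a - z| < n.+1%:R^-1 -> 3^-1 <= tau z <= 2 / 3 ->
   away B n.+1%:R^-1 z.
have kA : compact A by case: cA.
have kB : compact B by case: cB.
have : \forall n \near \oo, A `<=` Q n.
  apply: ((compact_near_coveringP A).1 kA nat \oo Q _) => a Aa.
  have [e e0 He] : exists2 e, 0 < e & forall z, `|a - z| < e -> 3^-1 <= tau z <= 2 / 3 ->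
      forall b, B b -> e <= `|z - b|.
    have [Ba|nBa] := pselect (B a).
      have : nbhs a [set z | ~ (3^-1 <= tau z <= 2 / 3)].
        have : (A `&` B) a by [].
        rewrite ABE => -[/tX ta|/tY ta].
          have : nbhs a (tau @^-1` [set t | 2 / 3 < t]).
            apply: ct; apply: open_nbhs_nbhs; split; first exact: open_gt.
            by rewrite /= ta; case: third_bounds.
          by apply: filterS => z /= h /andP[_]; rewrite leNgt h.
        have : nbhs a (tau @^-1` [set t | t < 3^-1]).
          apply: ct; apply: open_nbhs_nbhs; split; first exact: open_lt.
          by rewrite /= ta; case: third_bounds.
        by apply: filterS => z /= h /andP[]; rewrite leNgt h.
      move=> /nbhs_ballP [e /= e0 He]; exists e => // z az tz.
      by exfalso; apply: (He z) tz; rewrite -ball_normE.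
    have : nbhs a (~` B).
      by apply: open_nbhs_nbhs; split=> //; apply: closed_openC; exact: compact_closed.
    move=> /nbhs_ballP [e /= e0 He]; exists (e / 2); first by rewrite divr_gt0.
    move=> z az _ b Bb; rewrite leNgt; apply/negP => zb; apply: (He b) Bb.
    rewrite -ball_normE /= (_ : a - b = (a - z) + (z - b)); last by rewrite addrA subrK.
    by apply: (le_lt_trans (ler_normD _ _)); rewrite (splitr e) ltrD.
  have e2 : 0 < e / 2 by rewrite divr_gt0.
  exists (ball a (e / 2), [set n | n.+1%:R^-1 < e / 2]).
    by split; [exact: nbhsx_ballx | exact: near_infty_natSinv_lt (PosNum e2)].
  move=> [a' n] /= []; rewrite -ball_normE /= => aa hn z az tz b Bb.
  apply: (@le_trans _ _ e); first by apply: (le_trans (ltW hn)); rewrite ler_pdivrMr // ler_peMr ?ler1n // ltW.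
  apply: He => //; rewrite (_ : a - z = (a - a') + (a' - z)); last by rewrite addrA subrK.
  by apply: (le_lt_trans (ler_normD _ _)); rewrite (splitr e) ltrD // (lt_trans az).
move=> [n _ Hn]; exists (n.+1%:R^-1); first by rewrite invr_gt0 ltr0n.
move=> z tz; have [h|h] := pselect (away A n.+1%:R^-1 z); [by left|right].
apply: contrapT => h'; apply: h => a Aa; rewrite leNgt; apply/negP => za; apply: h'.
by apply: (Hn n (leqnn n) a Aa) => //; rewrite distrC.
Qed.

(** Off [A], and likewise off [B], the argument of [(z - p) / (z - q)] has a branch, since a
    connected set contains both [p] and [q]. As the complement of the union is joined to infinity,
    the two branches differ by one constant and fit together. Twisting by them gives a nowhere zero
    map [h] equal to [z - q] around [X0] and [z - p] around [Y0]. The lift of its angle would give a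
    continuous angle of [z - p] along a large circle. *)
Lemma separation_contradiction : False.
Proof.
have [p Xp] := X0n; have [q Yq] := Y0n.
have [Ap Bp] : A p /\ B p by have : (A `&` B) p by rewrite ABE; left.
have [Aq Bq] : A q /\ B q by have : (A `&` B) q by rewrite ABE; right.
have YX0 : Y0 `&` X0 = set0 by rewrite setIC.
have [tau [ct _ tY tX]] := urysohn_function cY cX YX0.
have [d' d'0 Hd'] := transition_away ct tX tY.
pose d := Num.min d' 1.
have d0 : 0 < d by rewrite lt_min d'0 ltr01.
have d1 : d <= 1 by rewrite ge_min lexx orbT.
have dd' : d <= d' by rewrite ge_min lexx.
move: d d0 d1 dd' => d d0 d1 dd'.
have Hd z : 3^-1 <= tau z <= 2 / 3 -> away A d z \/ away B d z.
  by move=> /Hd' [h|h]; [left|right]; apply: awayW h.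
have [e e0 He] := complement_joined_uniform d0.
(* At distance [c] the branches are available at the points at distance [d], along the joining sets,
   which keep distance [e], and on [outer], which keeps distance 1. *)
pose c := Num.min (Num.min d e) 1.
have c0 : 0 < c by rewrite !lt_min d0 e0 ltr01.
have cd : c <= d by rewrite !ge_min lexx.
have ce : c <= e by rewrite !ge_min lexx orbT.
have c1 : c <= 1 by rewrite ge_min lexx orbT.
have [lA HA] := connected_angle c0 (proj2 cA) Ap Aq.
have [lB HB] := connected_angle c0 (proj2 cB) Bp Bq.
have XA : away X c `<=` away A c by move=> z Zz a Aa; apply: Zz; left.
have XB : away X c `<=` away B c by move=> z Zz a Ba; apply: Zz; right.
pose k := lA (2, 0) - lB (2, 0).
have w0 : away X c (2, 0).
  apply: (awayW c1); apply: outer_away => //.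
  by rewrite /outer /= /Num.norm /= le_max ler_normr lexx.
have kE z : away A d z -> away B d z -> lA z = lB z + k.
  move=> ZA ZB.
  have [|C [nC Cz Cw CX]] := He z; first by move=> x [/ZA|/ZB].
  have CXc : C `<=` away X c by apply: subset_trans CX _; exact: awayW.
  have := @continuous_angle_diff_constant R P C lA lB
    (fun z => (z.1 - p.1) * (z.1 - q.1) + (z.2 - p.2) * (z.2 - q.2))
    (fun z => (z.2 - p.2) * (z.1 - q.1) - (z.1 - p.1) * (z.2 - q.2)) nC.
  move=> /(_ _ _ _ _ _ _ Cz Cw) E; rewrite /k -E; first by rewrite addrC subrK.
  - by apply: continuous_in_subspaceT => x /set_mem /CXc /XA /HA [].
  - by apply: continuous_in_subspaceT => x /set_mem /CXc /XB /HB [].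
  - by move=> x /CXc /XA /HA [].
  - by move=> x /CXc /XB /HB [].
have k1 : cos k = 1.
  exact: is_angle_uniq (proj1 (HA _ (XA _ w0))) (proj1 (HB _ (XB _ w0))).
pose lB' z := lB z + k.
have dc A' : away A' d `<=` away A' c by exact: awayW.
have HB' z : away B d z ->
    is_angle ((z.1 - p.1) * (z.1 - q.1) + (z.2 - p.2) * (z.2 - q.2))
             ((z.2 - p.2) * (z.1 - q.1) - (z.1 - p.1) * (z.2 - q.2)) (lB' z)
    /\ {for z, continuous lB'}.
  move=> /dc /HB [h1 h2]; split; first exact: is_angle_shift.
  by apply: cvgD => //; exact: cvg_cst.
pose lam z := Num.min 1 (Num.max 0 (3 * tau z - 1)).
have clam : continuous lam.
  move=> z.
  have h3 : {for z, continuous (fun z => 3 * tau z - 1 : R^o)}.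
    by apply: cvgB; [apply: cvgMl_tmp; exact: ct | exact: cvg_cst].
  have h4 : {for z, continuous ((cst 0 : P -> R^o) \max (fun z => 3 * tau z - 1 : R^o))}.
    by apply: continuous_max => //; exact: cvg_cst.
  have := @continuous_min R _ (cst 1 : P -> R^o) _ z (@cvg_cst _ _ _ _ _) h4.
  exact.
have lam01 z : 0 <= lam z <= 1 by rewrite /lam le_min ler01 le_max lexx ge_min lexx.
have lam1 z : 2 / 3 <= tau z -> lam z = 1.
  by move=> h; apply: clamp_high.
have lam0 z : tau z <= 3^-1 -> lam z = 0 by move=> h; apply: clamp_low.
have npA A' z : A' p -> away A' d z -> z != p.
  move=> A'p ZA; apply/eqP => E; have := ZA p A'p; rewrite E subrr normr0 => h.
  by move: (lt_le_trans d0 h); rewrite ltxx.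
have nqA A' z : A' q -> away A' d z -> z != q.
  move=> A'q ZA; apply/eqP => E; have := ZA q A'q; rewrite E subrr normr0 => h.
  by move: (lt_le_trans d0 h); rewrite ltxx.
(* At [p], a point of [X0], the first clause applies, and at [q], a point of [Y0], the second one:
   neither translate vanishes where it is used. *)
pose h z : P := if `[< 2 / 3 <= tau z >] then z - q else if `[< tau z <= 3^-1 >] then z - p
  else if `[< away A d z >] then twist p q lam lA z else twist p q lam lB' z.
have hA z : away A d z -> h z = twist p q lam lA z.
  move=> ZA; rewrite /h; case: asboolP => [t1|_].
    by rewrite twist1 ?lam1 ?(npA A) ?(nqA A) //; case: (HA z (dc _ _ ZA)).
  case: asboolP => [t0|_]; first by rewrite twist0 ?lam0.
  by case: asboolP.
have hB z : away B d z -> h z = twist p q lam lB' z.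
  move=> ZB; rewrite /h; case: asboolP => [t1|_].
    by rewrite twist1 ?lam1 ?(npA B) ?(nqA B) //; case: (HB' z ZB).
  case: asboolP => [t0|_]; first by rewrite twist0 ?lam0.
  by case: asboolP => // ZA; rewrite /twist /lB' -kE.
have ch : continuous h.
  apply/continuous_subspace_setT.
  have -> : setT = ([set z | 2 / 3 <= tau z] `|` [set z | tau z <= 3^-1]) `|` (away A d `|` away B d).
    apply/seteqP; split=> // z _.
    have [t1|t1] := leP (2 / 3) (tau z); first by left; left.
    have [t0|t0] := leP (tau z) 3^-1; first by left; right.
    by right; apply: Hd; rewrite !ltW.
  have cl1 : closed [set z | 2 / 3 <= tau z].
    exact: ((continuous_closedP _).1 ct _ (@closed_ge R _)).
  have cl2 : closed [set z | tau z <= 3^-1].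
    exact: ((continuous_closedP _).1 ct _ (@closed_le R _)).
  have sub w : continuous (fun z : P => z - w).
    by move=> z; apply: cvgB; [exact: cvg_id | exact: cvg_cst].
  apply: withinU_continuous; [exact: closedU | by apply: closedU; exact: away_closed | |].
    apply: withinU_continuous => //.
      apply: (@subspace_eq_continuous P [set z | 2 / 3 <= tau z] P (fun z => z - q) h).
        by move=> z /set_mem /= t1; rewrite /h; case: asboolP.
      exact: continuous_subspaceT.
    apply: (@subspace_eq_continuous P [set z | tau z <= 3^-1] P (fun z => z - p) h).
      move=> z /set_mem /= t0; rewrite /h; case: asboolP => [t1|_]; last by case: asboolP.
      by exfalso; exact: third_gap t1 t0.
    exact: continuous_subspaceT.
  apply: withinU_continuous; [exact: away_closed | exact: away_closed | |].
    apply: (@subspace_eq_continuous P (away A d) P (twist p q lam lA) h).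
      by move=> z /set_mem /= ZA; rewrite hA.
    apply: continuous_in_subspaceT => z /set_mem ZA.
    by apply: twist_continuous => //; [exact: (npA A) | case: (HA z (dc _ _ ZA))].
  apply: (@subspace_eq_continuous P (away B d) P (twist p q lam lB') h).
    by move=> z /set_mem /= ZB; rewrite hB.
  apply: continuous_in_subspaceT => z /set_mem ZB.
  by apply: twist_continuous => //; [exact: (npA B) | case: (HB' z ZB)].
have h0 z : h z != 0.
  rewrite /h; case: asboolP => [t1|t1].
    rewrite subr_eq0; apply/eqP => E; move: t1; rewrite E tY //; exact: third_neg.
  case: asboolP => [t0|t0].
    rewrite subr_eq0; apply/eqP => E; move: t0; rewrite E tX //; exact: third_neg'.
  have [ZA|ZB] : away A d z \/ away B d z.
    by apply: Hd; rewrite !ltW // ltNge; apply/negP.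
  - case: asboolP => // _; apply: twist_neq0 => //; [exact: (npA A)|exact: (nqA A)].
  - by case: asboolP => ZA; apply: twist_neq0 => //;
      [exact: (npA A)|exact: (nqA A)|exact: (npA B)|exact: (nqA B)].
(* The circle of radius 3 lies in [outer], hence away from [A]; there [twist_angle] turns the lift
   of [h] into a continuous angle of [z - p]. *)
have [th Hth] := angle_lift ch h0 3.
have far z : sqn z = 3 ^+ 2 -> outer z.
  move=> z9; rewrite /outer /= leNgt; apply/negP => /ltW /sqn_le_sup; rewrite z9; exact: nine_eight.
have farA z : sqn z = 3 ^+ 2 -> away A 1 z by move=> /far /(outer_away AD).
have near z : sqn z = 3 ^+ 2 -> `|z| <= 3.
  move=> z9; rewrite leNgt; apply/negP => z3.
  have h3 : 0 <= 3 :> R by [].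
  move: z9; case: z z3 => x y; rewrite /Num.norm /= lt_max /sqn /= => /orP[] h4.
    have : 3 ^+ 2 < `|x| ^+ 2 by rewrite ltr_pXn2r ?nnegrE.
    rewrite real_normK ?num_real // => h5 E; move: h5.
    by rewrite -E ltNge lerDl sqr_ge0.
  have : 3 ^+ 2 < `|y| ^+ 2 by rewrite ltr_pXn2r ?nnegrE.
  rewrite real_normK ?num_real // => h5 E; move: h5.
  by rewrite -E ltNge lerDr sqr_ge0.
have fA z : sqn z = 3 ^+ 2 -> away A d z by move=> /farA; exact: awayW.
apply: (@circle_no_angle R p 3 _ _ (fun z => th z + lam z * lA z)) => //.
- have := AD Ap; rewrite /disc /= => h1; apply: (le_lt_trans h1).
  by rewrite expr2 -natrM ltr1n.
- move=> z z9; have ZA := fA z z9.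
  have [a _] := Hth z (near z z9); rewrite hA // in a.
  by apply: twist_angle a => //; [exact: (npA A) | exact: (nqA A)].
- apply: continuous_in_subspaceT => z /set_mem /= z9.
  have [_ cz] := Hth z (near z z9); apply: cvgD => //.
  by apply: cvgM; [exact: clam | case: (HA z (dc _ _ (fA z z9)))].
Qed.

End Proof.

Lemma disc_enclosed A B X0 Y0 : continuum A -> continuum B -> A `<=` Disc -> B `<=` Disc ->
  closed X0 -> closed Y0 -> A `&` B = X0 `|` Y0 -> X0 `&` Y0 = set0 ->
  X0 !=set0 -> Y0 !=set0 ->
  exists z, [/\ Disc z, ~ (A `|` B) z &
    forall c, sqn c = 1 -> ~ joined (Disc `&` ~` (A `|` B)) z c].
Proof.
move=> cA cB AD BD cX cY ABE XY X0n Y0n; apply: contrapT => H.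
apply: (separation_contradiction cA cB AD BD cX cY ABE XY X0n Y0n) => z Dz nz.
apply: contrapT => H'; apply: H; exists z; split=> // c c1 J.
by apply: H'; exists c.
Qed.

End Janiszewski.

(** * Discs and their decompositions into continua *)

Section IsDisc.
Variables (R : realType) (T : pseudoMetricType R).
Hypothesis hT : hausdorff_space T.

(* What is used of a closed disc [D] with boundary circle [bd]: [disc_arcs] says
   that crosscuts with interlaced end points cross, and [disc_enclose] that two
   continua with disconnected intersection enclose a region missing [bd]. *)
Record is_disc (D bd : set T) : Prop := IsDisc {
  disc_cpt : compact D;
  disc_conn : connected D;
  disc_lc : locally_continuum D;
  disc_unicoh : unicoherent D;
  disc_bd_closed : closed bd;
  disc_bd_sub : bd `<=` D;
  disc_bd_neq0 : bd !=set0;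
  disc_int_open : open (D `\` bd);
  disc_arcs : forall p q, bd p -> bd q -> p <> q -> exists al be,
    [/\ closed al /\ closed be, connected al /\ connected be, al `|` be = bd,
        [/\ al p, al q, be p & be q] &
        forall a b X Y, al a -> be b -> a <> p -> a <> q -> b <> p -> b <> q ->
          continuum X -> continuum Y -> X `<=` D -> Y `<=` D ->
          X p -> X q -> Y a -> Y b -> X `&` Y !=set0];
  disc_enclose : forall A B X0 Y0, continuum A -> continuum B -> A `<=` D -> B `<=` D ->
    closed X0 -> closed Y0 -> A `&` B = X0 `|` Y0 -> X0 `&` Y0 = set0 ->
    X0 !=set0 -> Y0 !=set0 ->
    exists z, [/\ D z, ~ (A `|` B) z &
      forall c, bd c -> ~ joined (D `&` ~` (A `|` B)) z c]
}.

Local Notation P := (R * R)%type.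
Local Notation Disc := (@disc R).
Local Notation Circle := (@circle R).

Section Transport.
Variable j : P -> T.
Hypothesis cj : continuous j.
Hypothesis ij : forall z w, Disc z -> Disc w -> j z = j w -> z = w.
Hypothesis oj : open (j @` (Disc `\` Circle)).

Let D := j @` Disc.
Let pull (A : set T) := Disc `&` j @^-1` A.

Lemma circle_sub_disc : Circle `<=` Disc.
Proof. by move=> z; rewrite /circle /disc /= => ->. Qed.

Lemma image_compact (A : set P) : compact A -> compact (j @` A).
Proof. by move=> kA; apply: continuous_compact => //; exact: continuous_subspaceT. Qed.

Lemma image_connected (A : set P) : connected A -> connected (j @` A).
Proof. by move=> nA; apply: connected_continuous_connected => //; exact: continuous_subspaceT. Qed.

Lemma image_continuum (A : set P) : continuum A -> continuum (j @` A).
Proof. by move=> [kA nA]; split; [exact: image_compact | exact: image_connected]. Qed.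

Lemma image_pull A : A `<=` D -> j @` pull A = A.
Proof.
move=> AD; apply/seteqP; split=> x; first by move=> [z [_ Az] <-].
by move=> Ax; have [z Dz zx] := AD x Ax; exists z => //; split=> //=; rewrite zx.
Qed.

Lemma pull_closed A : closed A -> closed (pull A).
Proof.
move=> cA; apply: closedI; first exact: disc_closed.
exact: ((continuous_closedP _).1 cj).
Qed.

Lemma pull_compact A : closed A -> compact (pull A).
Proof.
move=> cA; apply: (subclosed_compact _ (@disc_compact R)); [exact: pull_closed | by move=> z []].
Qed.

Lemma pull_connected A : closed A -> A `<=` D -> connected A -> connected (pull A).
Proof.
move=> cA AD nA; apply: connected_of_closed_split; first exact: pull_closed.
move=> X Y cX cY XY XY0 [x Xx] [y Yy].
have XD : X `<=` Disc by move=> z Xz; have : pull A z; [rewrite XY; left | case].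
have YD : Y `<=` Disc by move=> z Yz; have : pull A z; [rewrite XY; right | case].
have k S : closed S -> S `<=` Disc -> closed (j @` S).
  move=> cS SD; apply: (compact_closed hT); apply: image_compact.
  exact: (subclosed_compact cS (@disc_compact R) SD).
have := connected_closed_meet nA (k X cX XD) (k Y cY YD).
case=> [|||t [[_ [z Xz <-]] [w Yw /(ij (YD w Yw) (XD z Xz)) wz]]].
- by rewrite -(image_pull AD) XY image_setU.
- exists (j x); split; last by exists x.
  by have : pull A x; [rewrite XY; left | case].
- exists (j y); split; last by exists y.
  by have : pull A y; [rewrite XY; right | case].
have : (X `&` Y) z by split=> //; rewrite -wz.
by rewrite XY0.
Qed.

Lemma pull_continuum A : continuum A -> A `<=` D -> continuum (pull A).
Proof.
move=> [kA nA] AD; have cA := compact_closed hT kA.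
by split; [exact: pull_compact | exact: pull_connected].
Qed.

Lemma is_disc_image : is_disc D (j @` Circle).
Proof.
have kD : compact D by apply: image_compact; exact: disc_compact.
have DC : Disc `\` Circle `<=` Disc by move=> z [].
split.
- exact: kD.
- by apply: image_connected; exact: disc_connected.
- move=> x O [z Dz zx] oO Ox.
  have oO' : open (j @^-1` O) by apply: open_comp => // y _; exact: cj.
  have [C [U [cC CO oU Uz UC]]] := @disc_locally_continuum R z _ Dz oO' (eq_ind_r O Ox zx).
  exists (j @` C), (~` (j @` (Disc `\` U))); split.
  + exact: image_continuum.
  + by move=> _ [w Cw <-]; have [Ow Dw] := CO w Cw; split=> //; exists w.
  + apply: closed_openC; apply: (compact_closed hT); apply: image_compact.
    apply: (subclosed_compact _ (@disc_compact R)); last by move=> w [].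
    by apply: closedI; [exact: disc_closed | exact: open_closedC].
  + by rewrite -zx => -[w [Dw nUw] /(ij Dw Dz) wz]; apply: nUw; rewrite wz.
  + move=> x' [+ [w Dw wx]]; rewrite -wx => nU; exists w => //; apply: UC; split=> //.
    by apply: contrapT => nUw; apply: nU; exists w.
- move=> A B cA cB nA nB AB.
  have AD : A `<=` D by rewrite -AB; left.
  have BD : B `<=` D by rewrite -AB; right.
  have := @disc_unicoherent R (pull A) (pull B) (pull_closed cA) (pull_closed cB)
    (pull_connected cA AD nA) (pull_connected cB BD nB).
  have -> : pull A `|` pull B = Disc.
    apply/seteqP; split=> z; first by move=> [[]|[]].
    move=> Dz; have : D (j z) by exists z.
    by rewrite -AB => -[?|?]; [left|right].
  move=> /(_ erefl) /image_connected.
  have -> : pull A `&` pull B = pull (A `&` B).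
    by apply/seteqP; split=> z; [move=> [[? ?] [? ?]]|move=> [? [? ?]]].
  by rewrite image_pull // => x [/AD].
- apply: (compact_closed hT); apply: image_compact.
  apply: (subclosed_compact _ (@disc_compact R)); first exact: circle_closed.
  exact: circle_sub_disc.
- by move=> _ [z /circle_sub_disc Dz <-]; exists z.
- exists (j (1, 0)); exists (1, 0) => //.
  by rewrite /circle /= /sqn /= expr1n expr0n addr0.
- rewrite (_ : D `\` _ = j @` (Disc `\` Circle)) //.
  apply/seteqP; split=> x.
    by move=> [[z Dz <-] nC]; exists z => //; split=> // Cz; apply: nC; exists z.
  move=> [z [Dz nCz] <-]; split; first by exists z.
  by move=> [w Cw /(ij (circle_sub_disc Cw) Dz) wz]; apply: nCz; rewrite -wz.
- move=> _ _ [p p1 <-] [q q1 <-] pq.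
  have {}pq : p != q by apply/eqP => E; apply: pq; rewrite E.
  have qp : q != p by rewrite eq_sym.
  have kA (a b : P) : compact (circle_arc a b).
    apply: (subclosed_compact _ (@disc_compact R)); first exact: arc_closed.
    by move=> z [z1 _]; exact: circle_sub_disc.
  have sd (a b : P) : side a b a = 0 :> R by rewrite /side !subrr !mulr0 subrr.
  have sd' (a b : P) : side a b b = 0 :> R by rewrite /side mulrC subrr.
  exists (j @` circle_arc p q), (j @` circle_arc q p); split.
  + by split; apply: (compact_closed hT); apply: image_compact.
  + by split; apply: image_connected; exact: arc_connected.
  + rewrite -image_setU; congr (j @` _); apply/seteqP; split=> z; first by move=> [[]|[]].
    move=> z1; have [h|h] := leP 0 (side p q z); first by left.
    by right; split=> //; rewrite sideC oppr_ge0 ltW.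
  + by split; [exists p|exists q|exists p|exists q] => //; split; rewrite ?sd ?sd'.
  + move=> _ _ X Y [a [a1 sa] <-] [b [b1 sb] <-] ap aq bp bq cX cY XD YD Xp Xq Ya Yb.
    have strict z : sqn z = 1 -> j z <> j p -> j z <> j q -> side p q z != 0.
      move=> z1 zp zq; apply/eqP => s0.
      by have [E|E] := circle_side0 pq p1 q1 z1 s0; [apply: zp|apply: zq]; rewrite E.
    have sa0 : 0 < side p q a by rewrite lt_neqAle eq_sym strict.
    have sb0 : side p q b < 0.
      by rewrite lt_neqAle strict //=; move: sb; rewrite sideC oppr_ge0.
    have dsc z : sqn z = 1 -> Disc z by exact: circle_sub_disc.
    have [z [[_ Xz] [_ Yz]]] := disc_crossing p1 q1 a1 b1 sa0 sb0
      (pull_continuum cX XD) (@subIsetl _ _ _) (conj (dsc _ p1) Xp) (conj (dsc _ q1) Xq)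
      (pull_continuum cY YD) (@subIsetl _ _ _) (conj (dsc _ a1) Ya) (conj (dsc _ b1) Yb).
    by exists (j z).
- move=> A B X0 Y0 cA cB AD BD cX cY ABE XY [x Xx] [y Yy].
  have sub S x' : S x' -> S `<=` A `&` B -> pull S !=set0.
    by move=> Sx /(_ x' Sx) [Ax _]; have [z Dz zx] := AD x' Ax; exists z; split=> //=; rewrite zx.
  have [||||z [Dz nz Hz]] := @disc_enclosed R (pull A) (pull B) (pull X0) (pull Y0)
    (pull_continuum cA AD) (pull_continuum cB BD) (@subIsetl _ _ _) (@subIsetl _ _ _)
    (pull_closed cX) (pull_closed cY).
  + apply/seteqP; split=> z.
      move=> [[Dz Az] [_ Bz]]; have : (A `&` B) (j z) by [].
      by rewrite ABE => -[?|?]; [left|right].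
    move=> [[Dz Xz]|[Dz Yz]].
      by have : (A `&` B) (j z); [rewrite ABE; left | case].
    by have : (A `&` B) (j z); [rewrite ABE; right | case].
  + apply/seteqP; split=> // z [[_ Xz] [_ Yz]].
    by have : (X0 `&` Y0) (j z) by []; rewrite XY.
  + by apply: (sub _ x) => //; rewrite ABE; left.
  + by apply: (sub _ y) => //; rewrite ABE; right.
  exists (j z); split; first by exists z.
    by move=> [Az|Bz]; apply: nz; [left|right].
  move=> _ [c c1 <-] [C [cC Cz Cc CO]]; apply: (Hz c c1).
  have CD : C `<=` D by move=> w /CO [].
  exists (pull C); split=> //.
  + exact: pull_continuum.
  + by split=> //; exact: circle_sub_disc.
  + move=> w [Dw Cw]; split=> // h; have [_] := CO _ Cw; apply.
    by case: h => -[_ h]; [left|right].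
Qed.

End Transport.
End IsDisc.

(** * Small discs in a surface *)

Section Charts.
Variables (R : realType) (M : metricType R).
Local Notation P := (R * R)%type.
Local Notation Disc := (@disc R).
Local Notation Circle := (@circle R).
Local Notation V2 := 'rV[R]_2.

Definition row_of (z : P) : V2 := z.1 *: delta_mx 0 0 + z.2 *: delta_mx 0 1.

Lemma row_eqP (v w : V2) : v 0 0 = w 0 0 -> v 0 1 = w 0 1 -> v = w.
Proof.
move=> h0 h1; apply/rowP => i; case: i => [[|[|//]]] /= p.
  by rewrite (_ : Ordinal p = 0) //; apply: val_inj.
by rewrite (_ : Ordinal p = 1) //; apply: val_inj.
Qed.

Lemma row_of_continuous : continuous row_of.
Proof.
by move=> z; apply: cvgD; apply: cvgZl; [exact: cvg_fst | exact: cvg_snd].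
Qed.

Lemma within_open_continuous (T U : topologicalType) (A : set T) (f : T -> U) x :
  open A -> {within A, continuous f} -> A x -> {for x, continuous f}.
Proof.
move=> oA; rewrite (continuous_open_subspace f oA) => cf Ax.
by apply: cf; exact: mem_set.
Qed.

Lemma disc_nbhd (x : M) (O : set M) : boundaryless_surface M -> open O -> O x ->
  exists D bd, [/\ is_disc D bd, D `<=` O & (D `\` bd) x].
Proof.
move=> sM oO Ox; have hM := @metric_hausdorff R M.
have [U [V [phi [psi [Ux [[oU oV] [fU gV] [pf fp] [cphi cpsi]]]]]]] := sM x.
pose c := phi x.
have Vc : V c by apply: fU; exists x.
have cpsi' v : V v -> {for v, continuous psi} by exact: within_open_continuous.
have cphi' v : U v -> {for v, continuous phi} by exact: within_open_continuous.
have : nbhs c [set v | V v /\ O (psi v)].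
  apply: filterI; first exact: open_nbhs_nbhs.
  by apply: (cpsi' c Vc); apply: open_nbhs_nbhs; split=> //; rewrite /c pf.
move=> /nbhs_ballP [e /= e0 He].
pose s := e / 2.
have s0 : 0 < s by rewrite divr_gt0.
pose k (z : P) : V2 := c + s *: row_of z.
have k0 z : k z 0 0 = c 0 0 + s * z.1 by rewrite /k !mxE /= mulr1 mulr0 addr0.
have k1 z : k z 0 1 = c 0 1 + s * z.2 by rewrite /k !mxE /= mulr1 mulr0 add0r.
have kV z : Disc z -> V (k z) /\ O (psi (k z)).
  move=> Dz; apply: He; split=> // i j; rewrite ord1.
  have := disc_norm Dz; case: z Dz => a b Dz; rewrite /Num.norm /= ge_max => /andP[ha hb].
  have bnd (u w : R) : `|w| <= 1 -> ball u e (u + s * w).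
    move=> w1; rewrite -ball_normE /= opprD addrA subrr sub0r normrN normrM (gtr0_norm s0).
    apply: (le_lt_trans (ler_wpM2l (ltW s0) w1)); rewrite mulr1 /s; move: e0; clear; lra.
  case: j => [[|[|//]]] p.
    by rewrite (_ : Ordinal p = 0); [rewrite k0; exact: bnd | apply: val_inj].
  by rewrite (_ : Ordinal p = 1); [rewrite k1; exact: bnd | apply: val_inj].
have ck : continuous k.
  by move=> z; apply: cvgD; [exact: cvg_cst | apply: cvgZr; exact: row_of_continuous].
have ik z w : k z = k w -> z = w.
  move=> E; apply: injective_projections.
    by have := congr1 (fun v : V2 => v 0 0) E; rewrite !k0 => /addrI /(mulfI (lt0r_neq0 s0)).
  by have := congr1 (fun v : V2 => v 0 1) E; rewrite !k1 => /addrI /(mulfI (lt0r_neq0 s0)).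
(* [psi] is known to be continuous on [V] only; composing with [retract] makes [j] continuous on the
   whole plane. *)
pose j (z : P) := psi (k (retract z)).
have cj : continuous j.
  move=> z; apply: (@continuous_comp _ _ _ (fun z => k (retract z)) psi).
    by apply: (@continuous_comp _ _ _ (@retract R) k); [exact: retract_continuous | exact: ck].
  by apply: cpsi'; case: (kV _ (retract_disc z)).
have jE z : Disc z -> j z = psi (k z) by move=> Dz; rewrite /j retract_id.
have ij z w : Disc z -> Disc w -> j z = j w -> z = w.
  move=> Dz Dw; rewrite !jE // => E; apply: ik.
  by rewrite -(fp _ (proj1 (kV z Dz))) E fp //; case: (kV w Dw).
pose inv (v : V2) : P := ((v 0 0 - c 0 0) / s, (v 0 1 - c 0 1) / s).
have invK z : inv (k z) = z.
  apply: injective_projections; rewrite /inv /=.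
    by rewrite k0 addrAC subrr add0r mulrAC divff ?mul1r // gt_eqF.
  by rewrite k1 addrAC subrr add0r mulrAC divff ?mul1r // gt_eqF.
have kK v : k (inv v) = v.
  by apply: row_eqP; rewrite ?k0 ?k1 /inv /= mulrCA divff ?mulr1 ?gt_eqF // addrC subrK.
have cinv : continuous inv.
  move=> v; apply: (@cvg_pair _ _ _ (nbhs v) (nbhs (inv v).1) (nbhs (inv v).2) _ _ _
    (fun v : V2 => (v 0 0 - c 0 0) / s) (fun v : V2 => (v 0 1 - c 0 1) / s));
  apply: cvgMr_tmp; apply: cvgB; try exact: cvg_cst; exact: coord_continuous.
pose W : set V2 := [set v | sqn (inv v) < 1].
have oW : open W.
  have cs : continuous (fun v => sqn (inv v)).
    by move=> v; apply: (@continuous_comp _ _ _ inv (@sqn R)); [exact: cinv | exact: sqn_continuous].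
  rewrite (_ : W = (fun v => sqn (inv v)) @^-1` [set x | x < 1]) //.
  by apply: open_comp; [move=> v _; exact: cs | exact: open_lt].
have oj : open (j @` (Disc `\` Circle)).
  have -> : j @` (Disc `\` Circle) = [set y | U y /\ W (phi y)].
    apply/seteqP; split=> y.
      move=> [z [Dz nz] <-]; have [Vz _] := kV z Dz; rewrite jE //; split.
        by apply: gV; exists (k z).
      by rewrite fp // /W /= invK lt_neqAle Dz andbT; apply/eqP.
    move=> [Uy Wy]; have Dz : Disc (inv (phi y)) by exact: ltW.
    exists (inv (phi y)).
      by split=> // E; move: Wy; rewrite /W /= E ltxx.
    by rewrite jE // kK pf.
  rewrite openE => y [Uy Wy]; apply: filterI; first exact: open_nbhs_nbhs.
  by apply: (cphi' y Uy); exact: open_nbhs_nbhs.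
exists (j @` Disc), (j @` Circle); split.
- exact: is_disc_image.
- by move=> _ [z Dz <-]; rewrite jE //; case: (kV z Dz).
- have D0 : Disc 0 by rewrite /disc /= /sqn /= !expr0n addr0 ler01.
  have k00 : k 0 = c by rewrite /k /row_of /= !scale0r addr0 scaler0 addr0.
  have j0 : j 0 = x by rewrite jE // k00 /c pf.
  split; first by exists 0.
  move=> [w Cw]; rewrite -j0 => /(ij _ _ (circle_sub_disc Cw) D0) E.
  move: Cw; rewrite E /circle /= /sqn /= !expr0n addr0 => /esym/eqP.
  by rewrite oner_eq0.
Qed.

End Charts.

(** * The tree of plaques of a decomposition *)

Section Tree.
Variables (R : realType) (T : pseudoMetricType R).
Hypothesis hT : hausdorff_space T.
Variables (D bd : set T).
Hypothesis dD : is_disc D bd.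

(** [dec_usc] is upper semicontinuity, in the form that saturations of closed sets are closed. Since
    every plaque reaches [bd], the plaques behave like the points of a tree with [psep] as
    betweenness. *)
Record decomposition (S : T -> set T) : Prop := Decomposition {
  dec_refl : forall z, D z -> S z z;
  dec_sub : forall z, D z -> S z `<=` D;
  dec_continuum : forall z, D z -> continuum (S z);
  dec_eq : forall z w, D z -> S z w -> S w = S z;
  dec_bd : forall z, D z -> exists2 b, bd b & S z b;
  dec_usc : forall F, closed F -> F `<=` D -> closed [set z | D z /\ S z `&` F !=set0]
}.

Let kD := disc_cpt dD.
Let nD := disc_conn dD.
Let lD := disc_lc dD.
Let clD : closed D := compact_closed hT kD.
Let bdD := disc_bd_sub dD.

Variable S : T -> set T.
Hypothesis dS : decomposition S.

Lemma plaque_closed z : D z -> closed (S z).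
Proof. by move=> Dz; apply: (compact_closed hT); case: (dec_continuum dS Dz). Qed.

Lemma plaque_sym z w : D z -> S z w -> S w z.
Proof. by move=> Dz Szw; rewrite (dec_eq dS Dz Szw); exact: dec_refl. Qed.

Lemma plaque_disjoint z w x : D z -> D w -> ~ S z w -> S z x -> ~ S w x.
Proof.
move=> Dz Dw zw Szx Swx; apply: zw.
rewrite -(dec_eq dS Dz Szx) (dec_eq dS Dw Swx); exact: dec_refl.
Qed.

Definition sat (F : set T) : set T := [set z | D z /\ S z `&` F !=set0].

Lemma sat_sub F : F `<=` D -> F `<=` sat F.
Proof.
move=> FD z Fz; have Dz := FD z Fz; split=> //; exists z; split=> //; exact: dec_refl.
Qed.

Lemma sat_D F : sat F `<=` D. Proof. by move=> z []. Qed.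

Lemma sat_saturated F z : sat F z -> S z `<=` sat F.
Proof.
move=> [Dz SF] w Sw; split; first exact: (dec_sub dS Dz).
by rewrite (dec_eq dS Dz Sw).
Qed.

Lemma sat_closed F : closed F -> F `<=` D -> closed (sat F).
Proof. exact: dec_usc. Qed.

Lemma sat_connected F : connected F -> F `<=` D -> connected (sat F).
Proof.
move=> nF FD; have [[f Ff]|F0] := pselect (F !=set0); last first.
  rewrite (_ : sat F = set0); first exact: connected0.
  by apply/seteqP; split=> // z [_ [w [_ Fw]]]; case: F0; exists w.
apply: (@connected_sub_cover _ F) => //; [exact: sat_sub| |by exists f].
move=> z sz; have [Dz SF] := sz; exists (S z); first by case: (dec_continuum dS Dz).
by split; [exact: dec_refl | split=> //; exact: sat_saturated].
Qed.

(* The plaque of [r] separates [p] from [q] in [D]. *)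
Definition psep r p q := [/\ ~ S r p, ~ S r q & ~ joined (D `&` ~` S r) p q].

Lemma psep_sym r p q : psep r p q -> psep r q p.
Proof. by move=> [h1 h2 h3]; split=> // /joined_sym. Qed.

Lemma plaque_joined r z w : D r -> D z -> ~ S r z -> S z w -> joined (D `&` ~` S r) z w.
Proof.
move=> Dr Dz nrz Szw; exists (S z); split=> //.
- exact: dec_continuum.
- exact: dec_refl.
- move=> x Szx; split; first exact: (dec_sub dS Dz).
  move=> Srx; apply: (plaque_disjoint Dr Dz nrz Srx Szx).
Qed.

Lemma psep_plaque r p q p' : D r -> D p -> psep r p q -> S p p' -> psep r p' q.
Proof.
move=> Dr Dp [h1 h2 h3] pp'; have J := plaque_joined Dr Dp h1 pp'.
split=> //; first by have [_ []] := joined_mem J.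
by move=> J'; apply: h3; exact: joined_trans J J'.
Qed.

(** The class of [p] off both plaques touches their union; the plaque touched is reached without
    meeting the other one. *)
Lemma first_hit p r s : D p -> D r -> D s -> ~ S r p -> ~ S s p -> ~ S r s ->
  joined (D `&` ~` S s) p r \/ joined (D `&` ~` S r) p s.
Proof.
move=> Dp Dr Ds nrp nsp nrs.
have nsr : ~ S s r by move=> h; apply: nrs; exact: plaque_sym.
have cF : closed (S r `|` S s) by apply: closedU; exact: plaque_closed.
have FD : S r `|` S s `<=` D by move=> x [|]; exact: dec_sub.
have F0 : (S r `|` S s) !=set0 by exists r; left; exact: dec_refl.
have nFp : ~ (S r `|` S s) p by move=> [].
have [f [clf Ff]] := joined_touch hT kD lD nD cF FD F0 Dp nFp.
have key u v : D u -> D v -> ~ S u v -> S u f -> S v `<=` S r `|` S s -> ~ S v p -> joined (D `&` ~` S v) p u.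
  move=> Du Dv nuv Suf vF nvp.
  have ov : open (~` S v) by apply: closed_openC; exact: plaque_closed.
  have nvf : ~ S v f by exact: (plaque_disjoint Du Dv nuv Suf).
  have Df : D f by exact: (dec_sub dS Du).
  have J : joined (D `&` ~` S v) p f.
    apply: (joined_closure lD ov nvf Df).
    apply: closureS clf => c /=; apply: joined_sub => x [Dx nx]; split=> // Svx.
    by apply: nx; exact: vF.
  apply: (joined_trans J); apply: plaque_joined => //; exact: plaque_sym.
by case: Ff => Sf; [left; apply: key => // x; right | right; apply: key => // x; left].
Qed.

(** The order is [p], [s], [r], [q]: by [first_hit] the plaque of [s] is reached from [p] without
    crossing that of [r]. *)
Lemma psep_trans r s p q : D r -> D s -> D p -> D q -> psep r p q -> psep s p r ->
  psep s p q /\ psep r s q.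
Proof.
move=> Dr Ds Dp Dq [nrp nrq nj] [nsp nsr nj'].
have nrs : ~ S r s by move=> h; apply: nsr; exact: plaque_sym.
have ps : joined (D `&` ~` S r) p s by case: (first_hit Dp Dr Ds nrp nsp nrs).
have sep2 : psep r s q.
  by split=> // sq; apply: nj; exact: joined_trans ps sq.
split=> //; split=> //.
  by move=> Ssq; case: sep2 => _ _; apply; exact: plaque_joined.
move=> [C [cC Cp Cq CO]]; apply: nj'.
have [[x [Cx rx]]|Cr] := pselect (C `&` S r !=set0).
  apply: (@joined_trans _ _ _ x _ r); first by exists C.
  have Dx : D x by have [] := CO x Cx.
  apply: plaque_joined => //; first by have [] := CO x Cx.
  exact: plaque_sym.
exfalso; apply: nj; exists C; split=> // x Cx; have [Dx _] := CO x Cx; split=> // rx.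
by apply: Cr; exists x.
Qed.

(** [N] plays the role of the segment from [p] to [q] in the tree. It is the intersection of the
    saturations of the two boundary arcs, connected by unicoherence; a plaque meeting both arcs
    crosses every continuum from [p] to [q]. *)
Lemma chain_exists p q : bd p -> bd q -> p <> q -> exists N,
  [/\ closed N, connected N /\ N `<=` D, forall z, N z -> S z `<=` N, N p /\ N q &
   forall r, N r -> S r p \/ S r q \/ psep r p q].
Proof.
move=> bp bq pq.
have [al [be [[cal cbe] [nal nbe] ab [alp alq bep beq] cross]]] := disc_arcs dD bp bq pq.
have alD : al `<=` D by apply: subset_trans bdD; rewrite -ab; left.
have beD : be `<=` D by apply: subset_trans bdD; rewrite -ab; right.
have cov : sat al `|` sat be = D.
  apply/seteqP; split=> z; first by move=> [/sat_D|/sat_D].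
  move=> Dz; have [b bdb Sb] := dec_bd dS Dz; move: bdb; rewrite -ab => -[h|h].
    by left; split=> //; exists b.
  by right; split=> //; exists b.
exists (sat al `&` sat be); split.
- by apply: closedI; exact: sat_closed.
- split; last by move=> z [/sat_D].
  by apply: (disc_unicoh dD) => //; [exact: sat_closed|exact: sat_closed|exact: sat_connected|exact: sat_connected].
- by move=> z [z1 z2] w Szw; split; [exact: (sat_saturated z1)|exact: (sat_saturated z2)].
- by split; split; exact: sat_sub.
move=> r [[Dr [a [ra ala]]] [_ [b [rb beb]]]].
have [|nrp] := pselect (S r p); first by left.
have [|nrq] := pselect (S r q); first by right; left.
right; right; split=> // -[C [cC Cp Cq CO]].
have ne u v : S r u -> ~ S r v -> u <> v by move=> h1 h2 E; apply: h2; rewrite -E.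
have CD : C `<=` D by move=> x /CO [].
have [x [Cx rx]] := cross a b C (S r) ala beb (ne _ _ ra nrp) (ne _ _ ra nrq)
  (ne _ _ rb nrp) (ne _ _ rb nrq) cC (dec_continuum dS Dr) CD (dec_sub dS Dr) Cp Cq ra rb.
by have [_] := CO x Cx.
Qed.

(** The chain from a boundary point of [Y] to one of the plaque of [q] is connected, so it is not
    covered by the disjoint closed sets [Y] and that plaque. A plaque of the chain in the gap
    separates. *)
Lemma separating_plaque Y q : closed Y -> connected Y -> Y `<=` D -> Y !=set0 ->
  (forall z, Y z -> S z `<=` Y) -> D q -> ~ Y q ->
  exists r, [/\ D r, ~ Y r & forall y, Y y -> psep r y q].
Proof.
move=> cY nY YD [y Yy] Ysat Dq nYq.
have [p bp yp] := dec_bd dS (YD y Yy).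
have [q' bq qq'] := dec_bd dS Dq.
have Yp : Y p by exact: (Ysat y).
have nYq' : ~ Y q' by move=> h; apply: nYq; apply: (Ysat q' h); exact: plaque_sym.
have pq : p <> q' by move=> E; apply: nYq'; rewrite -E.
have [N [cN [nN ND] Nsat [Np Nq] Nsep]] := chain_exists bp bq pq.
have Dp := bdD bp; have Dq' := bdD bq.
have [r [Nr nYr nqr]] : exists r, [/\ N r, ~ Y r & ~ S q' r].
  apply: contrapT => H.
  have := connected_closed_meet nN cY (plaque_closed Dq').
  case=> [|||x [[_ Yx] qx]].
  - move=> x Nx; apply: contrapT => h; apply: H; exists x; split=> // h'; apply: h; [left|right] => //.
  - by exists p.
  - by exists q'; split=> //; exact: dec_refl.
  by apply: nYq'; apply: (Ysat x Yx); exact: plaque_sym.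
have Dr := ND r Nr.
have nrq : ~ S r q' by move=> h; apply: nqr; exact: plaque_sym.
have dis z : Y z -> ~ S r z by move=> Yz h; apply: nYr; apply: (Ysat z Yz); exact: plaque_sym.
have sep : psep r p q' by case: (Nsep r Nr) => [h|[h|//]]; [case: (dis p)|].
exists r; split=> // z Yz.
have sep' : psep r p q.
  by apply/psep_sym/(psep_plaque Dr Dq' (psep_sym sep)); exact: plaque_sym.
case: sep' => h1 h2 h3; split=> //; first exact: dis.
move=> zq; apply: h3; apply: joined_trans zq; exists Y; split=> //.
- by split=> //; exact: (subclosed_compact cY kD YD).
- by move=> x Yx; split; [exact: YD | exact: dis].
Qed.

Lemma joined_avoid p q r s : D p -> D q -> D r -> D s -> psep r p q -> psep r s p ->
  ~ S p q -> ~ S p s -> joined (D `&` ~` S p) s q.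
Proof.
move=> Dp Dq Dr Ds rpq rsp npq nps.
have [nrp nrq _] := rpq; have [nrs _ nj] := rsp.
have np' : ~ S r p by [].
have h1 : joined (D `&` ~` S p) s r.
  by case: (first_hit Ds Dr Dp nrs nps nrp).
have h2 : joined (D `&` ~` S p) q r.
  by case: (first_hit Dq Dr Dp nrq npq nrp) => // h; case: (psep_sym rpq).
exact: joined_trans h1 (joined_sym h2).
Qed.

(** The second case is the branch point where [t] is attached to the segment from [p] to [q]; [r1]
    and [r2] keep this point away from the ends. Without such an [r], the chain from [p] to [q] is
    covered by the plaques off which [t] is joined to [q] and those off which it is joined to [p];
    some plaque is of both kinds and fails to separate [p] from [q]. *)
Lemma projection t p q r1 r2 : D t -> D p -> D q -> D r1 -> D r2 ->
  psep r1 p q -> psep r1 t p -> psep r2 p q -> psep r2 t q ->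
  psep t p q \/ exists r, [/\ D r, psep r p q, psep r t p & psep r t q].
Proof.
move=> Dt Dp Dq Dr1 Dr2 s1 s1' s2 s2'.
have [p' bp pp'] := dec_bd dS Dp; have [q' bq qq'] := dec_bd dS Dq.
have Dp' := bdD bp; have Dq' := bdD bq.
have to' r : D r -> psep r p q -> psep r p' q'.
  by move=> Dr /(psep_plaque Dr Dp) /(_ pp') /psep_sym /(psep_plaque Dr Dq) /(_ qq') /psep_sym.
have of' r : D r -> psep r p' q' -> psep r p q.
  move=> Dr /(psep_plaque Dr Dp') /(_ (plaque_sym Dp pp')) /psep_sym.
  by move=> /(psep_plaque Dr Dq') /(_ (plaque_sym Dq qq')) /psep_sym.
have pq : p' <> q'.
  by move=> E; case: (to' _ Dr1 s1) => h _; rewrite E => h'; apply: h'; apply: joined_refl; rewrite -E.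
have [N [cN [nN ND] Nsat [Np Nq] Nsep]] := chain_exists bp bq pq.
have npt : ~ S p t.
  move=> h; case: s1' => h1 h2; apply; apply: joined_sym; exact: plaque_joined.
have nqt : ~ S q t.
  move=> h; case: s2' => h1 h2; apply; apply: joined_sym; exact: plaque_joined.
have npq : ~ S p q.
  move=> h; case: s1 => h1 h2; apply; exact: plaque_joined.
have nqp : ~ S q p by move=> h; apply: npq; exact: plaque_sym.
have tq : joined (D `&` ~` S p) t q by exact: (joined_avoid Dp Dq Dr1 Dt).
have tp : joined (D `&` ~` S q) t p by exact: (joined_avoid Dq Dp Dr2 Dt (psep_sym s2)).
have [Nt|nNt] := pselect (N t).
  left; case: (Nsep t Nt) => [h|[h|/of']]; last exact.
    by exfalso; apply: npt; rewrite -(dec_eq dS Dp pp'); exact: plaque_sym.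
  by exfalso; apply: nqt; rewrite -(dec_eq dS Dq qq'); exact: plaque_sym.
apply: contrapT => H.
have H1 : ~ psep t p q by move=> h; apply: H; left.
have H2 r : D r -> psep r p q -> psep r t p -> psep r t q -> False.
  by move=> *; apply: H; right; exists r.
(* [O w] collects the [r] whose plaque does not prevent [t] from being joined to [w]; written with
   complements of saturations it is visibly open. *)
pose fam w := [set C | continuum C /\ C `<=` D /\ C t /\ C w].
pose O w := \bigcup_(C in fam w) ~` sat C.
have oO w : open (O w).
  apply: bigcup_open => C [[kC nC] [CD _]]; apply: closed_openC.
  by apply: sat_closed => //; exact: compact_closed.
have OE w r : D r -> O w r -> joined (D `&` ~` S r) t w.
  move=> Dr [C [cC [CD [Ct Cw]]] nr]; exists C; split=> // x Cx; split; first exact: CD.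
  by move=> rx; apply: nr; split=> //; exists x.
have EO w r : joined (D `&` ~` S r) t w -> O w r.
  move=> [C [cC Ct Cw CO]]; exists C; first by split=> //; split=> // x /CO [].
  by move=> [_ [x [rx Cx]]]; have [_] := CO x Cx.
have Srt r : N r -> ~ S r t by move=> Nr h; apply: nNt; exact: (Nsat r).
have := connected_open_meet nN (oO q) (oO p).
case=> [|||r [[Nr Oq] Op]].
- move=> r Nr; have Dr := ND r Nr.
  case: (Nsep r Nr) => [rp|[rq|/(of' _ Dr) rpq]].
  + left; apply: EO; rewrite (_ : S r = S p) //.
    by rewrite -(dec_eq dS Dr rp) (dec_eq dS Dp pp').
  + right; apply: EO; rewrite (_ : S r = S q) //.
    by rewrite -(dec_eq dS Dr rq) (dec_eq dS Dq qq').
  + have [rp rq _] := rpq.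
    have [h|h] := pselect (joined (D `&` ~` S r) t p); first by right; exact: EO.
    left; apply: EO; apply: contrapT => h'.
    by apply: (H2 r Dr rpq); split=> //; exact: Srt.
- exists p'; split=> //; apply: EO.
  by rewrite (dec_eq dS Dp pp').
- exists q'; split=> //; apply: EO.
  by rewrite (dec_eq dS Dq qq').
have Dr := ND r Nr.
have jq := OE q r Dr Oq; have jp := OE p r Dr Op.
case: (Nsep r Nr) => [rp|[rq|/(of' _ Dr) [_ _]]].
- have [_ [_ h]] := joined_mem jp; apply: h.
  by rewrite -(dec_eq dS Dr rp) (dec_eq dS Dp pp'); exact: dec_refl.
- have [_ [_ h]] := joined_mem jq; apply: h.
  by rewrite -(dec_eq dS Dr rq) (dec_eq dS Dq qq'); exact: dec_refl.
- by apply; exact: joined_trans (joined_sym jp) jq.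
Qed.

End Tree.

(** * Ultralimits and dynamics *)

Section Limits.
Variables (R : realType) (M : metricType R).
Hypothesis kM : compact [set: M].

Lemma open_mball (z : M) (r : R) : open [set w | mdist w z < r].
Proof.
rewrite openE => w /= wz; apply/nbhs_ballP; exists (r - mdist w z) => /=; first by rewrite subr_gt0.
move=> v; rewrite ballEmdist /= => wv; have := metric_triangle v w z.
by rewrite (metric_sym v w); lra.
Qed.

Lemma open_has_mball (O : set M) z : open O -> O z -> exists2 r, 0 < r & [set w | mdist w z < r] `<=` O.
Proof.
rewrite openE => oO /oO /nbhs_ballP [r r0 h]; exists r => // w wz; apply: h.
by rewrite ballEmdist /= metric_sym.
Qed.

Lemma continuous_modulus (g : M -> M) z r : continuous g -> 0 < r ->
  exists2 s, 0 < s & forall w, mdist w z < s -> mdist (g w) (g z) < r.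
Proof.
move=> cg r0; have o : open (g @^-1` [set w | mdist w (g z) < r]).
  by apply: open_comp => [x _|]; [exact: cg | exact: open_mball].
have [|s s0 h] := open_has_mball (z := z) o; first by rewrite /= mdistxx.
by exists s => // w /h.
Qed.

Lemma closed_mball (z : M) (r : R) : closed [set w | mdist w z <= r].
Proof.
rewrite (_ : [set w | _] = ~` [set w | r < mdist w z]); last first.
  by apply/seteqP; split=> w /=; rewrite leNgt => /negP.
apply: open_closedC; rewrite openE => w /= wz; apply/nbhs_ballP.
exists (mdist w z - r) => /=; first by rewrite subr_gt0.
by move=> v; rewrite ballEmdist /= => wv; have := metric_triangle w v z; lra.
Qed.

Variable F : set_system nat.
Hypothesis UF : UltraFilter F.
Hypothesis Foo : \oo `<=` F.

Let PF : ProperFilter F := ultra_proper.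

Lemma ultra_contra (P Q : set nat) : F P -> F Q -> (forall n, P n -> Q n -> False) -> False.
Proof.
by move=> FP FQ h; apply: (@filter_not_empty _ F); apply: filterS (filterI FP FQ) => n [] /h.
Qed.

Lemma ultra_em (P : set nat) : F P \/ F (~` P).
Proof. exact: in_ultra_setVsetC. Qed.

Lemma ultra_ex (P : set nat) N : F P -> exists2 n, (N <= n)%N & P n.
Proof.
move=> FP; apply: contrapT => h; have : F [set n | (N <= n)%N] by apply: Foo; exists N.
by move/(ultra_contra FP); apply => n Pn Nn; apply: h; exists n.
Qed.

Lemma ultra_ge N : F [set n | (N <= n)%N].
Proof. by apply: Foo; exists N. Qed.

Lemma ultra_small (r : R) : 0 < r -> F [set n | n.+1%:R^-1 < r].
Proof. by move=> r0; apply: Foo; exact: near_infty_natSinv_lt (PosNum r0). Qed.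

(** Along an ultrafilter every sequence of the compact space converges, so no subsequences have to
    be chosen. *)
Definition tends (a : nat -> M) p := forall r, 0 < r -> F [set n | mdist (a n) p < r].

Lemma tends_exists a : exists p, tends a p.
Proof.
have Fa : ProperFilter (a @ F) by exact: fmap_proper_filter.
have [p [_ clp]] := kM Fa (filterT : F [set n | True]).
exists p => r r0; case: (ultra_em [set n | mdist (a n) p < r]) => // FN; exfalso.
have [||x [/= h1 h2]] := clp [set w | ~ mdist w p < r] [set w | mdist w p < r]; last exact: h1.
  exact: FN.
by apply: open_nbhs_nbhs; split; [exact: open_mball | rewrite /= mdistxx].
Qed.

Lemma tends_ge a b p q c : tends a p -> tends b q -> F [set n | c <= mdist (a n) (b n)] ->
  c <= mdist p q.
Proof.
move=> ap bq Fc; rewrite leNgt; apply/negP => cpq.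
have r0 : 0 < (c - mdist p q) / 2 by rewrite divr_gt0 // subr_gt0.
apply: (ultra_contra (filterI (ap _ r0) (bq _ r0)) Fc) => n [] /= h1 h2 h3.
have := metric_triangle (a n) p (b n); have := metric_triangle p q (b n).
by rewrite (metric_sym q (b n)); lra.
Qed.

Lemma tends_closed C a p : closed C -> tends a p -> F [set n | C (a n)] -> C p.
Proof.
move=> cC ap FC; apply: contrapT => nC.
have [r r0 h] := open_has_mball (closed_openC cC) nC.
by apply: (ultra_contra FC (ap _ r0)) => n Cn /h.
Qed.

Lemma tends_close a b p : tends a p -> (forall r, 0 < r -> F [set n | mdist (b n) (a n) < r]) -> tends b p.
Proof.
move=> ap ab r r0; have r2 : 0 < r / 2 by rewrite divr_gt0.
apply: filterS (filterI (ap _ r2) (ab _ r2)) => n [] /= h1 h2.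
by have := metric_triangle (b n) (a n) p; lra.
Qed.

(** Along an ultrafilter the upper and the lower limit of the sets coincide; this is why limits of
    continua are connected. *)
Definition climit (C : nat -> set M) : set M :=
  [set z | forall r, 0 < r -> F [set n | exists2 c, C n c & mdist c z < r]].

Lemma climit_tends C a p : tends a p -> F [set n | C n (a n)] -> climit C p.
Proof.
move=> ap FC r r0; apply: filterS (filterI FC (ap r r0)) => n [] /= h1 h2.
by exists (a n).
Qed.

Lemma climit_closed C : closed (climit C).
Proof.
move=> z clz r r0; have r2 : 0 < r / 2 by rewrite divr_gt0.
have [|w [Lw /= wz]] := clz [set w | mdist w z < r / 2].
  by apply: open_nbhs_nbhs; split; [exact: open_mball | rewrite /= mdistxx].
apply: filterS (Lw _ r2) => n [c Cc cw]; exists c => //.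
by have := metric_triangle c w z; lra.
Qed.

Lemma climit_open C O : open O -> climit C `<=` O -> F [set n | C n `<=` O].
Proof.
move=> oO LO; case: (ultra_em [set n | C n `<=` O]) => // FN; exfalso.
have [n0 _ /(existsNP _).2 [x0 _]] := ultra_ex 0 FN.
have step n : exists x, ~ C n `<=` O -> C n x /\ ~ O x.
  have [h|h] := pselect (C n `<=` O); first by exists x0.
  by have [x /not_implyP [Cx nOx]] := (existsNP _).2 h; exists x.
have [a ha] := choice step.
have [p ap] := tends_exists a.
have Lp : climit C p by apply: climit_tends ap _; apply: filterS FN => n /ha [].
apply: (tends_closed (open_closedC oO) ap _ (LO _ Lp)).
by apply: filterS FN => n /ha [].
Qed.

Lemma climit_sub C D : closed D -> F [set n | C n `<=` D] -> climit C `<=` D.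
Proof.
move=> cD FD z Lz; apply: contrapT => nDz.
have [r r0 h] := open_has_mball (closed_openC cD) nDz.
by apply: (ultra_contra FD (Lz r r0)) => n CD [c /CD Dc /h].
Qed.

Lemma climit_meets C O z : climit C z -> open O -> O z -> F [set n | C n `&` O !=set0].
Proof.
move=> Lz oO Oz; have [r r0 h] := open_has_mball oO Oz.
by apply: filterS (Lz r r0) => n [c Cc /h Oc]; exists c.
Qed.

Lemma climit_continuum C : (forall n, continuum (C n)) -> continuum (climit C).
Proof.
move=> cC; have cL : closed (climit C) by exact: climit_closed.
split; first by apply: (subclosed_compact cL kM).
apply: connected_of_closed_split => // A B cA cB LAB AB0 [a Aa] [b Bb].
have [U [V [oU oV AU BV UV0]]] := closed_separation cA cB AB0.
have FUV : F [set n | C n `<=` U `|` V].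
  apply: climit_open; first exact: openU.
  by rewrite LAB => z [/AU|/BV]; [left|right].
have La : climit C a by rewrite LAB; left.
have Lb : climit C b by rewrite LAB; right.
have FU := climit_meets La oU (AU _ Aa); have FV := climit_meets Lb oV (BV _ Bb).
apply: (ultra_contra FUV (filterI FU FV)) => n CUV [CU CV].
have [x [[_ Ux] Vx]] := connected_open_meet (proj2 (cC n)) oU oV CUV CU CV.
have : (U `&` V) x by [].
by rewrite UV0.
Qed.

Lemma climit_le C (g : M -> M) c : continuous g ->
  F [set n | forall a b, C n a -> C n b -> mdist (g a) (g b) <= c] ->
  forall a b, climit C a -> climit C b -> mdist (g a) (g b) <= c.
Proof.
move=> cg Fc a b La Lb; rewrite leNgt; apply/negP => cab.
have r0 : 0 < (mdist (g a) (g b) - c) / 2 by rewrite divr_gt0 // subr_gt0.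
have [s s0 hs] := continuous_modulus a cg r0.
have [t t0 ht] := continuous_modulus b cg r0.
apply: (ultra_contra (filterI (La s s0) (Lb t t0)) Fc) => n [[a' Ca /hs h1] [b' Cb /ht h2]] /(_ _ _ Ca Cb) h3.
have := metric_triangle (g a) (g a') (g b); have := metric_triangle (g a') (g b') (g b).
by rewrite (metric_sym (g a) (g a')); lra.
Qed.

End Limits.

Lemma ultra_infinity : exists F : set_system nat, UltraFilter F /\ \oo `<=` F.
Proof. exact: ultraFilterLemma. Qed.

(** * Contraction of stable continua *)

Section Dynamics.
Variables (R : realType) (M : metricType R).
Hypothesis kM : compact [set: M].

Definition fwd (f : M -> M) (c : R) (C : set M) :=
  forall n a b, C a -> C b -> mdist (iter n f a) (iter n f b) <= c.

(* [g] is the inverse of [f]; the record is symmetric in [f] and [g], so every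
   statement on stable continua also yields one on unstable continua. *)
Record system (f g : M -> M) (e : R) : Prop := System {
  sys_fc : continuous f;
  sys_gc : continuous g;
  sys_fK : cancel f g;
  sys_gK : cancel g f;
  sys_e0 : 0 < e;
  sys_exp : forall a b c, fwd f (4 * e) [set x | [\/ x = a, x = b | x = c]] ->
    fwd g (4 * e) [set x | [\/ x = a, x = b | x = c]] -> [\/ a = b, a = c | b = c];
  sys_rec : forall N U, open U -> U !=set0 ->
    exists n x, [/\ (N <= n)%N, U x & U (iter n f x)]
}.

Lemma iter_cont (f : M -> M) n : continuous f -> continuous (iter n f).
Proof.
move=> cf; elim: n => [|n IH] x; first exact: cvg_id.
by apply: (@continuous_comp _ _ _ (iter n f) f); [exact: IH | exact: cf].
Qed.

Lemma iter_K (f g : M -> M) n : cancel f g -> cancel (iter n f) (iter n g).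
Proof. by move=> fK; elim: n => // n IH x; rewrite iterSr /= fK IH. Qed.

Lemma iter_cancel (f g : M -> M) m n x : cancel f g -> (m <= n)%N ->
  iter m g (iter n f x) = iter (n - m) f x.
Proof. by move=> fK mn; rewrite -{1}(subnKC mn) iterD iter_K. Qed.

Lemma system_sym f g e : system f g e -> system g f e.
Proof.
move=> [cf cg fK gK e0 ex rc]; split=> //; first by move=> a b c h1 h2; exact: ex.
move=> N U oU U0; have [n [x [Nn Ux Un]]] := rc N U oU U0.
by exists n, (iter n f x); split=> //; rewrite iter_K.
Qed.

Lemma fwd_sub f c C C' : C' `<=` C -> fwd f c C -> fwd f c C'.
Proof. by move=> CC h n a b /CC Ca /CC Cb; exact: h. Qed.

Lemma fwd_le f c c' C : c <= c' -> fwd f c C -> fwd f c' C.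
Proof. by move=> cc h n a b Ca Cb; apply: le_trans cc; exact: h. Qed.

Lemma image_continuum' (h : M -> M) C : continuous h -> continuum C -> continuum (h @` C).
Proof.
move=> ch [kC nC]; have cs : {within C, continuous h} by exact: continuous_subspaceT.
by split; [exact: continuous_compact | exact: connected_continuous_connected].
Qed.

Lemma fwd_image f c C n : fwd f c C -> fwd f c (iter n f @` C).
Proof. by move=> h m _ _ [a Ca <-] [b Cb <-]; rewrite -!iterD; exact: h. Qed.

Lemma iter_modulus (f : M -> M) m r : continuous f -> 0 < r ->
  exists2 s, 0 < s & forall j x y, (j <= m)%N -> mdist x y < s ->
    mdist (iter j f x) (iter j f y) < r.
Proof.
move=> cf r0; apply: contrapT => H.
have step k : exists p : M * M * nat, [/\ (p.2 <= m)%N, mdist p.1.1 p.1.2 < k.+1%:R^-1 &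
    r <= mdist (iter p.2 f p.1.1) (iter p.2 f p.1.2)].
  apply: contrapT => h; apply: H; exists k.+1%:R^-1; first by rewrite invr_gt0.
  move=> j x y jm xy; rewrite ltNge; apply/negP => h'; apply: h.
  by exists (x, y, j).
have [a ha] := choice step.
have [F [UF Foo]] := ultra_infinity; have PF : ProperFilter F := ultra_proper.
have [p ap] := tends_exists kM UF (fun k => (a k).1.1).
have bp : tends F (fun k => (a k).1.2) p.
  apply: (tends_close UF ap) => t t0; apply: filterS (ultra_small Foo t0) => k /= kt.
  by rewrite metric_sym; apply: lt_trans kt; case: (ha k).
have key j : exists2 s, 0 < s & forall w, mdist w p < s -> mdist (iter j f w) (iter j f p) < r / 2.
  by apply: continuous_modulus; [exact: iter_cont | rewrite divr_gt0].
have FA : F [set k | forall j, (j <= m)%N -> mdist (iter j f (a k).1.1) (iter j f p) < r / 2 /\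
    mdist (iter j f (a k).1.2) (iter j f p) < r / 2].
  have step' j : exists t, 0 < t /\ forall w, mdist w p < t ->
      mdist (iter j f w) (iter j f p) < r / 2.
    by have [t t0 h] := key j; exists t.
  have [s hs] := choice step'.
  elim: m {step ha H} => [|m' IH].
    have [s0 h0] := hs 0%N.
    apply: filterS (filterI (ap _ s0) (bp _ s0)) => k [h1 h2] j.
    by rewrite leqn0 => /eqP ->; split; exact: h0.
  have [s0 h0] := hs m'.+1.
  apply: filterS (filterI IH (filterI (ap _ s0) (bp _ s0))) => k [h3 [h1 h2]] j.
  by rewrite leq_eqVlt => /orP[/eqP ->|]; [split; exact: h0 | exact: h3].
have [k _ h] := ultra_ex UF Foo 0 FA.
have [jm _ rle] := ha k; have [h1 h2] := h _ jm.
have := metric_triangle (iter (a k).2 f (a k).1.1) (iter (a k).2 f p) (iter (a k).2 f (a k).1.2).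
by rewrite (metric_sym (iter (a k).2 f p)); lra.
Qed.

Variables (f g : M -> M) (e : R).
Hypothesis sys : system f g e.
Let cf := sys_fc sys.
Let cg := sys_gc sys.
Let fK := sys_fK sys.
Let e0 := sys_e0 sys.
Let hM : hausdorff_space M := @metric_hausdorff _ M.

(** A continuum with two points has a third one, and three points whose whole orbits stay within
    [4 * e] are excluded by [sys_exp]. *)
Lemma bounded_orbit_trivial C : continuum C -> fwd f (4 * e) C -> fwd g (4 * e) C ->
  forall a b, C a -> C b -> a = b.
Proof.
move=> [kC nC] fC gC a b Ca Cb; apply: contrapT => ab.
have c1 x : closed [set x : M] by apply: (compact_closed hM); exact: compact_set1.
have := connected_closed_meet nC (c1 a) (c1 b).
case=> [c Cc|||x [[_ xa] xb]]; [|by exists a|by exists b|by apply: ab; exact: (etrans (esym xa) xb)].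
have sub : [set x | [\/ x = a, x = b | x = c]] `<=` C by move=> x [->|->|->].
have [/ab //|ac|bc] := sys_exp sys (fwd_sub sub fC) (fwd_sub sub gC).
  by left; rewrite ac.
by right; rewrite bc.
Qed.

(** Compactness argument behind the estimates below: the limit of such continua would be a
    nondegenerate continuum with bounded full orbit. *)
Lemma no_persistent F (C : nat -> set M) a b r : UltraFilter F -> \oo `<=` F ->
  (forall n, continuum (C n)) ->
  (forall m, F [set k | forall x y, C k x -> C k y -> mdist (iter m f x) (iter m f y) <= 4 * e]) ->
  (forall m, F [set k | forall x y, C k x -> C k y -> mdist (iter m g x) (iter m g y) <= 4 * e]) ->
  (forall k, C k (a k)) -> (forall k, C k (b k)) -> 0 < r ->
  (forall k, r <= mdist (a k) (b k)) -> False.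
Proof.
move=> UF Foo cC Ff Fg Ca Cb r0 rab; have PF : ProperFilter F := ultra_proper.
have [p ap] := tends_exists kM UF a; have [q bq] := tends_exists kM UF b.
have Lp : climit F C p by apply: (climit_tends UF ap); exact: filterE.
have Lq : climit F C q by apply: (climit_tends UF bq); exact: filterE.
have rpq : r <= mdist p q by apply: (tends_ge UF ap bq); exact: filterE.
have pq : p = q.
  apply: (@bounded_orbit_trivial (climit F C)) => //; first exact: (climit_continuum kM UF Foo).
    by move=> n x y; exact: (climit_le UF (@iter_cont f n cf) (Ff n)).
  by move=> n x y; exact: (climit_le UF (@iter_cont g n cg) (Fg n)).
by move: rpq; rewrite pq mdistxx leNgt r0.
Qed.

(** Counterexamples at late times [n] are recentred at time [n]: besides their future, a past of
    length [n] is then bounded, which [no_persistent] forbids. *)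
Lemma fwd_contraction r : 0 < r -> exists N, forall C, continuum C -> fwd f (4 * e) C ->
  forall n a b, (N <= n)%N -> C a -> C b -> mdist (iter n f a) (iter n f b) < r.
Proof.
move=> r0; apply: contrapT => H.
have step N : exists p : set M * nat * M * M, let: (C, n, a, b) := p in
   [/\ continuum C, fwd f (4 * e) C, (N <= n)%N, C a /\ C b & r <= mdist (iter n f a) (iter n f b)].
  apply: contrapT => h; apply: H; exists N => C cC fC n a b Nn Ca Cb.
  by rewrite ltNge; apply/negP => h'; apply: h; exists (C, n, a, b).
have [s hs] := choice step.
have [F [UF Foo]] := ultra_infinity; have PF : ProperFilter F := ultra_proper.
pose C k := (s k).1.1.1; pose n k := (s k).1.1.2; pose a k := (s k).1.2; pose b k := (s k).2.
have {}hs k : [/\ continuum (C k), fwd f (4 * e) (C k), (k <= n k)%N, C k (a k) /\ C k (b k) &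
    r <= mdist (iter (n k) f (a k)) (iter (n k) f (b k))].
  by have := hs k; rewrite /C /n /a /b; case: (s k) => [[[? ?] ?] ?].
apply: (@no_persistent F (fun k => iter (n k) f @` C k)
  (fun k => iter (n k) f (a k)) (fun k => iter (n k) f (b k)) r UF Foo) => //.
- by move=> k; apply: image_continuum'; [exact: iter_cont | case: (hs k)].
- by move=> m; apply: filterE => k x y; have [_ fC _ _ _] := hs k; exact: fwd_image.
- move=> m; apply: filterS (ultra_ge Foo m) => k /= mk _ _ [x Cx <-] [y Cy <-].
  have [_ fC kn _ _] := hs k.
  by rewrite !(iter_cancel _ fK) ?(leq_trans mk) //; exact: fC.
- by move=> k; have [_ _ _ [? ?] _] := hs k; exists (a k).
- by move=> k; have [_ _ _ [? ?] _] := hs k; exists (b k).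
- by move=> k; have [] := hs k.
Qed.

(** Recentre counterexamples at the bad time [j]. As the continuum is tiny at times 0 and [n],
    equicontinuity of finitely many iterates forces both [j] and [n - j] to infinity, and
    [no_persistent] applies. *)
Lemma improvement r : 0 < r -> exists2 d, 0 < d & forall C n, continuum C ->
  (forall j a b, (j <= n)%N -> C a -> C b -> mdist (iter j f a) (iter j f b) <= 4 * e) ->
  (forall a b, C a -> C b -> mdist a b <= d) ->
  (forall a b, C a -> C b -> mdist (iter n f a) (iter n f b) <= d) ->
  forall j a b, (j <= n)%N -> C a -> C b -> mdist (iter j f a) (iter j f b) < r.
Proof.
move=> r0; apply: contrapT => H.
have step k : exists p : set M * nat * nat * M * M, let: (C, n, j, a, b) := p in
   [/\ continuum C, forall j a b, (j <= n)%N -> C a -> C b -> mdist (iter j f a) (iter j f b) <= 4 * e,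
    forall a b, C a -> C b -> mdist a b <= k.+1%:R^-1 /\ mdist (iter n f a) (iter n f b) <= k.+1%:R^-1,
    (j <= n)%N & [/\ C a, C b & r <= mdist (iter j f a) (iter j f b)]].
  apply: contrapT => h; apply: H; exists k.+1%:R^-1; first by rewrite invr_gt0.
  move=> C n cC h1 h2 h3 j a b jn Ca Cb.
  rewrite ltNge; apply/negP => h'; apply: h; exists (C, n, j, a, b); split=> //.
  by move=> x y Cx Cy; split; [exact: h2 | exact: h3].
have [s hs] := choice step.
have [F [UF Foo]] := ultra_infinity; have PF : ProperFilter F := ultra_proper.
pose C k := (s k).1.1.1.1; pose n k := (s k).1.1.1.2; pose j k := (s k).1.1.2.
pose a k := (s k).1.2; pose b k := (s k).2.
have {}hs k : [/\ continuum (C k), forall j a b, (j <= n k)%N -> C k a -> C k b -> mdist (iter j f a) (iter j f b) <= 4 * e,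
    forall a b, C k a -> C k b -> mdist a b <= k.+1%:R^-1 /\ mdist (iter (n k) f a) (iter (n k) f b) <= k.+1%:R^-1,
    (j k <= n k)%N & [/\ C k (a k), C k (b k) & r <= mdist (iter (j k) f (a k)) (iter (j k) f (b k))]].
  by have := hs k; rewrite /C /n /j /a /b; case: (s k) => [[[[? ?] ?] ?] ?].
have jbig m : F [set k | (m <= j k)%N].
  have [t t0 ht] := iter_modulus m cf r0.
  apply: filterS (ultra_small Foo t0) => k /= kt; rewrite leqNgt; apply/negP => jm.
  have [_ _ h3 _ [Ca Cb]] := hs k; have [h4 _] := h3 _ _ Ca Cb.
  by rewrite leNgt => /negP; apply; apply: ht; [exact: ltnW | exact: le_lt_trans kt].
have nbig m : F [set k | (m <= n k - j k)%N].
  have [t t0 ht] := iter_modulus m cg r0.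
  apply: filterS (ultra_small Foo t0) => k /= kt; rewrite leqNgt; apply/negP => jm.
  have [_ _ h3 jn [Ca Cb]] := hs k; have [_ h4] := h3 _ _ Ca Cb.
  rewrite leNgt => /negP; apply.
  have E x : iter (j k) f x = iter (n k - j k) g (iter (n k) f x).
    by rewrite iter_cancel ?leq_subr // subKn.
  by rewrite !E; apply: ht; [exact: ltnW | exact: le_lt_trans kt].
apply: (@no_persistent F (fun k => iter (j k) f @` C k)
  (fun k => iter (j k) f (a k)) (fun k => iter (j k) f (b k)) r UF Foo) => //.
- by move=> k; apply: image_continuum'; [exact: iter_cont | case: (hs k)].
- move=> m; apply: filterS (nbig m) => k /= mk _ _ [x Cx <-] [y Cy <-].
  have [_ h2 _ jn _] := hs k; rewrite -!iterD; apply: h2 => //.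
  by rewrite addnC -leq_subRL.
- move=> m; apply: filterS (jbig m) => k /= mk _ _ [x Cx <-] [y Cy <-].
  have [_ h2 _ jn _] := hs k; rewrite !(iter_cancel _ fK) //; apply: h2 => //.
  by apply: leq_trans jn; exact: leq_subr.
- by move=> k; have [_ _ _ _ [? ? _]] := hs k; exists (a k).
- by move=> k; have [_ _ _ _ [? ? _]] := hs k; exists (b k).
- by move=> k; have [_ _ _ _ []] := hs k.
Qed.

Lemma improvement_fwd r : 0 < r -> exists2 d, 0 < d & forall C, continuum C ->
  fwd f (4 * e) C -> (forall a b, C a -> C b -> mdist a b <= d) -> fwd f r C.
Proof.
move=> r0; have [d d0 hd] := improvement r0; exists d => // C cC fC dC n a b Ca Cb.
have [N hN] := fwd_contraction d0.
apply: ltW; apply: (hd C (maxn n N)) => //; last exact: leq_maxl.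
  by move=> j *; exact: fC.
by move=> x y Cx Cy; apply: ltW; apply: (hN C) => //; exact: leq_maxr.
Qed.

End Dynamics.

(** * Plaques in small discs *)

Section Plaques.
Variables (R : realType) (M : metricType R).
Hypothesis kM : compact [set: M].
Hypothesis discs : forall (x : M) O, open O -> O x ->
  exists D bd, [/\ is_disc D bd, D `<=` O & (D `\` bd) x].
Let hM : hausdorff_space M := @metric_hausdorff _ M.

(** A disc around a limit of centres serves for all nearby centres, as with a Lebesgue number. *)
Lemma uniform_disc r : 0 < r -> exists2 s, 0 < s & forall x : M, exists D bd,
  [/\ is_disc D bd, [set w | mdist w x < s] `<=` D `\` bd & D `<=` [set w | mdist w x < r]].
Proof.
move=> r0; apply: contrapT => H.
have step (k : nat) : exists x : M, ~ exists D bd, [/\ is_disc D bd,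
    [set w | mdist w x < k.+1%:R^-1] `<=` D `\` bd & D `<=` [set w | mdist w x < r]].
  apply: contrapT => h; apply: H; exists k.+1%:R^-1; first by rewrite invr_gt0.
  by move=> x; apply: contrapT => h'; apply: h; exists x.
have [x hx] := choice step.
have [F [UF Foo]] := ultra_infinity; have PF : ProperFilter F := ultra_proper.
have [p xp] := tends_exists kM UF x.
have r2 : 0 < r / 2 by rewrite divr_gt0.
have [|D [bd [dD DB Dp]]] := discs (open_mball p (r / 2)) (x := p); first by rewrite /= mdistxx.
have [t t0 ht] := open_has_mball (disc_int_open dD) Dp.
have t2 : 0 < t / 2 by rewrite divr_gt0.
have [k _ [[h1 h2] h3]] := ultra_ex UF Foo 0 (filterI (filterI (xp _ r2) (xp _ t2)) (ultra_small Foo t2)).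
apply: (hx k); exists D, bd; split=> // w /=.
  move=> wx; apply: ht => /=; have := metric_triangle w (x k) p.
  have h4 := lt_trans wx h3; move: h2 => /= h2; move: h4; clear -h2; lra.
move=> /DB /= wp; have := metric_triangle w p (x k); rewrite (metric_sym p).
by move: h1 => /=; lra.
Qed.

Lemma open_bowen (h : M -> M) n c y : continuous h ->
  open [set w | forall j, (j <= n)%N -> mdist (iter j h w) (iter j h y) < c].
Proof.
move=> ch; have o j : open [set w | mdist (iter j h w) (iter j h y) < c].
  apply: (@open_comp _ _ (iter j h) [set w | mdist w (iter j h y) < c]); last exact: open_mball.
  by move=> w _; exact: iter_cont.
elim: n => [|n IH].
  rewrite (_ : [set w | _] = [set w | mdist (iter 0 h w) (iter 0 h y) < c]) //.
  by apply/seteqP; split=> w /= H; [exact: (H 0%N) | move=> j; rewrite leqn0 => /eqP ->].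
rewrite (_ : [set w | _] = [set w | forall j, (j <= n)%N -> mdist (iter j h w) (iter j h y) < c] `&`
    [set w | mdist (iter n.+1 h w) (iter n.+1 h y) < c]); first exact: openI.
apply/seteqP; split=> w /= H; first by split; [move=> j jn; apply: H; exact: leqW | exact: (H n.+1)].
by move=> j; rewrite leq_eqVlt => /orP[/eqP ->|]; [case: H | case: H => H _; exact: (H j)].
Qed.

Lemma closed_bowen (h : M -> M) (P : set nat) c y : continuous h ->
  closed [set w | forall j, P j -> mdist (iter j h w) (iter j h y) <= c].
Proof.
move=> ch; rewrite (_ : [set w | _] = \bigcap_(j in P) (iter j h @^-1` [set w | mdist w (iter j h y) <= c])) //.
apply: closed_bigI => j _; apply: ((continuous_closedP _).1 (@iter_cont _ _ h j ch)).
exact: closed_mball.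
Qed.

Section System.
Variables (f g : M -> M) (e : R).
Hypothesis sys : system f g e.
Let cf := sys_fc sys.
Let cg := sys_gc sys.
Let e0 := sys_e0 sys.

Lemma disc_two_points (D bd : set M) x : is_disc D bd -> (D `\` bd) x ->
  exists2 y, (D `\` bd) y & y <> x.
Proof.
move=> dD Dx; apply: contrapT => H.
have V1 y : (D `\` bd) y -> y = x by move=> Vy; apply: contrapT => yx; apply: H; exists y.
have [b bb] := disc_bd_neq0 dD; have Db := disc_bd_sub dD bb.
have cx : closed [set x] by apply: (compact_closed hM); exact: compact_set1.
have := connected_open_meet (disc_conn dD) (disc_int_open dD) (closed_openC cx).
case=> [z Dz|||z [[_ /V1 zx] nzx]].
- by have [->|zx] := pselect (z = x); [left | right].
- by exists x; split=> //; case: Dx.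
- by exists b; split=> // bx; case: Dx => _; apply; rewrite -bx.
- exact: nzx.
Qed.

(* A stable open set would contract into two disjoint open subsets of itself,
   at times [n] and [m]; time [n * m] then gives a contradiction. *)
Lemma no_stable_open V : open V -> V !=set0 -> ~ fwd f (4 * e) V.
Proof.
move=> oV [x Vx] fV; have [D [bd [dD DV Dx]]] := discs oV Vx.
have [y Dy yx] := disc_two_points dD Dx.
have cD : continuum D by split; [exact: (disc_cpt dD) | exact: (disc_conn dD)].
have fD := fwd_sub DV fV.
have d0 : 0 < mdist y x by rewrite mdist_gt0; apply/eqP.
have Ret z : (D `\` bd) z -> exists n, (0 < n)%N /\ forall w, D w ->
    D (iter n f w) /\ mdist (iter n f w) z < mdist y x / 2.
  move=> Dz; have [t t0 ht] := open_has_mball (disc_int_open dD) Dz.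
  pose s := Num.min (t / 2) (mdist y x / 4).
  have s0 : 0 < s by rewrite lt_min !divr_gt0.
  have [N hN] := fwd_contraction kM sys s0.
  have [|n [u [Nn /= uz nuz]]] := sys_rec sys (maxn N 1) (open_mball z s).
    by exists z; rewrite /= mdistxx.
  move: Nn; rewrite geq_max => /andP [Nn n0].
  have Du : D u.
    have [|//] := ht u; apply: lt_le_trans uz _; rewrite ge_min.
    by apply/orP; left; lra.
  exists n; split=> // w Dw; have h := hN D cD fD n w u Nn Dw Du.
  have st : s <= t / 2 by rewrite ge_min lexx.
  have sd : s <= mdist y x / 4 by rewrite ge_min lexx orbT.
  have tri := metric_triangle (iter n f w) (iter n f u) z.
  split; last by lra.
  by have [|//] := ht (iter n f w); rewrite /=; lra.
have [n [n0 hn]] := Ret x Dx; have [m [m0 hm]] := Ret y Dy.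
have itr k q w : (forall w, D w -> D (iter k f w)) -> D w -> D (iter (q * k) f w).
  move=> hk; elim: q => // q IH Dw; rewrite mulSn iterD; apply: hk; exact: IH.
have Dn w : D w -> D (iter n f w) by move=> /hn [].
have Dm w : D w -> D (iter m f w) by move=> /hm [].
have h1 : mdist (iter (n * m) f x) x < mdist y x / 2.
  rewrite mulnC -(prednK m0) mulSn iterD; apply: (proj2 (hn _ _)).
  by apply: itr => //; case: Dx.
have h2 : mdist (iter (n * m) f x) y < mdist y x / 2.
  rewrite -(prednK n0) mulSn iterD; apply: (proj2 (hm _ _)).
  by apply: itr => //; case: Dx.
have := metric_triangle y (iter (n * m) f x) x.
by rewrite (metric_sym y (iter (n * m) f x)); lra.
Qed.

(** Closeness is measured from the orbit of [z] alone, so at first the iterates are only known to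
    have diameter at most [2 * e]. In small discs [improvement_fwd] lowers this to [e], and the
    plaques become the classes of an equivalence relation. *)
Definition plaque (D : set M) (z : M) : set M :=
  connected_component [set w | D w /\ forall n, mdist (iter n f w) (iter n f z) <= e] z.

Variables (D bd : set M).
Hypothesis dD : is_disc D bd.

Let clD : closed D := compact_closed hM (disc_cpt dD).

Lemma plaque_refl z : D z -> plaque D z z.
Proof.
by move=> Dz; apply: connected_component_refl => /=; split=> // n; rewrite mdistxx ltW.
Qed.

Lemma plaque_dom z : plaque D z `<=` [set w | D w /\ forall n, mdist (iter n f w) (iter n f z) <= e].
Proof. exact: connected_component_sub. Qed.

Lemma plaque_continuum z : D z -> continuum (plaque D z).
Proof.
move=> Dz; apply: component_continuum => //; last by split=> // n; rewrite mdistxx ltW.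
apply: (subclosed_compact _ (disc_cpt dD)); last by move=> w [].
rewrite (_ : [set w | _] = D `&` [set w | forall j, setT j -> mdist (iter j f w) (iter j f z) <= e]).
  by apply: closedI => //; exact: closed_bowen.
by apply/seteqP; split=> w /= [Dw h]; split=> // j; exact: h.
Qed.

Lemma plaque_max z C : continuum C -> fwd f e C -> C z -> C `<=` D -> C `<=` plaque D z.
Proof.
move=> [_ nC] fC Cz CD; apply: connected_component_max => //.
by move=> w Cw; split; [exact: CD | move=> n; exact: fC].
Qed.

(** A limit of plaques is a stable continuum through the limit point, hence inside the plaque of
    that point. *)
Lemma plaque_usc F0 :
  (forall z, D z -> fwd f e (plaque D z)) -> closed F0 -> F0 `<=` D ->
  closed [set z | D z /\ plaque D z `&` F0 !=set0].
Proof.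
move=> fP cF FD z clz; have Dz : D z by apply: clD; apply: closureS clz => w [].
split=> //.
have step (k : nat) : exists p : M * M, [/\ D p.1, mdist p.1 z < k.+1%:R^-1, plaque D p.1 p.2 & F0 p.2].
  have [|u [[Du [w [Pw Fw]]] /= uz]] := clz [set u | mdist u z < k.+1%:R^-1].
    apply: open_nbhs_nbhs; split; first exact: open_mball.
    by rewrite /= mdistxx invr_gt0.
  by exists (u, w).
have [s hs] := choice step.
have [F [UF Foo]] := ultra_infinity; have PF : ProperFilter F := ultra_proper.
have sz : tends F (fun k => (s k).1) z.
  by move=> r r0; apply: filterS (ultra_small Foo r0) => k /= kr; apply: lt_trans kr; case: (hs k).
have [w sw] := tends_exists kM UF (fun k => (s k).2).
pose C k := plaque D (s k).1.
have cC k : continuum (C k) by apply: plaque_continuum; case: (hs k).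
have cL := climit_continuum kM UF Foo cC.
exists w; split; last by apply: (tends_closed UF cF sw); apply: filterE => k; case: (hs k).
apply: (plaque_max cL).
- move=> n a b; apply: (climit_le UF (@iter_cont _ _ f n cf)).
  by apply: filterE => k x y; apply: fP; case: (hs k).
- by apply: (climit_tends UF sz); apply: filterE => k; apply: plaque_refl; case: (hs k).
- by apply: (climit_sub UF clD); apply: filterE => k u /plaque_dom [].
- by apply: (climit_tends UF sw); apply: filterE => k; case: (hs k).
Qed.

End System.
End Plaques.

(** * Small discs are decomposed by their plaques *)

Section Decomposition.
Variables (R : realType) (M : metricType R).
Hypothesis kM : compact [set: M].
Hypothesis discs : forall (x : M) O, open O -> O x ->
  exists D bd, [/\ is_disc D bd, D `<=` O & (D `\` bd) x].
Variables (f g : M -> M) (e : R).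
Hypothesis sys : system f g e.
Let hM : hausdorff_space M := @metric_hausdorff _ M.
Let cf := sys_fc sys.
Let cg := sys_gc sys.
Let fK := sys_fK sys.
Let gK := sys_gK sys.
Let e0 := sys_e0 sys.

Definition bounded_by (d : R) (C : set M) := forall a b, C a -> C b -> mdist a b <= d.

Section Touch.
Variables (D bd : set M) (z : M).
Hypothesis dD : is_disc D bd.
Hypothesis Dz : D z.
Let clD : closed D := compact_closed hM (disc_cpt dD).

(** Finite-time form of a stable continuum from [z] to the boundary; radius [e / 2] about the orbit
    of [z] becomes diameter [e] in the limit over [n]. *)
Definition reaches n := exists K, [/\ continuum K, K z, K `<=` D, K `&` bd !=set0 &
  forall j a, (j <= n)%N -> K a -> mdist (iter j f a) (iter j f z) <= e / 2].

Lemma plaque_touch_of_reaches : (forall n, reaches n) -> exists2 b, bd b & plaque f e D z b.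
Proof.
move=> H; have [K hK] := choice H.
have step n : exists b, K n b /\ bd b by have [_ _ _ [b Kb] _] := hK n; exists b.
have [b hb] := choice step.
have [F [UF Foo]] := ultra_infinity; have PF : ProperFilter F := ultra_proper.
have [q bq] := tends_exists kM UF b.
have cK n : continuum (K n) by case: (hK n).
exists q; first by apply: (tends_closed UF (disc_bd_closed dD) bq); apply: filterE => n; case: (hb n).
apply: (plaque_max (climit_continuum kM UF Foo cK)).
- move=> j a a'; apply: (climit_le UF (@iter_cont _ _ f j cf)).
  apply: filterS (ultra_ge Foo j) => n /= jn x y Kx Ky; have [_ _ _ _ h] := hK n.
  have h1 := h j x jn Kx; have h2 := h j y jn Ky.
  have := metric_triangle (iter j f x) (iter j f z) (iter j f y).
  by rewrite (metric_sym (iter j f z)); lra.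
- move=> r r0; apply: filterE => n /=; exists z; last by rewrite mdistxx.
  by case: (hK n).
- by apply: (climit_sub UF clD); apply: filterE => n; case: (hK n).
- by apply: (climit_tends UF bq); apply: filterE => n; case: (hb n).
Qed.

Variable d : R.
Hypothesis d0 : 0 < d.
Hypothesis dE : forall C n, continuum C ->
  (forall j a b, (j <= n)%N -> C a -> C b -> mdist (iter j g a) (iter j g b) <= 4 * e) ->
  bounded_by d C ->
  (forall a b, C a -> C b -> mdist (iter n g a) (iter n g b) <= d) ->
  forall j a b, (j <= n)%N -> C a -> C b -> mdist (iter j g a) (iter j g b) < e / 2.
Hypothesis bD : bounded_by d D.

(* Otherwise the backward orbit of a whole neighbourhood of [f^n z] stays small,
   since a continuum in it growing under [g^n] would leave [D]. *)
Lemma reaches_all n : reaches n.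
Proof.
apply: contrapT => nr.
have nbz : ~ bd z.
  move=> bz; apply: nr; exists [set z]; split=> //; first exact: continuum1.
  - by move=> w ->.
  - by exists z.
  - by move=> j a _ ->; rewrite mdistxx divr_ge0 // ltW.
have nrm m : (n <= m)%N -> ~ reaches m.
  move=> nm [K [cK Kz KD Kb hK]]; apply: nr; exists K; split=> // j a jn.
  by apply: hK; exact: leq_trans jn nm.
have [s s0 hs] := uniform_disc kM discs (divr_gt0 d0 (ltr0n R 2)).
have ball_small m : (n <= m)%N -> forall w, mdist w (iter m f z) < s ->
    forall j, (j <= m)%N -> mdist (iter j g w) (iter j g (iter m f z)) < e / 2.
  move=> nm; set y := iter m f z; have [D' [bd' [dD' BD' DB']]] := hs y.
  pose O := [set w | forall j, (j <= m)%N -> mdist (iter j g w) (iter j g y) < e / 2].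
  suff DO : D' `<=` O by move=> w wy; apply: DO; case: (BD' w wy).
  apply: contrapT => nDO.
  have cD' : continuum D' by split; [exact: (disc_cpt dD') | exact: (disc_conn dD')].
  have D'y : D' y by case: (BD' y); rewrite /= ?mdistxx.
  have Oy : O y by move=> j _; rewrite mdistxx divr_gt0.
  have [K [cK Ky KD' KO [w Kw nOw]]] := continuum_sub_exits hM cD' (open_bowen m (e / 2) y cg) D'y Oy nDO.
  have KE j a : (j <= m)%N -> K a -> mdist (iter j g a) (iter j g y) <= e / 2.
    move=> jm Ka; have cl := @closed_bowen _ _ g [set j | (j <= m)%N] (e / 2) y cg.
    have /cl h : closure [set w | forall j, [set j | (j <= m)%N] j -> mdist (iter j g w) (iter j g y) <= e / 2] a.
      by apply: closureS (KO a Ka) => x Ox i im; apply: ltW; exact: Ox.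
    exact: h.
  have KE2 j a b : (j <= m)%N -> K a -> K b -> mdist (iter j g a) (iter j g b) <= 4 * e.
    move=> jm Ka Kb; have h1 := KE j a jm Ka; have h2 := KE j b jm Kb.
    have := metric_triangle (iter j g a) (iter j g y) (iter j g b).
    by rewrite (metric_sym (iter j g y)); move: e0; lra.
  have bK : bounded_by d K.
    move=> a b /KD' /DB' /= ay /KD' /DB' /= by'; have := metric_triangle a y b.
    by rewrite (metric_sym y b); lra.
  (* If [L] stayed in [D], both [K] and [L] would be small and [dE] would keep [w] inside the open
     set it has left. So [L] leaves [D], and its part up to the boundary witnesses [reaches m]. *)
  pose L := iter m g @` K.
  have cL : continuum L by apply: image_continuum' => //; exact: iter_cont.
  have Lz : L z by exists y => //; rewrite /y iter_K.
  have nLD : ~ L `<=` D.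
    move=> LD; apply: nOw => j jm; apply: (dE cK KE2 bK) => // a b Ka Kb.
    by apply: bD; apply: LD; [exists a | exists b].
  have [K' [cK' K'z K'L K'cl [b K'b nb]]] := continuum_sub_exits hM cL (disc_int_open dD) Lz (conj Dz nbz)
    (fun h => nLD (subset_trans h (@subDsetl _ _ _))).
  have K'D : K' `<=` D by move=> a /K'cl; apply: closure_sub_closed => // x [].
  apply: (nrm m nm); exists K'; split=> //.
    by exists b; split=> //; apply: contrapT => nbb; apply: nb; split=> //; exact: K'D.
  move=> j a jm /K'L [c Kc <-]; rewrite -(iter_K m fK z) -/y.
  by rewrite !(iter_cancel _ gK) //; apply: KE => //; exact: leq_subr.
have [F [UF Foo]] := ultra_infinity; have PF : ProperFilter F := ultra_proper.
have [p zp] := tends_exists kM UF (fun m => iter m f z).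
have s2 : 0 < s / 2 by rewrite divr_gt0.
apply: (no_stable_open kM discs (system_sym sys) (open_mball p (s / 2))).
  by exists p; rewrite /= mdistxx.
move=> j a b /= ap bp.
have [m] := ultra_ex UF Foo (maxn n j) (zp _ s2); rewrite geq_max => /andP[nm jm] /= mp.
have near c : mdist c p < s / 2 -> mdist c (iter m f z) < s.
  by move=> cp; have := metric_triangle c p (iter m f z); rewrite (metric_sym p); lra.
have h1 := ball_small m nm a (near a ap) j jm; have h2 := ball_small m nm b (near b bp) j jm.
have := metric_triangle (iter j g a) (iter j g (iter m f z)) (iter j g b).
by rewrite (metric_sym (iter j g (iter m f z))); move: e0; lra.
Qed.

End Touch.

Lemma plaque_decomposition : exists2 rho, 0 < rho & forall D bd, is_disc D bd ->
  bounded_by rho D -> decomposition D bd (plaque f e D) /\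
    forall z, D z -> fwd f e (plaque f e D z).
Proof.
have [d1 d10 h1] := improvement_fwd kM sys e0.
have e20 : 0 < e / 2 by rewrite divr_gt0.
have [d2 d20 h2] := improvement kM (system_sym sys) e20.
(* [d1] makes the iterates of plaques have diameter at most [e]; [d2] makes the plaques reach the
   boundary. *)
exists (Num.min d1 d2); first by rewrite lt_min d10.
move=> D bd dD bD.
have b1 : bounded_by d1 D.
  by move=> a b Da Db; apply: le_trans (bD a b Da Db) _; rewrite ge_min lexx.
have b2 : bounded_by d2 D.
  by move=> a b Da Db; apply: le_trans (bD a b Da Db) _; rewrite ge_min lexx orbT.
have fP z : D z -> fwd f e (plaque f e D z).
  move=> Dz; apply: h1; first exact: (plaque_continuum sys dD).
    move=> n a b /plaque_dom [_ ha] /plaque_dom [_ hb].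
    have := metric_triangle (iter n f a) (iter n f z) (iter n f b).
    have := ha n; have := hb n; rewrite (metric_sym (iter n f b)).
    by move: e0; lra.
  by move=> a b /plaque_dom [Da _] /plaque_dom [Db _]; exact: b1.
have sub z w : D z -> plaque f e D z w -> plaque f e D z `<=` plaque f e D w.
  move=> Dz zw; apply: plaque_max => //; first exact: (plaque_continuum sys dD).
    exact: fP.
  by move=> x /plaque_dom [].
have refl z : D z -> plaque f e D z z by exact: (plaque_refl sys).
split=> //; split=> //.
- by move=> z _ w /plaque_dom [].
- by move=> z; exact: (plaque_continuum sys dD).
- move=> z w Dz zw; have Dw : D w by case: (plaque_dom zw).
  apply/seteqP; split; last exact: (sub z w Dz zw).
  by apply: (sub w z Dw); apply: (sub z w Dz zw); exact: refl.
- move=> z Dz; apply: (plaque_touch_of_reaches dD) => n.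
  exact: (reaches_all dD Dz d20 h2 b2).
- by move=> F cF FD; exact: (plaque_usc kM sys dD fP cF FD).
Qed.

End Decomposition.

(** * Absence of lenses *)

Section Removal.
Variables (R : realType) (T : pseudoMetricType R).
Hypothesis hT : hausdorff_space T.

(** The removed part is attached to the rest at no point other than [w]. Given a splitting of what
    remains, it can be added to a side so that all of [K] is split. *)
Lemma continuum_remove K O (w : T) : continuum K -> open O ->
  (forall z, K z -> closure (K `&` O) z -> O z \/ z = w) -> continuum (K `\` O).
Proof.
move=> [kK nK] oO Hw; have cK := compact_closed hT kK.
have cKO : closed (K `\` O) by apply: closedI => //; exact: open_closedC.
split; first by apply: (subclosed_compact cKO kK) => z [].
apply: connected_of_closed_split => // A B cA cB AB AB0 [a Aa] [b Bb].
have key A' B' a' b' : closed A' -> closed B' -> K `\` O = A' `|` B' -> A' `&` B' = set0 ->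
    A' a' -> B' b' -> ~ B' w -> False.
  move=> cA' cB' AB' AB0' Aa' Bb' nBw.
  have AK z : (A' `|` B') z -> K z /\ ~ O z by rewrite -AB' => -[].
  have := connected_closed_meet nK (closedU cA' (@closed_closure _ (K `&` O))) cB'.
  case=> [z Kz|||z [[Kz Az] Bz]].
  - have [Oz|nOz] := pselect (O z); first by left; right; exact: subset_closure.
    have : (A' `|` B') z by rewrite -AB'.
    by case=> [Az|Bz]; [left; left | right].
  - by exists a'; split; [case: (AK a' (or_introl Aa')) | left].
  - by exists b'; split=> //; case: (AK b' (or_intror Bb')).
  case: Az => [Az|clz]; first by have : (A' `&` B') z by []; rewrite AB0'.
  have [Oz|zw] := Hw z Kz clz; first by case: (AK z (or_intror Bz)).
  by apply: nBw; rewrite -zw.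
have [Bw|nBw] := pselect (B w); last exact: (key A B a b).
apply: (key B A b a) => //; rewrite 1?setUC 1?setIC //.
by move=> Aw; have : (A `&` B) w by []; rewrite AB0.
Qed.

Variables (D bd : set T).
Hypothesis dD : is_disc D bd.
Let lD := disc_lc dD.

Lemma side_closure X a z : closed X -> closure [set c | joined (D `&` ~` X) a c] z -> D z ->
  joined (D `&` ~` X) a z \/ X z.
Proof.
move=> cX cl Dz; have [Xz|nXz] := pselect (X z); [by right | left].
by apply: (joined_closure lD) => //; exact: closed_openC.
Qed.

(** If [X] met [K] in at most the point [w], the part of [K] in the class of [h] could be removed,
    against irreducibility. *)
Lemma irreducible_meets_twice K X x y h w : irreducible K x y -> K `<=` D -> closed X ->
  K h -> ~ X h -> ~ joined (D `&` ~` X) h x -> ~ joined (D `&` ~` X) h y ->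
  exists w', [/\ X w', K w' & w' <> w].
Proof.
move=> [cK Kx Ky minK] KD cX Kh nXh nx ny; apply: contrapT => H.
have Xw z : X z -> K z -> z = w by move=> Xz Kz; apply: contrapT => zw; apply: H; exists z.
have [ O oO VE] := joined_rel_open lD h (closed_openC cX).
have OE z : D z -> O z -> joined (D `&` ~` X) h z by move=> Dz Oz; have : (O `&` D) z by []; rewrite -VE.
have EO z : joined (D `&` ~` X) h z -> O z by move=> hz; have : [set b | joined (D `&` ~` X) h b] z by []; rewrite VE => -[].
have cKO : continuum (K `\` O).
  apply: (@continuum_remove K O w) => // z Kz cl; have Dz := KD z Kz.
  have [ | /EO | Xz] := side_closure (a := h) cX _ Dz; [|by left|by right; exact: Xw].
  by apply: closureS cl => c [/KD Dc Oc]; exact: OE.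
have E : K `\` O = K.
  apply: minK => //.
  - by split=> // Ox; apply: nx; apply: OE => //; exact: KD.
  - by split=> // Oy; apply: ny; apply: OE => //; exact: KD.
have : (K `\` O) h by rewrite E.
by move=> [_]; apply; apply: EO; apply: joined_refl; split=> //; exact: KD.
Qed.

(* If a piece of [K] lay in the component of [g], removing it would have to
   disconnect [K]; then the part of the piece of [u] on one side could be
   removed instead. *)
Lemma irreducible_avoids K X x y u g w w' : irreducible K x y -> K `<=` D -> closed X ->
  (forall z, X z -> K z -> z = w \/ z = w') -> K u -> ~ X u ->
  ~ joined (D `&` ~` X) u x -> ~ joined (D `&` ~` X) u y ->
  ~ joined (D `&` ~` X) g x -> ~ joined (D `&` ~` X) g y ->
  ~ joined (D `&` ~` X) g u -> forall v, K v -> ~ joined (D `&` ~` X) g v.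
Proof.
move=> [cK Kx Ky minK] KD cX Xw Ku nXu nux nuy ngx ngy ngu v Kv gv.
have oX := closed_openC cX.
have [ O oO VE] := joined_rel_open lD g oX.
have OE z : D z -> O z -> joined (D `&` ~` X) g z by move=> Dz Oz; have : (O `&` D) z by []; rewrite -VE.
have EO z : joined (D `&` ~` X) g z -> O z by move=> hz; have : [set b | joined (D `&` ~` X) g b] z by []; rewrite VE => -[].
have [ O' oO' VE'] := joined_rel_open lD u oX.
have OE' z : D z -> O' z -> joined (D `&` ~` X) u z by move=> Dz Oz; have : (O' `&` D) z by []; rewrite -VE'.
have EO' z : joined (D `&` ~` X) u z -> O' z by move=> hz; have : [set b | joined (D `&` ~` X) u b] z by []; rewrite VE' => -[].
have clKO z : K z -> closure (K `&` O) z -> O z \/ X z.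
  move=> Kz cl; have [ | /EO | ] := side_closure (a := g) cX _ (KD z Kz); [|by left|by right].
  by apply: closureS cl => c [/KD Dc Oc]; exact: OE.
have clKO' z : K z -> closure (K `&` O') z -> O' z \/ X z.
  move=> Kz cl; have [ | /EO' | ] := side_closure (a := u) cX _ (KD z Kz); [|by left|by right].
  by apply: closureS cl => c [/KD Dc Oc]; exact: OE'.
have [kK nK] := cK; have cKc := compact_closed hT kK.
have cKO : closed (K `\` O) by apply: closedI => //; exact: open_closedC.
have nOu : ~ O u by move=> /(OE u (KD u Ku)).
suff nKO : connected (K `\` O).
  have E : K `\` O = K.
    apply: minK => //.
    - by split=> //; apply: (subclosed_compact cKO kK) => z [].
    - by split=> // Ox; apply: ngx; apply: OE => //; exact: KD.
    - by split=> // Oy; apply: ngy; apply: OE => //; exact: KD.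
  have : (K `\` O) v by rewrite E.
  by move=> [_]; apply; exact: EO.
apply: connected_of_closed_split => // A B cA cB AB AB0 [a Aa] [b Bb].
have key A' B' b' : closed A' -> closed B' -> K `\` O = A' `|` B' -> A' `&` B' = set0 ->
    A' u -> B' b' -> False.
  move=> cA' cB' AB' AB0' Au Bb'.
  have AK z : (A' `|` B') z -> K z /\ ~ O z by rewrite -AB' => -[].
  have [w0 hw0] : exists w0, forall z, A' z -> X z -> z = w0.
    apply: contrapT => nw.
    have Awx z : X z -> K z -> B' z -> False.
      move=> Xz Kz Bz; apply: nw; have nA t : A' t -> t <> z.
        by move=> At tz; have : (A' `&` B') z; [split=> //; rewrite -tz | rewrite AB0'].
      have [zw|zw] := Xw z Xz Kz; [exists w' | exists w] => t At Xt;
        have [||] := Xw t Xt _; rewrite ?zw //; try (by case: (AK t (or_introl At)));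
        by move=> tz; case: (nA t At); rewrite tz zw.
    have := connected_closed_meet nK (closedU cA' (@closed_closure _ (K `&` O))) cB'.
    case=> [z Kz|||z [[Kz Az] Bz]].
    - have [Oz|nOz] := pselect (O z); first by left; right; exact: subset_closure.
      have : (A' `|` B') z by rewrite -AB'.
      by case=> [Az|Bz]; [left; left | right].
    - by exists u; split=> //; left.
    - by exists b'; split=> //; case: (AK b' (or_intror Bb')).
    case: Az => [Az|clz]; first by have : (A' `&` B') z by []; rewrite AB0'.
    have [Oz|Xz] := clKO z Kz clz; first by case: (AK z (or_intror Bz)).
    exact: (Awx z).
  have oO2 : open (O' `&` ~` B') by apply: openI => //; exact: closed_openC.
  have sub : K `&` (O' `&` ~` B') `<=` A'.
    move=> z [Kz [Oz nBz]]; have Dz := KD z Kz.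
    have nOz : ~ O z.
      move=> /(OE z Dz) gz; apply: ngu; apply: (joined_trans gz).
      by apply: joined_sym; exact: OE'.
    have : (A' `|` B') z by rewrite -AB'.
    by case.
  have cK2 : continuum (K `\` (O' `&` ~` B')).
    apply: (@continuum_remove K _ w0) => // z Kz cl; have Az : A' z by apply: cA'; exact: closureS cl.
    have [|Oz|Xz] := clKO' z Kz _; [|left|right; exact: hw0].
      by apply: closureS cl => c [Kc []].
    by split=> // Bz; have : (A' `&` B') z by []; rewrite AB0'.
  have E : K `\` (O' `&` ~` B') = K.
    apply: minK => //.
    - by split=> // -[Ox _]; apply: nux; apply: OE' => //; exact: KD.
    - by split=> // -[Oy _]; apply: nuy; apply: OE' => //; exact: KD.
  have : (K `\` (O' `&` ~` B')) u by rewrite E.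
  move=> [_]; apply; split; first by apply: EO'; apply: joined_refl; split=> //; exact: KD.
  by move=> Bu; have : (A' `&` B') u by []; rewrite AB0'.
have : (A `|` B) u by rewrite -AB.
case=> [Au|Bu]; first exact: (key A B b).
by apply: (key B A a) => //; rewrite 1?setUC 1?setIC.
Qed.

End Removal.

Definition at_most_two (T : Type) (A : set T) :=
  forall a b c, A a -> A b -> A c -> [\/ a = b, a = c | b = c].

(** * Plaques through the inside of a lens *)

Section Lens.
Variables (R : realType) (T : pseudoMetricType R).
Hypothesis hT : hausdorff_space T.
Variables (D bd : set T).
Hypothesis dD : is_disc D bd.
Let clD : closed D := compact_closed hT (disc_cpt dD).
Let lD := disc_lc dD.

Lemma psep_nbhs S r p q : decomposition D bd S -> D r -> D p -> psep D S r p q ->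
  exists U, [/\ open U, U p & forall w, U w -> D w -> psep D S r w q].
Proof.
move=> dS Dr Dp [nrp nrq nj].
have [U [oU Up HU]] := joined_open lD (closed_openC (plaque_closed hT dS Dr)) Dp nrp.
exists U; split=> // w Uw Dw; have pw := HU w Uw Dw; split=> //.
  by have [_ []] := joined_mem pw.
by move=> wq; apply: nj; exact: joined_trans pw wq.
Qed.

Lemma psep_exists S p q : decomposition D bd S -> D p -> D q -> ~ S p q ->
  exists2 r, D r & psep D S r p q.
Proof.
move=> dS Dp Dq npq; have [kP nP] := dec_continuum dS Dp.
have PD : S p `<=` D by exact: (dec_sub dS Dp).
have P0 : S p !=set0 by exists p; exact: (dec_refl dS).
have Psat z : S p z -> S z `<=` S p by move=> pz; rewrite (dec_eq dS Dp pz).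
have [r [Dr _ h]] := separating_plaque hT dD dS (compact_closed hT kP) nP PD P0 Psat Dq npq.
by exists r => //; apply: h; exact: (dec_refl dS).
Qed.

(** By [projection] the plaque of [g] either separates [x] from [h], hence [u0] from both ends of
    [U0], and must meet [U0] twice, or it branches off at some plaque of [r]. In the latter case the
    plaque of [r] already uses up two points of [U0], so [irreducible_avoids] keeps [U0] out of the
    branch, and the plaque of [g] would lead to the boundary without crossing the lens. *)
Lemma lens_half S x y S0 U0 h u0 r1 r2 g w : decomposition D bd S -> D x -> S x y ->
  S0 `<=` S x -> irreducible U0 x y -> U0 `<=` D ->
  (forall r, D r -> at_most_two (S r `&` U0)) ->
  (forall c, bd c -> ~ joined (D `&` ~` (S0 `|` U0)) h c) ->
  D h -> S h u0 -> U0 u0 -> D r1 -> D r2 -> psep D S r1 x h -> psep D S r2 x h ->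
  joined (D `&` ~` (S0 `|` U0)) h g -> psep D S r1 g x -> psep D S r2 g h ->
  exists w', [/\ S g w', U0 w' & w' <> w].
Proof.
move=> dS Dx Sxy S0S irr U0D two Hbd Dh Su0 Uu0 Dr1 Dr2 s1 s2 hg s1' s2'.
have Dg : D g by have [_ []] := joined_mem hg.
have Du0 := U0D _ Uu0; have Dy : D y by exact: (dec_sub dS Dx).
have hits r : D r -> psep D S r x h ->
    [/\ ~ S r u0, ~ joined (D `&` ~` S r) u0 x & ~ joined (D `&` ~` S r) u0 y].
  move=> Dr rxh; have rux := psep_plaque dS Dr Dh (psep_sym rxh) Su0.
  have [] := psep_sym (psep_plaque dS Dr Dx (psep_sym rux) Sxy).
  by case: rux.
have [gxh|[r [Dr rxh rgx rgh]]] := projection hT dD dS Dg Dx Dh Dr1 Dr2 s1 s1' s2 s2'.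
  have [ngu nux nuy] := hits g Dg gxh.
  exact: (irreducible_meets_twice hT dD w irr U0D (plaque_closed hT dS Dg) Uu0 ngu nux nuy).
have [nru nux nuy] := hits r Dr rxh.
have cr := plaque_closed hT dS Dr.
have [w1 [rw1 Uw1 _]] := irreducible_meets_twice hT dD h irr U0D cr Uu0 nru nux nuy.
have [w2 [rw2 Uw2 w21]] := irreducible_meets_twice hT dD w1 irr U0D cr Uu0 nru nux nuy.
have Xw z : S r z -> U0 z -> z = w1 \/ z = w2.
  move=> rz Uz; have [|?|?] := two r Dr w1 w2 z (conj rw1 Uw1) (conj rw2 Uw2) (conj rz Uz).
  - by move=> E; case: w21.
  - by left.
  - by right.
have [nrg nrx ngx] := rgx; have [_ _ ngh] := rgh.
have [_ _ ngy] := psep_sym (psep_plaque dS Dr Dx (psep_sym rgx) Sxy).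
have [_ _ ngu] := psep_sym (psep_plaque dS Dr Dh (psep_sym rgh) Su0).
have avoid := irreducible_avoids hT dD irr U0D cr Xw Uu0 nru nux nuy ngx ngy ngu.
have [b bb gb] := dec_bd dS Dg; case: (Hbd b bb); apply: (joined_trans hg).
apply: (joined_continuum (dec_continuum dS Dg)) => //; first exact: (dec_refl dS).
move=> z gz; split; first exact: (dec_sub dS Dg).
have gz' : joined (D `&` ~` S r) g z by exact: (plaque_joined dS).
move=> [/S0S xz|Uz]; last exact: (avoid z Uz).
apply: ngx; apply: (joined_trans gz').
by apply: joined_sym; exact: (plaque_joined dS).
Qed.

(** The plaque of [k] reaches [bd] and so leaves the enclosed region; being disjoint from the plaque
    of [x], which contains [S0], it can only leave through [U0]. *)
Lemma lens_exit S S0 U0 x h k : decomposition D bd S -> D x -> S0 `<=` S x ->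
  closed (S0 `|` U0) ->
  (forall c, bd c -> ~ joined (D `&` ~` (S0 `|` U0)) h c) ->
  joined (D `&` ~` (S0 `|` U0)) h k -> ~ S x k ->
  exists K, [/\ continuum K, K k, K `<=` S k,
    (forall z, K z -> joined (D `&` ~` (S0 `|` U0)) h z \/ (S0 `|` U0) z) & K `&` U0 !=set0].
Proof.
move=> dS Dx S0S cSU Hbd hk nxk.
pose H := [set z | joined (D `&` ~` (S0 `|` U0)) h z].
have Dk : D k by have [_ []] := joined_mem hk.
have HD z : H z -> D z by move=> hz; have [_ []] := joined_mem hz.
have oH : open H.
  have [V oV HE] := joined_rel_open lD h (closed_openC cSU).
  rewrite (_ : H = V `&` (D `\` bd)); first by apply: openI => //; exact: (disc_int_open dD).
  apply/seteqP; split=> z.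
    move=> Hz; have : (V `&` D) z by rewrite -HE.
    by move=> [Vz Dz]; split=> //; split=> // /Hbd.
  by move=> [Vz [Dz _]]; have : (V `&` D) z by []; rewrite -HE.
have nSH : ~ S k `<=` H by have [b bb kb] := dec_bd dS Dk => /(_ b kb); exact: Hbd.
have [K [cK Kk KS Kcl [w Kw nHw]]] :=
  continuum_sub_exits hT (dec_continuum dS Dk) oH (dec_refl dS Dk) hk nSH.
have KH z : K z -> H z \/ (S0 `|` U0) z.
  by move=> Kz; apply: (side_closure dD) => //; [exact: Kcl | apply: (dec_sub dS Dk); exact: KS].
exists K; split=> //; exists w; split=> //.
have [//|[/S0S xw|//]] := KH w Kw.
by case: (plaque_disjoint dS Dx Dk nxk xw); exact: KS.
Qed.

(* Irreducible continua in the two plaques through [x] and [y] enclose a point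
   [h]; a point whose plaques lie strictly between those of [x] and of [h] has
   plaques crossing each side of the lens twice. *)
Lemma lens_region S U x y : decomposition D bd S -> decomposition D bd U ->
  (forall a b, D a -> D b -> at_most_two (S a `&` U b)) ->
  (forall V, open V -> V !=set0 -> V `<=` D -> ~ V `<=` S x /\ ~ V `<=` U x) ->
  D x -> x <> y -> S x y -> U x y ->
  exists G S0 U0, [/\ open G /\ G !=set0, G `<=` D, S0 `<=` S x, U0 `<=` U x &
   forall g w, G g -> (exists w', [/\ S g w', U0 w' & w' <> w]) /\                      (exists w', [/\ U g w', S0 w' & w' <> w])].
Proof.
move=> dS dU two noint Dx xy Sxy Uxy.
have Sx := dec_refl dS Dx; have Ux := dec_refl dU Dx.
have [S0 irrS S0S] := irreducible_exists hT (dec_continuum dS Dx) Sx Sxy.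
have [U0 irrU U0U] := irreducible_exists hT (dec_continuum dU Dx) Ux Uxy.
have [cS S0x S0y _] := irrS; have [cU U0x U0y _] := irrU.
have S0D : S0 `<=` D by apply: subset_trans S0S _; exact: (dec_sub dS).
have U0D : U0 `<=` D by apply: subset_trans U0U _; exact: (dec_sub dU).
have c1 (z : T) : closed [set z] by apply: (compact_closed hT); exact: compact_set1.
have SU : S0 `&` U0 = [set x] `|` [set y].
  apply/seteqP; split=> z; last by move=> [->|->].
  move=> [Sz Uz]; have [//|->|->] := two x x Dx Dx x y z (conj Sx Ux) (conj Sxy Uxy)
    (conj (S0S z Sz) (U0U z Uz)); [by left | by right].
have [|h0 [Dh0 nh0 Hbd0]] := disc_enclose dD cS cU S0D U0D (c1 x) (c1 y) SU _
    (ex_intro _ x erefl) (ex_intro _ y erefl).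
  by apply/seteqP; split=> // z [/= -> /xy].
have cSU : closed (S0 `|` U0).
  by apply: closedU; apply: (compact_closed hT); [case: cS | case: cU].
have oSU := closed_openC cSU.
pose E a b := joined (D `&` ~` (S0 `|` U0)) a b.
have nbh a : E h0 a -> exists V, [/\ open V, V a, V `<=` D & forall z, V z -> E h0 z].
  move=> Ea; have [_ [Da na]] := joined_mem Ea.
  have [V [oV Va HV]] := joined_open lD oSU Da na.
  exists (V `&` (D `\` bd)); split.
  - by apply: openI => //; exact: (disc_int_open dD).
  - by split=> //; split=> // /Hbd0.
  - by move=> z [_ []].
  - by move=> z [Vz [Dz _]]; apply: (joined_trans Ea); exact: HV.
(* Neither plaque of [x] contains an open set, so the enclosed point can be moved off both of
   them. *)
have [h [Eh nSh nUh]] : exists h, [/\ E h0 h, ~ S x h & ~ U x h].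
  have [V [oV Vh VD VE]] := nbh h0 (joined_refl (conj Dh0 nh0)).
  have oV1 : open (V `\` S x).
    by apply: openI => //; apply: closed_openC; exact: (plaque_closed hT dS).
  have V1D : V `\` S x `<=` D by move=> z [/VD].
  have V10 : (V `\` S x) !=set0.
    have [/existsNP [z /not_implyP [Vz nz]] _] := noint V oV (ex_intro _ h0 Vh) VD.
    by exists z.
  have [_ /existsNP [z /not_implyP [[Vz nSz] nUz]]] := noint _ oV1 V10 V1D.
  by exists z; split=> //; exact: VE.
have Hbd c : bd c -> ~ E h c by move=> bc hc; apply: (Hbd0 c bc); exact: joined_trans Eh hc.
have Dh : D h by have [_ []] := joined_mem Eh.
have Ehh : E h h by apply: joined_refl; have [] := joined_mem Eh.
have cUS : closed (U0 `|` S0) by rewrite setUC.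
have cSWAP : U0 `|` S0 = S0 `|` U0 by rewrite setUC.
(* The order is [x], [r1], [r3], [r2], [h]. The plaque of [r3] will contain a point of [G], while
   [r1] and [r2] leave a margin that makes the position of [g] an open condition; [t1], [t3], [t2]
   do the same for [U]. *)
have [r3 Dr3 sr3] := psep_exists dS Dx Dh nSh.
have [r1 Dr1 sr1] := psep_exists dS Dx Dr3 (fun h1 => (let: And3 n1 _ _ := sr3 in n1) (plaque_sym dS Dx h1)).
have [r2 Dr2 sr2] := psep_exists dS Dr3 Dh (let: And3 _ n2 _ := sr3 in n2).
have [t3 Dt3 st3] := psep_exists dU Dx Dh nUh.
have [t1 Dt1 st1] := psep_exists dU Dx Dt3 (fun h1 => (let: And3 n1 _ _ := st3 in n1) (plaque_sym dU Dx h1)).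
have [t2 Dt2 st2] := psep_exists dU Dt3 Dh (let: And3 _ n2 _ := st3 in n2).
have [K [cK Kh KS KE [u0 [Ku0 Uu0]]]] := lens_exit dS Dx S0S cSU Hbd Ehh nSh.
have HbdU c : bd c -> ~ joined (D `&` ~` (U0 `|` S0)) h c by rewrite cSWAP; exact: Hbd.
have EhhU : joined (D `&` ~` (U0 `|` S0)) h h by rewrite cSWAP.
have [L [_ _ LU _ [s0 [Ls0 Ss0]]]] := lens_exit dU Dx U0U cUS HbdU EhhU nUh.
have meets Z Q r p q : decomposition D bd Z -> D r -> D p -> psep D Z r p q -> continuum Q ->
    Q `<=` D -> Q q -> (exists2 p', Z p p' & Q p') -> exists2 k, Z r k & Q k.
  move=> dZ Dr Dp rpq cQ QD Qq [p' pp' Qp']; have [_ _ nj] := psep_plaque dZ Dr Dp rpq pp'.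
  apply: contrapT => no; apply: nj; apply: (joined_continuum cQ) => // z Qz.
  by split; [exact: QD | move=> rz; apply: no; exists z].
have KD : K `<=` D by apply: subset_trans KS _; exact: (dec_sub dS).
(* Going from [h] along its stable plaque to [U0], the unstable plaque of [t3] is crossed at [k];
   going from [k] along its unstable plaque to [S0], the stable plaque of [r3] is crossed at [g]. So
   [G] is not empty. *)
have [|k tk Kk] := meets U K t3 x h dU Dt3 Dx st3 cK KD Kh; first by exists u0 => //; exact: U0U.
have Dk := KD k Kk.
have [nt3x _ _] := st3; have [nr3x _ _] := sr3.
have nUxk := plaque_disjoint dU Dt3 Dx nt3x tk.
have nShx : ~ S h x by move=> hx; apply: nSh; exact: (plaque_sym dS).
have nSxk : ~ S x k by apply: (plaque_disjoint dS Dh Dx nShx); exact: KS.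
have Ehk : E h k by case: (KE k Kk) => // -[/S0S|/U0U].
have EhkU : joined (D `&` ~` (U0 `|` S0)) h k by rewrite cSWAP.
have [Q [cQ Qk QU QE [v [Qv Sv]]]] := lens_exit dU Dx U0U cUS HbdU EhkU nUxk.
have QD : Q `<=` D by apply: subset_trans QU _; exact: (dec_sub dU).
have sr3k : psep D S r3 x k.
  by apply/psep_sym; apply: (psep_plaque dS Dr3 Dh (psep_sym sr3)); exact: KS.
have [|g rg Qg] := meets S Q r3 x k dS Dr3 Dx sr3k cQ QD Qk; first by exists v => //; exact: S0S.
have kg : U k g by exact: QU.
have tg : U t3 g by rewrite -(dec_eq dU Dt3 tk).
have nSxg := plaque_disjoint dS Dr3 Dx nr3x rg.
have nUxg := plaque_disjoint dU Dt3 Dx nt3x tg.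
have Ehg : E h g by have := QE g Qg; rewrite cSWAP => -[//|[/S0S|/U0U]].
have [r1h _] := psep_trans hT dD dS Dr3 Dr1 Dx Dh sr3 sr1.
have [t1h _] := psep_trans hT dD dU Dt3 Dt1 Dx Dh st3 st1.
have [r2h _] := psep_trans hT dD dS Dr3 Dr2 Dh Dx (psep_sym sr3) (psep_sym sr2).
have [t2h _] := psep_trans hT dD dU Dt3 Dt2 Dh Dx (psep_sym st3) (psep_sym st2).
pose G := [set g | [/\ E h g, psep D S r1 g x, psep D S r2 g h, psep D U t1 g x & psep D U t2 g h]].
exists G, S0, U0; split=> //.
- split; last first.
    exists g; split=> //.
    + exact: (psep_plaque dS Dr1 Dr3 (psep_sym sr1) rg).
    + exact: (psep_plaque dS Dr2 Dr3 sr2 rg).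
    + exact: (psep_plaque dU Dt1 Dt3 (psep_sym st1) tg).
    + exact: (psep_plaque dU Dt2 Dt3 st2 tg).
  rewrite openE => z [Ez z1 z2 z3 z4].
  have Dz : D z by have [_ []] := joined_mem Ez.
  have [V [oV Vz VD VE]] := nbh z (joined_trans Eh Ez).
  have [V1 [oV1 V1z HV1]] := psep_nbhs dS Dr1 Dz z1.
  have [V2 [oV2 V2z HV2]] := psep_nbhs dS Dr2 Dz z2.
  have [V3 [oV3 V3z HV3]] := psep_nbhs dU Dt1 Dz z3.
  have [V4 [oV4 V4z HV4]] := psep_nbhs dU Dt2 Dz z4.
  have nb (W : set T) : open W -> W z -> nbhs z W by move=> oW Wz; exact: open_nbhs_nbhs.
  apply: filterS (filterI (nb V oV Vz) (filterI (filterI (nb V1 oV1 V1z) (nb V2 oV2 V2z))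
    (filterI (nb V3 oV3 V3z) (nb V4 oV4 V4z)))) => w [Vw [[w1 w2] [w3 w4]]].
  have Dw := VD w Vw; split; [|exact: HV1|exact: HV2|exact: HV3|exact: HV4].
  exact: joined_trans (joined_sym Eh) (VE w Vw).
- by move=> z [hz _ _ _ _]; have [_ []] := joined_mem hz.
move=> z w [hz z1 z2 z3 z4]; split.
  apply: (lens_half (S0 := S0) (u0 := u0) w dS Dx Sxy S0S irrU U0D _ Hbd Dh _ Uu0 Dr1 Dr2 r1h (psep_sym r2h) hz z1 z2).
    by move=> r Dr a b c [ra /U0U Ua] [rb /U0U Ub] [rc /U0U Uc]; exact: (two r x).
  exact: KS.
have hzU : joined (D `&` ~` (U0 `|` S0)) h z by rewrite cSWAP.
apply: (lens_half (S0 := U0) (u0 := s0) w dU Dx Uxy U0U irrS S0D _ HbdU Dh _ Ss0 Dt1 Dt2 t1h (psep_sym t2h) hzU z3 z4).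
  by move=> r Dr a b c [ra /S0S Sa] [rb /S0S Sb] [rc /S0S Sc]; exact: (two x r).
exact: LU.
Qed.

End Lens.

(** * Recurrence excludes lenses *)

Section NoLens.
Variables (R : realType) (M : metricType R).
Hypothesis kM : compact [set: M].
Hypothesis discs : forall (x : M) O, open O -> O x ->
  exists D bd, [/\ is_disc D bd, D `<=` O & (D `\` bd) x].
Variables (f g : M -> M) (e : R).
Hypothesis sys : system f g e.
Let hM : hausdorff_space M := @metric_hausdorff _ M.
Let cf := sys_fc sys.
Let cg := sys_gc sys.
Let fK := sys_fK sys.
Let e0 := sys_e0 sys.

(** The point given by [sys_rec] depends on the time bound, but in [no_lens] that bound depends on
    the point. Nested balls, each of which returns into the previous one at a late time, yield one
    point with arbitrarily late returns. *)
Lemma recurrent_point O : open O -> O !=set0 ->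
  exists2 x, O x & forall N, exists2 m, (N <= m)%N & O (iter m f x).
Proof.
move=> oO [x0 Ox0]; have [t0 t00 ht0] := open_has_mball oO Ox0.
pose next (p q : M * R * nat) := 0 < p.1.2 -> [/\ 0 < q.1.2, q.2 = p.2.+1,
  [set w | mdist w q.1.1 <= q.1.2] `<=` [set w | mdist w p.1.1 < p.1.2] &
  exists2 m, (p.2 <= m)%N & forall w, mdist w q.1.1 <= q.1.2 -> mdist (iter m f w) p.1.1 < p.1.2].
have step p : {q | next p q}.
  apply: cid; case: p => -[u t] k; have [t1|nt] := pselect (0 < t); last by exists (u, t, k).
  have [|m [w [km /= wu mwu]]] := sys_rec sys k (open_mball u t); first by exists u; rewrite /= mdistxx.
  have oV : open ([set w | mdist w u < t] `&` iter m f @^-1` [set w | mdist w u < t]).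
    apply: openI; first exact: open_mball.
    by apply: open_comp; [move=> z _; exact: iter_cont | exact: open_mball].
  have [s s0 hs] := open_has_mball (z := w) oV (conj wu mwu).
  have half z : mdist z w <= s / 2 -> mdist z w < s by move=> h; move: s0 h; lra.
  exists (w, s / 2, k.+1) => _; split=> //=; first by rewrite divr_gt0.
    by move=> z /= /half /hs [].
  by exists m => // z /half /hs [].
have [q [q0 hq]] := dependent_choice step (x0, t0 / 2, 0%N).
pose u n := (q n).1.1; pose t n := (q n).1.2.
have tpos n : 0 < t n.
  elim: n => [|n IH]; first by rewrite /t q0 /= divr_gt0.
  by case: (hq n IH).
have idx n : (q n).2 = n by elim: n => [|n IH]; [rewrite q0 | case: (hq n (tpos n)) => _ ->; rewrite IH].
have nest n k : (n <= k)%N -> [set w | mdist w (u k) <= t k] `<=` [set w | mdist w (u n) <= t n].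
  move=> /subnK <-; elim: (k - n)%N => [|i IH] //=.
  apply: subset_trans IH => w; have [_ _ h _] := hq (i + n)%N (tpos _).
  by rewrite addSn => /h /= /ltW.
have [F [UF Foo]] := ultra_infinity; have PF : ProperFilter F := ultra_proper.
have [x ux] := tends_exists kM UF u.
have xin n : mdist x (u n) <= t n.
  apply: (tends_closed UF (@closed_mball _ _ (u n) (t n)) ux).
  apply: filterS (ultra_ge Foo n) => k /= nk; apply: (nest n k nk).
  by rewrite /= mdistxx ltW.
have ball0 : [set w | mdist w (u 0%N) <= t 0%N] `<=` O.
  by move=> w; rewrite /u /t q0 /= => h; apply: ht0 => /=; move: t00 h; lra.
exists x; first by apply: ball0; exact: xin.
move=> N; have [_ _ _ [m Nm hm]] := hq N (tpos N); rewrite idx in Nm.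
exists m => //; apply: ball0; apply: (nest 0%N N) => //=.
by apply: ltW; apply: hm; exact: xin.
Qed.

Variables (D bd : set M).
Hypothesis dD : is_disc D bd.
Hypothesis dS : decomposition D bd (plaque f e D).
Hypothesis fS : forall z, D z -> fwd f e (plaque f e D z).
Hypothesis dU : decomposition D bd (plaque g e D).
Hypothesis fU : forall z, D z -> fwd g e (plaque g e D z).

Local Notation S := (plaque f e D).
Local Notation U := (plaque g e D).

Let e4 : e <= 4 * e.
Proof. by move: e0; lra. Qed.

Lemma product_at_most_two a b : D a -> D b -> at_most_two (S a `&` U b).
Proof.
move=> Da Db s1 s2 s3 [S1 U1] [S2 U2] [S3 U3]; apply: (sys_exp sys).
  by apply: (fwd_le e4); apply: fwd_sub (fS Da) => x [->|->|->].
by apply: (fwd_le e4); apply: fwd_sub (fU Db) => x [->|->|->].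
Qed.

Lemma no_lens x y : D x -> S x y -> U x y -> x = y.
Proof.
move=> Dx Sxy Uxy; apply: contrapT => xy.
have [|G [S0 [U0 [[oG [g0 Gg0]] GD S0S U0U HG]]]] :=
  lens_region hM dD dS dU product_at_most_two _ Dx xy Sxy Uxy.
  move=> V oV V0 VD; split=> VS.
    by apply: (no_stable_open kM discs sys oV V0); apply: (fwd_le e4); exact: fwd_sub (fS Dx).
  by apply: (no_stable_open kM discs (system_sym sys) oV V0); apply: (fwd_le e4); exact: fwd_sub (fU Dx).
have [t t0 ht] := open_has_mball oG Gg0.
have t2 : 0 < t / 2 by rewrite divr_gt0.
have [|p /= pg0 rec] := recurrent_point (open_mball g0 (t / 2)); first by exists g0; rewrite /= mdistxx.
have Gp : G p by apply: ht => /=; move: t0 pg0; lra.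
have Dp := GD p Gp.
have [[u [pu Uu _]] _] := HG p p Gp; have [[u' [pu' Uu' u'u]] _] := HG p u Gp.
have d0 : 0 < mdist u u' by rewrite mdist_gt0; apply/eqP => E; apply: u'u; rewrite E.
have [N1 hN1] := fwd_contraction kM sys t2.
have [N2 hN2] := fwd_contraction kM (system_sym sys) d0.
have [m] := rec (maxn N1 N2); rewrite geq_max => /andP [Nm1 Nm2] /= mp.
have inG w : S p w -> G (iter m f w).
  move=> pw; apply: ht => /=.
  have := hN1 _ (dec_continuum dS Dp) (fwd_le e4 (fS Dp)) m w p Nm1 pw (dec_refl dS Dp).
  have := metric_triangle (iter m f w) (iter m f p) g0; lra.
set v := iter m f u; set v' := iter m f u'.
have Gv : G v by exact: inG. have Gv' : G v' by exact: inG.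
have Dv := GD v Gv; have Dv' := GD v' Gv'.
have gv w : iter m g (iter m f w) = w by rewrite iter_K.
(* On a common unstable plaque, [iter m g] would bring the two points closer than [mdist u u'],
   although it takes them back to [u] and [u']. *)
have [vv'|nvv'] := pselect (U v v').
  have := hN2 _ (dec_continuum dU Dv) (fwd_le e4 (fU Dv)) m v v' Nm2 (dec_refl dU Dv) vv'.
  by rewrite !gv ltxx.
have [_ [s1 [v1 S1 _]]] := HG v v Gv; have [_ [s2 [v2 S2 s21]]] := HG v s1 Gv.
have [_ [s3 [v3 S3 _]]] := HG v' v' Gv'.
have n3 s : U v s -> s <> s3 by move=> vs E; apply: (plaque_disjoint dU Dv Dv' nvv' vs); rewrite E.
(* Up to time [m] the backward orbits run through forward iterates of the stable plaque of [p];
   after that they are backward orbits of points of [U0], within one unstable plaque. *)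
have near_v j (a b : M) : (a = v \/ a = v') -> (b = v \/ b = v') -> mdist (iter j g a) (iter j g b) <= e.
  have fm a' : (a' = v \/ a' = v') -> exists c, [/\ a' = iter m f c, S p c & U0 c].
    by case=> ->; [exists u | exists u'].
  move=> /fm [c [-> pc Uc]] /fm [c' [-> pc' Uc']].
  have [jm|/ltnW mj] := leqP j m; first by rewrite !(iter_cancel _ fK) //; exact: (fS Dp).
  by rewrite -(subnK mj) !iterD !gv; apply: (fU Dx); exact: U0U.
(* Backwards, two of these points are linked by three steps of size [e]: along an unstable plaque to
   [v] or [v'], between these by [near_v], and along an unstable plaque again. *)
have [s12|s13|s23] : [\/ s1 = s2, s1 = s3 | s2 = s3].
- apply: (sys_exp sys).
    by apply: (fwd_le e4); apply: fwd_sub (fS Dx) => z [->|->|->]; exact: S0S.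
  have base z : [\/ z = s1, z = s2 | z = s3] -> exists w, (w = v \/ w = v') /\ U w z.
    by case=> ->; [exists v | exists v | exists v']; split=> //; [left|left|right].
  have near_b j z w : (w = v \/ w = v') -> U w z -> mdist (iter j g z) (iter j g w) <= e.
    have Dw : (w = v \/ w = v') -> D w by case=> ->.
    by move=> /Dw {}Dw wz; apply: (fU Dw) => //; exact: (dec_refl dU).
  move=> j a b /base [va [hva Ua]] /base [vb [hvb Ub]].
  have h1 := near_b j a va hva Ua; have h2 := near_b j b vb hvb Ub; have h3 := near_v j va vb hva hvb.
  have := metric_triangle (iter j g a) (iter j g va) (iter j g b).
  have := metric_triangle (iter j g va) (iter j g vb) (iter j g b).
  rewrite (metric_sym (iter j g vb)); move: e0 h1 h2 h3.
  move: (mdist _ _) (mdist _ _) (mdist _ _) (mdist _ _) (mdist _ _) => A B C E F; lra.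
- by apply: s21.
- exact: (n3 s1).
- exact: (n3 s2).
Qed.

End NoLens.

(** * Hairpins and propagation of separation *)

Section Separated.
Variables (R : realType) (T : pseudoMetricType R).
Hypothesis hT : hausdorff_space T.
Variables (D bd : set T).
Hypothesis dD : is_disc D bd.
Variables S U : T -> set T.
Hypothesis dS : decomposition D bd S.
Hypothesis dU : decomposition D bd U.
Hypothesis nolens : forall x y, D x -> S x y -> U x y -> x = y.

(** If a continuum [Y] joined [a] to [b] off the plaque of [c], some plaque [U r] would separate [c]
    from the saturation of [Y], hence from both ends. It would then meet [C] in two points, and
    these form a lens. *)
Lemma irreducible_separated C a b c : D a -> C `<=` S a -> irreducible C a b -> C c ->
  c <> a -> c <> b -> psep D U c a b.
Proof.
move=> Da CS irr Cc ca cb; have [cC Ca Cb _] := irr.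
have CD : C `<=` D by apply: subset_trans CS _; exact: (dec_sub dS).
have Dc := CD c Cc; have Sca z : C z -> S c z.
  by move=> /CS az; rewrite (dec_eq dS Da (CS c Cc)).
have na : ~ U c a by move=> Uca; apply: ca; apply: nolens => //; exact: Sca.
have nb : ~ U c b by move=> Ucb; apply: cb; apply: nolens => //; exact: Sca.
split=> // -[Y [cY Ya Yb YO]].
have YD : Y `<=` D by move=> z /YO [].
have clY : closed Y by apply: (compact_closed hT); case: cY.
have nYc : ~ sat D U Y c by move=> [_ [z [cz /YO [_]]]].
have Ysat z : sat D U Y z -> U z `<=` sat D U Y by exact: (sat_saturated dU).
have Y0 : sat D U Y !=set0 by exists a; apply: (sat_sub dU).
have [r [Dr _ Hr]] := separating_plaque hT dD dU (sat_closed dU clY YD)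
  (sat_connected dU (proj2 cY) YD) (@sat_D _ _ D U Y) Y0 Ysat Dc nYc.
have [nra nrc nac] := Hr a (sat_sub dU YD Ya).
have [nrb _ nbc] := Hr b (sat_sub dU YD Yb).
have nca : ~ joined (D `&` ~` U r) c a by move/joined_sym.
have ncb : ~ joined (D `&` ~` U r) c b by move/joined_sym.
have clr := plaque_closed hT dU Dr.
have [w1 [rw1 Cw1 _]] := irreducible_meets_twice hT dD c irr CD clr Cc nrc nca ncb.
have [w2 [rw2 Cw2 w21]] := irreducible_meets_twice hT dD w1 irr CD clr Cc nrc nca ncb.
apply: w21; apply/esym; apply: nolens; first exact: CD.
  by rewrite (dec_eq dS Da (CS _ Cw1)); exact: CS.
by rewrite (dec_eq dU Dr rw1).
Qed.

End Separated.

(** * Discs carrying both decompositions, and the absence of hairpins *)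

Section Good.
Variables (R : realType) (M : metricType R).
Hypothesis kM : compact [set: M].
Hypothesis discs : forall (x : M) O, open O -> O x ->
  exists D bd, [/\ is_disc D bd, D `<=` O & (D `\` bd) x].
Let hM : hausdorff_space M := @metric_hausdorff _ M.

Record good (f g : M -> M) (e : R) (D bd : set M) : Prop := Good {
  good_disc : is_disc D bd;
  good_S : decomposition D bd (plaque f e D);
  good_fS : forall z, D z -> fwd f e (plaque f e D z);
  good_U : decomposition D bd (plaque g e D);
  good_fU : forall z, D z -> fwd g e (plaque g e D z)
}.

Lemma good_discs f g e : system f g e -> exists2 rho, 0 < rho &
  forall D bd, is_disc D bd -> bounded_by rho D -> good f g e D bd.
Proof.
move=> sys; have [r r0 hr] := plaque_decomposition kM discs sys.
have [s s0 hs] := plaque_decomposition kM discs (system_sym sys).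
exists (Num.min r s); first by rewrite lt_min r0.
move=> D bd dD bD.
have bDr : bounded_by r D.
  by move=> a b Da Db; apply: le_trans (bD a b Da Db) _; rewrite ge_min lexx.
have bDs : bounded_by s D.
  by move=> a b Da Db; apply: le_trans (bD a b Da Db) _; rewrite ge_min lexx orbT.
have [dS fS] := hr D bd dD bDr; have [dU fU] := hs D bd dD bDs.
by split.
Qed.

Variables (f g : M -> M) (e : R).
Hypothesis sys : system f g e.
Let cf := sys_fc sys.

Lemma good_nolens D bd : good f g e D bd ->
  forall x y, D x -> plaque f e D x y -> plaque g e D x y -> x = y.
Proof. by move=> [dD dS fS dU fU] x y; exact: (no_lens kM discs sys dD dS fS dU fU). Qed.

Lemma good_uniform : exists2 rho, 0 < rho & forall r, 0 < r -> r <= rho -> exists2 s, 0 < s & forall x : M,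
  exists D bd, [/\ good f g e D bd, [set w | mdist w x < s] `<=` D `\` bd &
    D `<=` [set w | mdist w x < r]].
Proof.
have [rho rho0 hrho] := good_discs sys; exists (rho / 2); first by rewrite divr_gt0.
move=> r r0 rr; have [s s0 hs] := uniform_disc kM discs r0; exists s => // x.
have [D [bd [dD BD DB]]] := hs x; exists D, bd; split=> //; apply: hrho => // a b /DB /= ax /DB /= bx.
by have := metric_triangle a x b; rewrite (metric_sym x b); lra.
Qed.

(* A hairpin would degenerate to a lens: the unstable plaque of a far point of
   the hairpin separates the two close ends. *)
Lemma no_hairpin : exists2 k, 0 < k & forall r, 0 < r -> exists2 s, 0 < s &
  forall C a b, continuum C -> fwd f e C -> bounded_by k C -> C a -> C b -> mdist a b < s ->
  exists C', [/\ continuum C', C' a, C' b, C' `<=` C & bounded_by r C'].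
Proof.
have [rho rho0 hrho] := good_uniform; have [s1 s10 hs1] := hrho rho rho0 (lexx _).
exists (s1 / 2); first by rewrite divr_gt0.
move=> r r0; apply: contrapT => H.
have step (k : nat) : exists p : set M * M * M * M, let: (C, a, b, c) := p in
  [/\ irreducible C a b, fwd f e C, bounded_by (s1 / 2) C, mdist a b < k.+1%:R^-1 & C c /\ r / 2 <= mdist c a].
  apply: contrapT => h; apply: H; exists k.+1%:R^-1; first by rewrite invr_gt0.
  move=> C a b cC fC bC Ca Cb ab; have [I irr IC] := irreducible_exists hM cC Ca Cb.
  have [cI Ia Ib _] := irr; exists I; split=> // u v Iu Iv.
  rewrite leNgt; apply/negP => uv; apply: h.
  have [c [Ic cr]] : exists c, I c /\ r / 2 <= mdist c a.
    have [h1|h1] := leP (r / 2) (mdist u a); first by exists u.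
    exists v; split=> //; have := metric_triangle u a v; rewrite (metric_sym a v).
    by move: uv h1; lra.
  exists (I, a, b, c); split=> //; first exact: fwd_sub fC.
  by move=> x y /IC Cx /IC; exact: bC.
have [q hq] := choice step.
pose C k := (q k).1.1.1; pose a k := (q k).1.1.2; pose b k := (q k).1.2; pose c k := (q k).2.
have {}hq k : [/\ irreducible (C k) (a k) (b k), fwd f e (C k), bounded_by (s1 / 2) (C k),
    mdist (a k) (b k) < k.+1%:R^-1 & C k (c k) /\ r / 2 <= mdist (c k) (a k)].
  by have := hq k; rewrite /C /a /b /c; case: (q k) => [[[? ?] ?] ?].
have cC k : continuum (C k) by have [[]] := hq k.
have Ca k : C k (a k) by have [[]] := hq k.
have Cb k : C k (b k) by have [[]] := hq k.
have Cc k : C k (c k) by have [_ _ _ _ []] := hq k.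
have [F [UF Foo]] := ultra_infinity; have PF : ProperFilter F := ultra_proper.
have [p ap] := tends_exists kM UF a; have [z cz] := tends_exists kM UF c.
have bp : tends F b p.
  apply: (tends_close UF ap) => t t0; apply: filterS (ultra_small Foo t0) => k /= kt.
  by rewrite metric_sym; apply: lt_trans kt; case: (hq k).
have zp : r / 2 <= mdist z p.
  by apply: (tends_ge UF cz ap); apply: filterE => k; case: (hq k) => _ _ _ _ [].
have r2 : 0 < r / 2 by rewrite divr_gt0.
have s2 : 0 < s1 / 2 by rewrite divr_gt0.
have [D [bd [gD BD _]]] := hs1 p; have [dD dS fS dU fU] := gD.
have clD : closed D := compact_closed hM (disc_cpt dD).
have FD : F [set k | C k `<=` D].
  apply: filterS (ap _ s2) => k /= apk w Cw.
  have [|//] := BD w; rewrite /=; have [_ _ bC _ _] := hq k.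
  by have := bC w (a k) Cw (Ca k); have := metric_triangle w (a k) p; lra.
have Spz : plaque f e D p z.
  apply: (plaque_max (climit_continuum kM UF Foo cC)).
  - move=> n x y; apply: (climit_le UF (@iter_cont _ _ f n cf)).
    by apply: filterE => k x' y'; case: (hq k) => _ fC _ _ _; exact: fC.
  - by apply: (climit_tends UF ap); apply: filterE.
  - exact: (climit_sub UF clD FD).
  - by apply: (climit_tends UF cz); apply: filterE.
have Dp : D p by case: (BD p); rewrite /= ?mdistxx.
have Dz : D z by exact: (dec_sub dS Dp).
(* Near [p] the ends [a k] and [b k] are joined by a small continuum, which must meet the unstable
   plaque of [c k]. By upper semicontinuity the unstable plaque of [z] then has points arbitrarily
   near [p]. *)
have Uzp : plaque g e D z p.
  apply: contrapT => nzp.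
  have [t t0 ht] := open_has_mball (closed_openC (plaque_closed hM dU Dz)) nzp.
  have t2 : 0 < t / 2 by rewrite divr_gt0.
  have [|Q [V [cQ QO oV Vp VQ]]] := disc_lc dD Dp (open_mball p (t / 2)); first by rewrite /= mdistxx.
  have [v v0 hv] := open_has_mball oV Vp.
  have cF : closed ([set w | mdist w p <= t / 2] `&` D) by apply: closedI => //; exact: closed_mball.
  have cUF := dec_usc dU cF (@subIsetr _ _ _).
  have [|_ [w [zw [/= wp _]]]] := tends_closed UF cUF cz; last first.
    by apply: (ht w) => //=; move: t0 wp; lra.
  apply: filterS (filterI (filterI FD (ultra_small Foo r2)) (filterI (ap _ v0) (bp _ v0))) => k /= [[CD kr] [ak bk]].
  have Dc := CD _ (Cc k); have Da := CD _ (Ca k); have Db := CD _ (Cb k); split=> //.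
  have [irr fC _ ab [_ cr]] := hq k.
  have [_ _ nj] : psep D (plaque g e D) (c k) (a k) (b k).
    apply: (irreducible_separated hM dD dS dU (good_nolens gD) Da _ irr (Cc k)).
    - exact: (plaque_max (cC k) fC (Ca k)).
    - by move=> E; move: cr; rewrite E mdistxx leNgt r2.
    - by move=> E; move: cr; rewrite E leNgt metric_sym (lt_trans ab kr).
  apply: contrapT => no; apply: nj; apply: (joined_continuum cQ).
  - by apply: VQ; split=> //; exact: hv.
  - by apply: VQ; split=> //; exact: hv.
  - move=> w Qw; have [/= wp Dw] := QO w Qw; split=> // cw; apply: no.
    by exists w; split=> //; split=> //=; exact: ltW.
have Upz : plaque g e D p z by exact: (plaque_sym dU).
by move: zp; rewrite (good_nolens gD Dp Spz Upz) mdistxx leNgt r2.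
Qed.

End Good.

(** * Order among the plaques separating two points *)

Section Order.
Variables (R : realType) (T : pseudoMetricType R).
Hypothesis hT : hausdorff_space T.
Variables (D bd : set T).
Hypothesis dD : is_disc D bd.
Variables S : T -> set T.
Hypothesis dS : decomposition D bd S.

Lemma psep_eq r r' p q : S r = S r' -> psep D S r p q -> psep D S r' p q.
Proof. by rewrite /psep => ->. Qed.

Lemma sep_sides x y r r' : D x -> D y -> D r -> D r' -> psep D S r x y -> psep D S r' x y ->
  ~ S r r' -> joined (D `&` ~` S r) r' x \/ joined (D `&` ~` S r) r' y.
Proof.
move=> Dx Dy Dr Dr' [nrx nry _] [nrx' nry' nj'] nrr.
have [xr|/joined_sym] := first_hit hT dD dS Dx Dr Dr' nrx nrx' nrr; last by left.
have [yr|/joined_sym] := first_hit hT dD dS Dy Dr Dr' nry nry' nrr; last by right.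
by case: nj'; apply: (joined_trans xr); exact: joined_sym.
Qed.

(** The order is decided by the side of the plaque of [r] on which [r'] lies: that of [x] or that of
    [y]. *)
Lemma sep_order x y r r' : D x -> D y -> D r -> D r' -> psep D S r x y -> psep D S r' x y ->
  ~ S r r' -> psep D S r x r' \/ psep D S r' x r.
Proof.
move=> Dx Dy Dr Dr' sr sr' nrr; have [nrx nry nj] := sr; have [nrx' nry' nj'] := sr'.
have nrr' : ~ S r' r by move=> h; apply: nrr; exact: (plaque_sym dS).
have [h|h] := sep_sides Dx Dy Dr Dr' sr sr' nrr.
  right; split=> // h'; have [yr|yr] := first_hit hT dD dS Dy Dr Dr' nry nry' nrr.
    by apply: nj'; apply: (joined_trans h'); exact: joined_sym.
  by apply: nj; apply: joined_sym; exact: (joined_trans yr).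
by left; split=> // h'; apply: nj; exact: joined_trans h' h.
Qed.

Lemma sep_between x y r r' t : D x -> D y -> D r -> D r' -> D t -> psep D S r x y ->
  psep D S r' x y -> psep D S t r r' -> psep D S t x y.
Proof.
move=> Dx Dy Dr Dr' Dt sr sr' st.
have nrr : ~ S r r'.
  by move=> rr; have [ntr _ nj] := st; apply: nj; exact: (plaque_joined dS).
have key u u' : D u -> D u' -> psep D S u' x y -> psep D S t u' u -> psep D S u x u' -> psep D S t x y.
  move=> Du Du' su' stu sxu.
  have [h _] := psep_trans hT dD dS Du Dt Du' Dx (psep_sym sxu) stu.
  by have [] := psep_trans hT dD dS Du' Dt Dx Dy su' (psep_sym h).
have [h|h] := sep_order Dx Dy Dr Dr' sr sr' nrr.
  exact: (key r r' Dr Dr' sr' (psep_sym st)).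
exact: (key r' r Dr' Dr sr st).
Qed.

(** Each term separates [x] from the preceding one, so the sequence moves strictly towards [x]. *)
Lemma sep_sequence x y : D x -> D y -> ~ S x y -> exists r : nat -> T,
  (forall n, D (r n) /\ psep D S (r n) x y) /\ (forall m n, m <> n -> ~ S (r m) (r n)).
Proof.
move=> Dx Dy nxy; pose next r r' := D r -> psep D S r x y -> D r' /\ psep D S r' x r.
have step r : {r' | next r r'}.
  apply: cid; have [Dr|] := pselect (D r); last by exists r.
  have [[nrx _ _]|] := pselect (psep D S r x y); last by exists r.
  have [|r' Dr' sr'] := psep_exists hT dD dS Dx Dr; last by exists r'.
  by move=> xr; apply: nrx; exact: (plaque_sym dS).
have [r0 Dr0 sr0] := psep_exists hT dD dS Dx Dy nxy.
have [r [r0E hr]] := dependent_choice step r0.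
have sr n : D (r n) /\ psep D S (r n) x y.
  elim: n => [|n [Dr sr]]; first by rewrite r0E.
  have [Dr' sr'] := hr n Dr sr; split=> //.
  by have [] := psep_trans hT dD dS Dr Dr' Dx Dy sr sr'.
have ord m k : psep D S (r (m + k.+1)%N) x (r m).
  elim: k => [|k IH].
    by rewrite addn1; have [Dr s1] := sr m; have [] := hr m Dr s1.
  have [Dr s1] := sr (m + k.+1)%N; have [Dr' s2] := hr _ Dr s1.
  by rewrite addnS; have [] := psep_trans hT dD dS Dr Dr' Dx (proj1 (sr m)) IH s2.
exists r; split=> // m n mn.
have [Drm _] := sr m; have [Drn _] := sr n.
have [lt|gt|//] := ltngtP m n.
  have := ord m (n - m).-1; rewrite prednK ?subn_gt0 // subnKC ?(ltnW lt) // => -[_ h _].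
  by move=> mn'; apply: h; exact: (plaque_sym dS).
by have := ord n (m - n).-1; rewrite prednK ?subn_gt0 // subnKC ?(ltnW gt) // => -[_ h _].
Qed.

End Order.

(** * An unstable continuum transverse to the separating plaques *)

Section UnstableArc.
Variables (R : realType) (M : metricType R).
Hypothesis kM : compact [set: M].
Variables (D bd : set M).
Hypothesis dD : is_disc D bd.
Variables S U : M -> set M.
Hypothesis dS : decomposition D bd S.
Hypothesis dU : decomposition D bd U.
Hypothesis nolens : forall x y, D x -> S x y -> U x y -> x = y.
Let hM : hausdorff_space M := @metric_hausdorff _ M.
Let clD : closed D := compact_closed hM (disc_cpt dD).

Lemma tends_plaque F Z z z0 w0 : UltraFilter F -> decomposition D bd Z ->
  tends F z z0 -> D w0 -> D z0 ->
  (forall t, 0 < t -> F [set n | D (z n) /\ exists2 v, Z (z n) v & mdist v w0 <= t]) -> Z z0 w0.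
Proof.
move=> UF dZ zz Dw0 Dz0 H; have PF : ProperFilter F := ultra_proper.
apply: contrapT => nzw.
have [t t0 ht] := open_has_mball (closed_openC (plaque_closed hM dZ Dz0)) nzw.
have t2 : 0 < t / 2 by rewrite divr_gt0.
have cF : closed ([set v | mdist v w0 <= t / 2] `&` D) by apply: closedI => //; exact: closed_mball.
have [|_ [v [zv [/= vw _]]]] := tends_closed UF (dec_usc dZ cF (@subIsetr _ _ _)) zz.
  apply: filterS (H _ t2) => n [Dz [v zv vw]]; split=> //; exists v; split=> //; split=> //.
  exact: (dec_sub dZ Dz).
by apply: (ht v) => //=; move: t0 vw; lra.
Qed.

(* Unless some unstable plaque meets two of infinitely many separating stable
   plaques, the far ends of these unstable plaques are separated from one
   another, and converge to the far end of a lens. *)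
Lemma unstable_arc x y C : D x -> D y -> ~ S x y -> continuum C -> C `<=` D `\` bd -> C x -> C y ->
  exists K a b, [/\ irreducible K a b, a <> b, D a, K `<=` U a &
    forall c, K c -> c <> a -> c <> b -> psep D S c x y].
Proof.
move=> Dx Dy nxy cC CD Cx Cy; have [r [hr rneq]] := sep_sequence hM dD dS Dx Dy nxy.
have stepz n : exists z, S (r n) z /\ C z.
  have [Dr [_ _ nj]] := hr n; apply: contrapT => no; apply: nj.
  apply: (joined_continuum cC) => // z Cz; have [Dz _] := CD z Cz; split=> // rz.
  by apply: no; exists z.
have [z hz] := choice stepz.
have Dz n : D (z n) by have [_ Cz] := hz n; case: (CD _ Cz).
have Szr n : S (z n) = S (r n) by apply: (dec_eq dS); [case: (hr n) | case: (hz n)].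
have [[n [w [zw [Dw sw] nrw]]]|H] := pselect (exists n w, [/\ U (z n) w, D w /\ psep D S w x y & ~ S (r n) w]).
  (* The interior points of [K] separate its two ends by [irreducible_separated] with the roles of
     [S] and [U] exchanged; both ends separate [x] from [y], and so does what lies between them. *)
  have [K irr KU] := irreducible_exists hM (dec_continuum dU (Dz n)) (dec_refl dU (Dz n)) zw.
  exists K, (z n), w; split=> //; first by move=> E; apply: nrw; rewrite -E; case: (hz n).
  move=> c Kc ca cb; have Dc : D c by apply: (dec_sub dU (Dz n)); exact: KU.
  apply: (sep_between hM dD dS Dx Dy (Dz n) Dw) => //.
    by apply: (psep_eq (esym (Szr n))); case: (hr n).
  apply: (irreducible_separated hM dD dU dS _ (Dz n) KU irr Kc ca cb).
  by move=> u v Du uv suv; exact: nolens.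
exfalso; have {}H n w : U (z n) w -> D w -> psep D S w x y -> S (r n) w.
  by move=> zw Dw sw; apply: contrapT => nrw; apply: H; exists n, w.
have stepw n : exists w, bd w /\ U (z n) w by have [b bb zb] := dec_bd dU (Dz n); exists b.
have [w hw] := choice stepw.
have Dw n : D (w n) by apply: (disc_bd_sub dD); case: (hw n).
have nrw n : ~ S (r n) (w n).
  move=> rw; have E : z n = w n by apply: nolens => //; [rewrite Szr | case: (hw n)].
  by have [_ /CD [_]] := hz n; apply; rewrite E; case: (hw n).
(* If [w n] were joined to [q], a plaque of some [t] would cut the joining continuum off from the
   plaque of [r n]. It would separate [x] from [y] and be met by the unstable plaque from [z n] to
   [w n], against [H]. *)
have side n q q' : D q -> D q' -> psep D S (r n) q q' ->
    (forall r', D r' -> psep D S r' q q' -> psep D S r' x y) -> ~ joined (D `&` ~` S (r n)) (w n) q.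
  move=> Dq Dq' sq toxy [Y [cY Yw Yq YO]]; have [Dr _] := hr n.
  have YD : Y `<=` D by move=> v /YO [].
  have clY : closed Y by apply: (compact_closed hM); case: cY.
  have nYr : ~ sat D S Y (r n) by move=> [_ [v [rv /YO [_]]]].
  have Ysat v : sat D S Y v -> S v `<=` sat D S Y by exact: (sat_saturated dS).
  have Y0 : sat D S Y !=set0 by exists q; apply: (sat_sub dS).
  have [t [Dt _ Ht]] := separating_plaque hM dD dS (sat_closed dS clY YD)
    (sat_connected dS (proj2 cY) YD) (@sat_D _ _ D S Y) Y0 Ysat Dr nYr.
  have tw := Ht _ (sat_sub dS YD Yw); have tq := Ht _ (sat_sub dS YD Yq).
  have [txy _] := psep_trans hM dD dS Dr Dt Dq Dq' sq tq.
  have [_ _ nj] := psep_plaque dS Dt Dr (psep_sym tw) (proj1 (hz n)).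
  apply: nj; apply: (joined_continuum (dec_continuum dU (Dz n))) => //.
  - exact: (dec_refl dU).
  - by case: (hw n).
  move=> v zv; have Dv := dec_sub dU (Dz n) zv; split=> // tv.
  have rv : S (r n) v.
    by apply: H => //; apply: (psep_eq (esym (dec_eq dS Dt tv))); exact: toxy.
  have [_ ntr _] := tw; apply: ntr.
  by rewrite -(dec_eq dS Dt tv) (dec_eq dS Dr rv); exact: (dec_refl dS).
have sidex n : ~ joined (D `&` ~` S (r n)) (w n) x by have [Dr s] := hr n; apply: (side n x y).
have sidey n : ~ joined (D `&` ~` S (r n)) (w n) y.
  by have [Dr s] := hr n; apply: (side n y x) => //; [exact: psep_sym | move=> r' _ /psep_sym].
(* By [H] the unstable plaque of [z m] avoids the plaque of [r n], so it leads from [w m] to the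
   plaque of [r m], which lies on the side of [x] or of [y]; [w n] is on neither side. *)
have apart m n : m <> n -> ~ joined (D `&` ~` S (r n)) (w n) (w m).
  move=> mn wnm; have [Drn sn] := hr n; have [Drm sm] := hr m.
  have nnm : ~ S (r n) (r m) by apply: rneq => E; apply: mn.
  have mz : joined (D `&` ~` S (r n)) (w m) (z m).
    apply: (joined_continuum (dec_continuum dU (Dz m))); [by case: (hw m) | exact: (dec_refl dU) |].
    move=> v zv; have Dv := dec_sub dU (Dz m) zv; split=> // nv.
    have mv : S (r m) v by apply: H => //; exact: (psep_eq (esym (dec_eq dS Drn nv))).
    by apply: (plaque_disjoint dS Drn Drm nnm nv).
  have zr : joined (D `&` ~` S (r n)) (z m) (r m).
    by apply: joined_sym; apply: (plaque_joined dS) => //; case: (hz m).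
  have wr := joined_trans wnm (joined_trans mz zr).
  have [h|h] := sep_sides hM dD dS Dx Dy Drn Drm sn sm nnm.
    by apply: (sidex n); exact: joined_trans wr h.
  by apply: (sidey n); exact: joined_trans wr h.
have [F [UF Foo]] := ultra_infinity; have PF : ProperFilter F := ultra_proper.
have [z0 zz] := tends_exists kM UF z; have [w0 ww] := tends_exists kM UF w.
have Cz0 : C z0.
  apply: (tends_closed UF _ zz); first by apply: (compact_closed hM); case: cC.
  by apply: filterE => n; case: (hz n).
have bw0 : bd w0 by apply: (tends_closed UF (disc_bd_closed dD) ww); apply: filterE => n; case: (hw n).
have Dw0 := disc_bd_sub dD bw0; have [Dz0 nbz0] := CD z0 Cz0.
apply: nbz0; rewrite (_ : z0 = w0) //; apply: nolens => //.
  (* Close to [w0] a small continuum joins [w n] to a later [w m]; by [apart] it meets the stable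
     plaque of [r n], which is that of [z n]. *)
  apply: (tends_plaque UF dS zz Dw0 Dz0) => t t0.
  have [|Q [V [cQ QO oV Vw VQ]]] := disc_lc dD Dw0 (open_mball w0 t); first by rewrite /= mdistxx.
  have [v v0 hv] := open_has_mball oV Vw.
  apply: filterS (ww _ v0) => n /= wn; split=> //; apply: contrapT => no.
  have [m nm /= wm] := ultra_ex UF Foo n.+1 (ww _ v0).
  apply: (@apart m n); first by move=> E; move: nm; rewrite E ltnn.
  apply: (joined_continuum cQ); [by apply: VQ; split=> //; exact: hv | by apply: VQ; split=> //; exact: hv |].
  move=> q Qq; have [/= qw Dq] := QO q Qq; split=> // rq; apply: no.
  by exists q; [rewrite Szr | exact: ltW].
apply: (tends_plaque UF dU zz Dw0 Dz0) => t t0; apply: filterS (ww _ t0) => n /= wn; split=> //.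
by exists (w n); [case: (hw n) | exact: ltW].
Qed.

End UnstableArc.

(** * Separation in discs of different sizes *)

Section Propagation.
Variables (R : realType) (M : metricType R).
Hypothesis kM : compact [set: M].
Hypothesis discs : forall (x : M) O, open O -> O x ->
  exists D bd, [/\ is_disc D bd, D `<=` O & (D `\` bd) x].
Variables (f g : M -> M) (e : R).
Hypothesis sys : system f g e.
Let hM : hausdorff_space M := @metric_hausdorff _ M.
Let cf := sys_fc sys.
Let cg := sys_gc sys.
Let fK := sys_fK sys.
Let gK := sys_gK sys.
Let e0 := sys_e0 sys.

Lemma closed_point (x : M) : closed [set x].
Proof. by apply: (compact_closed hM); exact: compact_set1. Qed.

Lemma near_end K O (a b : M) : connected K -> K a -> K b -> a <> b -> open O -> O a ->
  exists c, [/\ K c, O c, c <> a & c <> b].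
Proof.
move=> nK Ka Kb ab oO Oa.
have oA : open (O `&` ~` [set b]) by apply: openI => //; apply: closed_openC; exact: closed_point.
have := connected_open_meet nK oA (closed_openC (@closed_point a)).
case=> [c Kc|||c [[Kc [Oc cb]] ca]].
- by have [->|ca] := pselect (c = a); [left | right].
- by exists a.
- by exists b; split=> // ba; apply: ab; rewrite ba.
by exists c.
Qed.

Lemma interior_dense K O (a b z : M) : connected K -> K a -> K b -> a <> b -> open O -> K z -> O z ->
  exists c, [/\ K c, O c, c <> a & c <> b].
Proof.
move=> nK Ka Kb ab oO Kz Oz.
have [E|za] := pselect (z = a); first by apply: near_end => //; rewrite -E.
have [E|zb] := pselect (z = b); last by exists z.
have [||c [Kc Oc cb ca]] := near_end nK Kb Ka _ oO; last by exists c.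
  by move=> ba; apply: ab.
by rewrite -E.
Qed.

Lemma irreducible_image n K (a b : M) : irreducible K a b ->
  irreducible (iter n f @` K) (iter n f a) (iter n f b).
Proof.
move=> [cK Ka Kb minK].
have cfn := @iter_cont _ _ f n cf; have cgn := @iter_cont _ _ g n cg.
split; [exact: image_continuum' | by exists a | by exists b |].
move=> C cC Ca Cb CK; rewrite -(minK (iter n g @` C)).
- rewrite image_comp; apply/seteqP; split=> z.
    by move=> Cz; exists z => //=; rewrite (iter_K n gK).
  by move=> [w Cw /= <-]; rewrite (iter_K n gK).
- exact: image_continuum'.
- by exists (iter n f a) => //; rewrite iter_K.
- by exists (iter n f b) => //; rewrite iter_K.
- by move=> _ [w /CK [z Kz <-] <-]; rewrite iter_K.
Qed.

Notation plq := (plaque f e).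

Lemma plaque_meets D bd c x y C : good f g e D bd -> psep D (plq D) c x y ->
  continuum C -> C `<=` D -> C x -> C y -> exists2 t, C t & plq D c t.
Proof.
move=> gD [_ _ nj] cC CD Cx Cy; apply: contrapT => no; apply: nj.
apply: (joined_continuum cC) => // z Cz; split; first exact: CD.
by move=> cz; apply: no; exists z.
Qed.

(* If [x] and [y] were joined off the larger plaque of [c], this plaque would cut
   off from both of them some other plaque through [K]; without hairpins the
   cut is made by the small plaque of [c], on one side of which both would lie. *)
Lemma grow D bd D' bd' C K a b x y : good f g e D bd -> good f g e D' bd' -> D `<=` D' ->
  continuum C -> C `<=` D -> C x -> C y ->
  (forall c t t', C t -> C t' -> D' c -> plq D' c t -> plq D' c t' -> plq D t t') ->
  irreducible K a b -> a <> b -> K `<=` D -> fwd g e K ->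
  (forall c, K c -> c <> a -> c <> b -> psep D (plq D) c x y) ->
  forall c, K c -> c <> a -> c <> b -> psep D' (plq D') c x y.
Proof.
move=> gD gD' DD' cC CD Cx Cy hp irr ab KD gK' sepK c Kc ca cb.
have [cK Ka Kb _] := irr; have Dc := KD c Kc; have D'c := DD' c Dc.
have [dD dS fS dU fU] := gD; have [dD' dS' fS' dU' fU'] := gD'.
have Dx := CD x Cx; have Dy := CD y Cy.
have clD : closed D := compact_closed hM (disc_cpt dD).
have incl z : D z -> plq D z `<=` plq D' z.
  move=> Dz; apply: (plaque_max (dec_continuum dS Dz) (fS z Dz) (dec_refl dS Dz)).
  by apply: subset_trans DD'; exact: (dec_sub dS).
have [t2 Ct2 ct2] := plaque_meets gD (sepK c Kc ca cb) cC CD Cx Cy.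
have strand t : C t -> plq D' c t -> plq D c t.
  move=> Ct ct; rewrite -(dec_eq dS Dc ct2); apply: (hp c) => //.
  exact: incl.
have [ncx ncy _] := sepK c Kc ca cb.
have n'x : ~ plq D' c x by move=> /(strand x Cx).
have n'y : ~ plq D' c y by move=> /(strand y Cy).
split=> // xy.
have sab : psep D' (plq D') c a b.
  apply: (irreducible_separated hM dD' dU' dS' _ (DD' a (KD a Ka)) _ irr Kc ca cb).
    by move=> u v Du uv vu; exact: (good_nolens kM discs sys gD').
  apply: (plaque_max cK gK' Ka); exact: subset_trans KD DD'.
have [nca ncb nab] := sab.
have [c1 [Kc1 c1a c1b nc1 nc1x]] : exists c1, [/\ K c1, c1 <> a, c1 <> b, ~ plq D' c c1 &
    ~ joined (D' `&` ~` plq D' c) c1 x].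
  have key k k' : K k -> K k' -> k <> k' -> ~ plq D' c k -> ~ joined (D' `&` ~` plq D' c) k x ->
      exists c1, [/\ K c1, c1 <> k, c1 <> k', ~ plq D' c c1 & ~ joined (D' `&` ~` plq D' c) c1 x].
    move=> Kk Kk' kk' nck nkx.
    have [V [oV Vk HV]] := joined_open (disc_lc dD') (closed_openC (plaque_closed hM dS' D'c)) (DD' k (KD k Kk)) nck.
    have [c1 [Kc1 Vc1 c1k c1k']] := near_end (proj2 cK) Kk Kk' kk' oV Vk.
    have kc1 := HV c1 Vc1 (DD' _ (KD _ Kc1)).
    exists c1; split=> //; first by have [_ []] := joined_mem kc1.
    by move=> c1x; apply: nkx; exact: joined_trans kc1 c1x.
  have [ax|nax] := pselect (joined (D' `&` ~` plq D' c) a x); last exact: key.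
  have ba : b <> a by move=> E; apply: ab.
  have nbx : ~ joined (D' `&` ~` plq D' c) b x.
    by move=> bx; apply: nab; apply: (joined_trans ax); exact: joined_sym.
  by have [c1 [? ? ? ? ?]] := key b a Kb Ka ba ncb nbx; exists c1.
have Dc1 := KD c1 Kc1; have D'c1 := DD' c1 Dc1.
have [t1 Ct1 ct1] := plaque_meets gD (sepK c1 Kc1 c1a c1b) cC CD Cx Cy.
have Dt1 := CD t1 Ct1.
have nct1 : ~ plq D' c t1.
  move=> h; apply: (plaque_disjoint dS' D'c D'c1 nc1 h); exact: incl.
have c1t1 : joined (D' `&` ~` plq D' c) c1 t1 by apply: (plaque_joined dS') => //; exact: incl.
have nt1 q : q = x \/ q = y -> ~ joined (D' `&` ~` plq D' c) q t1.
  move=> qxy qt; apply: nc1x; apply: (joined_trans c1t1); apply: joined_sym.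
  by case: qxy qt => ->; [|move=> qt; exact: joined_trans xy qt].
have sepq q : q = x \/ q = y -> ~ joined (D `&` ~` plq D c) q t1.
  move=> qxy; have Cq : C q by case: qxy => ->.
  have n'q : ~ plq D' c q by case: qxy => ->.
  have cX : closed (D `&` plq D' c) by apply: closedI => //; exact: (plaque_closed hM dS').
  have [|||s [Ds cs] ns] := @separating_component _ _ hM D (disc_cpt dD) (disc_lc dD) (disc_conn dD) (disc_unicoh dD)
    _ q t1 cX (@subIsetl _ _ _) (CD q Cq) Dt1.
  - by move=> [].
  - by move=> [].
  - move=> [Y [cY Yq Yt YO]]; apply: (nt1 q qxy); exists Y; split=> // z /YO [Dz nz].
    by split; [exact: DD' | move=> cz; apply: nz].
  set W := connected_component _ s in ns.
  have WX : W `<=` D `&` plq D' c by exact: connected_component_sub.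
  have cW : continuum W.
    by apply: component_continuum => //; apply: (subclosed_compact cX (disc_cpt dD)) => z [].
  have [t [Ct Wt]] : exists t, C t /\ W t.
    apply: contrapT => no; apply: ns; apply: (joined_continuum cC) => // z Cz.
    by split; [exact: CD | move=> Wz; apply: no; exists z].
  have ct : plq D c t by apply: strand => //; case: (WX t Wt).
  have Wc : W `<=` plq D c.
    rewrite -(dec_eq dS Dc ct); apply: (plaque_max cW) => //; last by move=> z /WX [].
    by apply: fwd_sub (fS' c D'c) => z /WX [].
  move=> qt; apply: ns; apply: joined_sub qt => z [Dz nz]; split=> // /Wc; exact: nz.
have nDc1 : ~ plq D c c1 by move=> /(incl c Dc).
have c1t1D : joined (D `&` ~` plq D c) c1 t1 by exact: (plaque_joined dS).
have [h|h] := sep_sides hM dD dS Dx Dy Dc Dc1 (sepK c Kc ca cb) (sepK c1 Kc1 c1a c1b) nDc1.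
  by apply: (sepq x); [left | exact: joined_trans (joined_sym h) c1t1D].
by apply: (sepq y); [right | exact: joined_trans (joined_sym h) c1t1D].
Qed.

(** The preimage under [g] of the plaque of [c] separates [f x] from [f y] in [D], hence by
    [separating_component] one component of it does. This component meets [C], and by the hypothesis
    on strands it does so in the plaque of [f c], which therefore contains it and separates. *)
Lemma shrink D bd D' bd' C c x y : good f g e D bd -> good f g e D' bd' -> bounded_by e D' ->
  (forall w, D w -> D' (g w)) -> continuum C -> C `<=` D -> C (f x) -> C (f y) ->
  D' c -> D (f c) ->
  (forall t, C t -> plq D' c (g t) -> plq D (f c) t) ->
  psep D' (plq D') c x y -> psep D (plq D) (f c) (f x) (f y).
Proof.
move=> gD gD' bD' gDD' cC CD Cx Cy D'c Dfc hp [ncx ncy nj].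
have [dD dS fS dU fU] := gD; have [dD' dS' fS' dU' fU'] := gD'.
have Dx := CD _ Cx; have Dy := CD _ Cy.
have clD : closed D := compact_closed hM (disc_cpt dD).
have back w : plq D (f c) w -> plq D' c (g w).
  move=> cw; have cI : continuum (g @` plq D (f c)).
    by apply: image_continuum' => //; exact: (dec_continuum dS).
  have SD := dec_sub dS Dfc.
  apply: (plaque_max cI); last by exists w.
  - move=> [|n] _ _ [u cu <-] [v cv <-]; first by apply: bD'; apply: gDD'; exact: SD.
    by rewrite !iterSr !gK; exact: (fS _ Dfc).
  - by exists (f c); [exact: (dec_refl dS) | rewrite fK].
  - by move=> _ [u cu <-]; apply: gDD'; exact: SD.
have nx : ~ plq D (f c) (f x) by move=> /back; rewrite fK.
have ny : ~ plq D (f c) (f y) by move=> /back; rewrite fK.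
split=> //.
have cX : closed (D `&` g @^-1` plq D' c).
  by apply: closedI => //; apply: ((continuous_closedP _).1 cg); exact: (plaque_closed hM dS').
have [|||s [Ds cs] ns] := @separating_component _ _ hM D (disc_cpt dD) (disc_lc dD) (disc_conn dD) (disc_unicoh dD)
    _ (f x) (f y) cX (@subIsetl _ _ _) Dx Dy.
- by move=> [_] /=; rewrite fK.
- by move=> [_] /=; rewrite fK.
- move=> [Y [cY Yx Yy YO]]; apply: nj; exists (g @` Y); split.
  + exact: image_continuum'.
  + by exists (f x) => //; rewrite fK.
  + by exists (f y) => //; rewrite fK.
  + by move=> _ [z /YO [Dz nz] <-]; split; [exact: gDD' | move=> cz; apply: nz].
set W := connected_component _ s in ns.
have WX : W `<=` D `&` g @^-1` plq D' c by exact: connected_component_sub.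
have cW : continuum W.
  by apply: component_continuum => //; apply: (subclosed_compact cX (disc_cpt dD)) => z [].
have [t [Ct Wt]] : exists t, C t /\ W t.
  apply: contrapT => no; apply: ns; apply: (joined_continuum cC) => // z Cz.
  by split; [exact: CD | move=> Wz; apply: no; exists z].
have ct : plq D (f c) t by apply: hp => //; case: (WX t Wt).
have Wc : W `<=` plq D (f c).
  rewrite -(dec_eq dS Dfc ct); apply: (plaque_max cW) => //; last by move=> z /WX [].
  move=> n u v /WX [_ /= cu] /WX [_ /= cv].
  by have := fS' c D'c n.+1 _ _ cu cv; rewrite !iterSr !gK.
move=> qt; apply: ns; apply: joined_sub qt => z [Dz nz]; split=> // /Wc; exact: nz.
Qed.

End Propagation.

Lemma pos_min (R : realDomainType) (s : seq R) : all (fun z => 0 < z) s ->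
  exists2 m, 0 < m & all (fun z => m <= z) s.
Proof.
elim: s => [_|z s IH /= /andP [z0 /IH [m m0 hm]]]; first by exists 1; rewrite ?ltr01.
exists (Num.min z m); first by rewrite lt_min z0.
rewrite ge_min lexx /=; apply: sub_all hm => w mw.
by apply: le_trans mw; rewrite ge_min lexx orbT.
Qed.

Lemma le_half_lt (R : realFieldType) (x c : R) : 0 < c -> x <= c / 2 -> x < c.
Proof. lra. Qed.

Lemma le_four (R : realFieldType) (x : R) : 0 < x -> x <= 4 * x.
Proof. lra. Qed.

Lemma triangle_le (R : realType) (M : metricType R) (x y z : M) (a c : R) :
  mdist x y <= a -> mdist y z <= a -> a <= c / 2 -> mdist x z <= c.
Proof. by have := metric_triangle x y z; lra. Qed.

Lemma triangle_lt (R : realType) (M : metricType R) (x y z : M) (a b c : R) :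
  mdist x y <= a -> mdist y z < b -> a <= c / 2 -> b <= c / 2 -> mdist x z < c.
Proof. by have := metric_triangle x y z; lra. Qed.

(** * Points with close forward orbits *)

Section Forward.
Variables (R : realType) (M : metricType R).
Hypothesis kM : compact [set: M].
Hypothesis discs : forall (x : M) O, open O -> O x ->
  exists D bd, [/\ is_disc D bd, D `<=` O & (D `\` bd) x].
Variables (f g : M -> M) (e : R).
Hypothesis sys : system f g e.
Let cf := sys_fc sys.
Let cg := sys_gc sys.
Let fK := sys_fK sys.
Let gK := sys_gK sys.
Let e0 := sys_e0 sys.

Local Notation plq := (plaque f e).

Definition hairpin_scale (k r s : R) := forall C a b, continuum C -> fwd f e C ->
  bounded_by k C -> C a -> C b -> mdist a b < s ->
  exists C', [/\ continuum C', C' a, C' b, C' `<=` C & bounded_by r C'].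

(** Without hairpins the two close points are joined within the plaque of [D'] by a continuum so
    small that it lies in [D]. *)
Lemma same_strand k s h t0 D bd D' bd' p c t t' : good f g e D bd -> good f g e D' bd' ->
  bounded_by k D' -> [set w | mdist w p < s] `<=` D -> hairpin_scale k (s / 2) h ->
  t0 <= s / 2 -> t0 <= h / 2 -> mdist t p < t0 -> mdist t' p < t0 -> D' c ->
  plq D' c t -> plq D' c t' -> plq D t t'.
Proof.
move=> gD gD' bD' BD hh ts th tp t'p D'c ct ct'.
have [dD' dS' fS' dU' fU'] := gD'.
have [||C' [cC' C't C't' C'c bC']] := hh _ t t' (dec_continuum dS' D'c) (fS' c D'c) _ ct ct'.
- by move=> u v cu cv; apply: bD'; exact: (dec_sub dS' D'c).
- by have := metric_triangle t p t'; rewrite (metric_sym p t'); lra.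
apply: (plaque_max cC' (fwd_sub C'c (fS' c D'c)) C't) => // w C'w; apply: BD => /=.
by have := bC' w t C'w C't; have := metric_triangle w t p; lra.
Qed.

Lemma forward_close r : 0 < r -> exists2 d, 0 < d & forall x y,
  (forall n, mdist (iter n f x) (iter n f y) <= d) ->
  exists C, [/\ continuum C, C x, C y, fwd f e C & forall w, C w -> mdist w x < r].
Proof.
move=> r0.
(* The constants go from large to small. Discs [E1] fit in radius [R1] and contain radius [r1];
   discs [E2] (radii [R2], [r2]) lie in the [E1] of the same centre, and along the orbit [g] maps
   each into the previous [E1]. [sig] bounds the distance of the iterates of [K] from the orbit of
   [x], [D'] (radii [R3], [r3]) is the initial disc, and [d1] is the size of the continua joining
   the two orbits. [hG], [hS] and [hB] are the distances below which hairpins are excluded in the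
   inductive use of [grow], in [shrink] and in the initial use of [grow]. *)
have [rho rho0 gu] := good_uniform kM discs sys.
have [k k0 nh] := no_hairpin kM discs sys.
have half (z : R) : 0 < z -> 0 < z / 2 by move=> z0; rewrite divr_gt0.
have [R1 R10 /and4P [R1rho R1k R1e _]] : exists2 m, 0 < m & all (fun z => m <= z) [:: rho; k / 2; e / 2].
  by apply: pos_min; rewrite /= rho0 !half.
have [r1 r10 h1] := gu R1 R10 R1rho.
have [sg sg0 hsg] := iter_modulus kM 1 cg r10.
have [R2 R20 /and5P [R2rho R2r1 R2sg R2R1 _]] : exists2 m, 0 < m & all (fun z => m <= z) [:: rho; r1; sg; R1].
  by apply: pos_min; rewrite /= rho0 r10 sg0 R10.
have [r2 r20 h2] := gu R2 R20 R2rho.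
have [hG hG0 specG] := nh _ (half _ r20).
have [sf sf0 hsf] := iter_modulus kM 1 cf (half _ r20).
have [hS hS0 specS] := nh _ (half _ sf0).
have [sig sig0 /and4P [sigr2 sighS sige _]] : exists2 m, 0 < m & all (fun z => m <= z) [:: r2 / 2; hS / 2; e / 2].
  by apply: pos_min; rewrite /= !half.
have [N0 hN0] := fwd_contraction kM sys (half _ sig0).
(* Positive, so that [n - N] is smaller than [n] in [drift]. *)
pose N := N0.+1.
have [sN sN0 hsN] := iter_modulus kM N cf sig0.
have [R3 R30 /and5P [R3rho R3r R3r2 R3sN _]] : exists2 m, 0 < m & all (fun z => m <= z) [:: rho; r; r2; sN].
  by apply: pos_min; rewrite /= rho0 r0 r20 sN0.
have [r3 r30 h3] := gu R3 R30 R3rho.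
have [hB hB0 specB] := nh _ (half _ r30).
have [sN2 sN20 hsN2] := iter_modulus kM N cf (half _ sig0).
have [sg2 sg20 hsg2] := iter_modulus kM 1 cg (half _ hS0).
have [d1 d10 /andP [d1hG /and5P [d1r2 d1sg2 d1r3 d1hB /andP [d1sN2 _]]]] :
    exists2 m, 0 < m & all (fun z => m <= z) [:: hG / 2; r2 / 2; sg2; r3 / 2; hB / 2; sN2].
  by apply: pos_min; rewrite /= !half ?sg20 ?sN20.
have [d2 d20 hd2] := uniform_disc kM discs d10.
exists (d2 / 2); first exact: half.
move=> x y xy.
have [D' [bd' [gD' BD' DB']]] := h3 x.
have [dD' dS' fS' dU' fU'] := gD'.
have D'x : D' x by case: (BD' x); rewrite /= ?mdistxx.
have [Sxy|nSxy] := pselect (plq D' x y).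
  exists (plq D' x); split=> //; [exact: (dec_continuum dS') | exact: (dec_refl dS') | exact: fS' |].
  by move=> w /(dec_sub dS' D'x) /DB' /= h; apply: lt_le_trans h R3r.
exfalso.
have step0 (p : M) : exists C, [/\ continuum C, C p, forall q, mdist q p <= d2 / 2 -> C q &
    forall w, C w -> mdist w p < d1].
  have [C [bC [dC BC CB]]] := hd2 p; exists C; split=> //.
  - by split; [exact: (disc_cpt dC) | exact: (disc_conn dC)].
  - by case: (BC p); rewrite /= ?mdistxx.
  - by move=> q qp; case: (BC q) => //=; exact: le_half_lt d20 qp.
have [G hGm] := choice step0.
have step1 (p : M) : exists q : set M * set M, [/\ good f g e q.1 q.2, [set w | mdist w p < r1] `<=` q.1 `\` q.2 &
    q.1 `<=` [set w | mdist w p < R1]] by have [A [B H]] := h1 p; exists (A, B).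
have [E1 hE1] := choice step1.
have step2 (p : M) : exists q : set M * set M, [/\ good f g e q.1 q.2, [set w | mdist w p < r2] `<=` q.1 `\` q.2 &
    q.1 `<=` [set w | mdist w p < R2]] by have [A [B H]] := h2 p; exists (A, B).
have [E2 hE2] := choice step2.
pose X n := iter n f x; pose Y n := iter n f y.
have GY n : G (X n) (Y n) by have [_ _ h _] := hGm (X n); apply: h; rewrite metric_sym; exact: xy.
have GX n : G (X n) (X n) by case: (hGm (X n)).
have cG n : continuum (G (X n)) by case: (hGm (X n)).
have Gd n w : G (X n) w -> mdist w (X n) < d1 by case: (hGm (X n)) => _ _ _; apply.
have G2 n : G (X n) `<=` (E2 (X n)).1.
  move=> w /Gd wd; have [_ B _] := hE2 (X n); case: (B w) => //=.
  exact: le_half_lt r20 (le_trans (ltW wd) d1r2).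
have GD' : G (X 0%N) `<=` D' `\` bd'.
  by move=> w /Gd wd; apply: BD' => /=; exact: le_half_lt r30 (le_trans (ltW wd) d1r3).
have D'y : D' y by case: (GD' (Y 0%N) (GY 0%N)).
have [K [a [b [irr ab D'a KU sepK]]]] := unstable_arc kM dD' dS' dU' (good_nolens kM discs sys gD')
  D'x D'y nSxy (cG 0%N) GD' (GX 0%N) (GY 0%N).
have [cK Ka Kb _] := irr.
have KD' : K `<=` D' by apply: subset_trans KU _; exact: (dec_sub dU').
have fgK : fwd g e K by apply: fwd_sub KU _; exact: fU'.
have e4 : e <= 4 * e by exact: le_four.
have bdd (A : set M) p c q : A `<=` [set w | mdist w p < c] -> c <= q / 2 -> bounded_by q A.
  move=> Ap cq u v /Ap /= /ltW up /Ap /= /ltW vp; rewrite metric_sym in vp.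
  exact: triangle_le up vp cq.
(* The ends of [K] are left out, since their plaques are not given to separate at time 0; [drift]
   reaches them by density. *)
pose P n := forall c, K c -> c <> a -> c <> b -> (E2 (X n)).1 (iter n f c) /\
  psep (E2 (X n)).1 (plq (E2 (X n)).1) (iter n f c) (X n) (Y n).
(* For [n] beyond [N], the separating plaque at time [n - N] meets the small continuum joining the
   orbits there; in [N] more steps the plaque contracts and the continuum stays small. Up to time
   [N] continuity is enough. *)
have drift n : (forall m, (m < n)%N -> P m) -> forall c, K c -> mdist (iter n f c) (X n) <= sig.
  move=> Pm; have inner c : K c -> c <> a -> c <> b -> mdist (iter n f c) (X n) <= sig.
    move=> Kc ca cb; apply: ltW; have [nN|Nn] := leqP n N.
      by apply: hsN => //; have /= h := DB' c (KD' c Kc); exact: lt_le_trans h R3sN.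
    pose m := (n - N)%N; have mn : (m < n)%N by rewrite ltn_subrL /= (leq_ltn_trans _ Nn).
    have nE z : iter n f z = iter N f (iter m f z) by rewrite -iterD subnKC // ltnW.
    have [gE _ _] := hE2 (X m); have [Ecm sm] := Pm m mn c Kc ca cb.
    have [t Gt ct] := plaque_meets gE sm (cG m) (@G2 m) (GX m) (GY m).
    have [dE dSE fSE _ _] := gE.
    have h4 := hN0 _ (dec_continuum dSE Ecm) (fwd_le e4 (fSE _ Ecm)) N _ _ (leqnSn _) (dec_refl dSE Ecm) ct.
    have h5 : mdist (iter N f t) (iter N f (X m)) < sig / 2.
      by apply: hsN2 => //; apply: lt_le_trans (Gd m t Gt) d1sN2.
    rewrite /X !nE; exact: triangle_lt (ltW h4) h5 (lexx _) (lexx _).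
  move=> z Kz; rewrite leNgt; apply/negP => zn.
  have oO : open [set w | sig < mdist (iter n f w) (X n)].
    rewrite (_ : [set w | _] = iter n f @^-1` ~` [set w | mdist w (X n) <= sig]).
      apply: open_comp; first by move=> w _; exact: iter_cont.
      by apply: closed_openC; exact: closed_mball.
    by apply/seteqP; split=> w /=; rewrite ltNge => /negP.
  have [c [Kc /= Oc ca cb]] := interior_dense (proj2 cK) Ka Kb ab oO Kz zn.
  by move: Oc; rewrite ltNge inner.
have KE n c : (forall m, (m < n)%N -> P m) -> K c -> (E2 (X n)).1 (iter n f c).
  move=> Pm Kc; have [_ B _] := hE2 (X n); case: (B (iter n f c)) => //=.
  exact: le_half_lt r20 (le_trans (drift n Pm c Kc) sigr2).
have bE2 n : bounded_by k (E2 (X n)).1.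
  by have [_ _ B] := hE2 (X n); apply: bdd B _; exact: le_trans R2R1 R1k.
have bE1 n : bounded_by k (E1 (X n)).1 by have [_ _ B] := hE1 (X n); exact: bdd B R1k.
have bE1e n : bounded_by e (E1 (X n)).1 by have [_ _ B] := hE1 (X n); exact: bdd B R1e.
have E21 n : (E2 (X n)).1 `<=` (E1 (X n)).1.
  have [_ _ B2] := hE2 (X n); have [_ B1 _] := hE1 (X n).
  by move=> w /B2 /= wd; case: (B1 w) => //=; exact: lt_le_trans wd R2r1.
have B2' n : [set w | mdist w (X n) < r2] `<=` (E2 (X n)).1.
  by move=> w; have [_ B _] := hE2 (X n) => /B [].
(* At time 0 [grow] passes from [D'] to [E2]. In the step, [grow] passes from [E2] to [E1] around
   [X n], and [shrink] from there to [E2] around [X n.+1]. *)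
have allP n : P n.
  elim/ltn_ind: n => -[_|n IH].
    move=> c Kc ca cb; split; first exact: KE.
    have [gE _ _] := hE2 (X 0%N).
    apply: (grow kM discs sys gD' gE _ (cG 0%N) _ (GX 0%N) (GY 0%N) _ irr ab KD' fgK sepK) => //.
    - by move=> w /DB' /= wd; apply: (B2' 0%N) => /=; exact: lt_le_trans wd R3r2.
    - by move=> w /GD' [].
    - move=> c' t t' Gt Gt' Ec' ct ct'.
      apply: (same_strand gD' gE (bE2 0%N) _ specB d1r3 d1hB (Gd 0%N t Gt) (Gd 0%N t' Gt') Ec' ct ct').
      by move=> w /BD' [].
  have IH' m : (m < n)%N -> P m by move=> mn; apply: IH; exact: ltnW.
  have [g1 _ _] := hE1 (X n); have [g2 _ _] := hE2 (X n).
  have irrn := irreducible_image sys n irr.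
  have injn z w : iter n f z = iter n f w -> z = w.
    by move=> E; rewrite -(iter_K n fK z) E iter_K.
  have abn : iter n f a <> iter n f b by move/injn.
  have KnE : iter n f @` K `<=` (E2 (X n)).1 by move=> _ [z Kz <-]; exact: KE.
  have fgKn : fwd g e (iter n f @` K).
    move=> j _ _ [u Ku <-] [v Kv <-]; have [jn|/ltnW nj] := leqP j n.
      rewrite !(iter_cancel _ fK) //.
      have Pj m : (m < n - j)%N -> P m.
        by move=> h; apply: IH'; apply: leq_trans h _; exact: leq_subr.
      have hu := drift _ Pj u Ku; have hv := drift _ Pj v Kv.
      by rewrite metric_sym in hv; exact: triangle_le hu hv sige.
    by rewrite -(subnK nj) !iterD !(iter_K n fK); exact: fgK.
  have sepn z : (iter n f @` K) z -> z <> iter n f a -> z <> iter n f b ->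
      psep (E2 (X n)).1 (plq (E2 (X n)).1) z (X n) (Y n).
    move=> [c Kc <-] ca cb.
    have ca' : c <> a by move=> E; apply: ca; rewrite E.
    have cb' : c <> b by move=> E; apply: cb; rewrite E.
    by have [] := IH n (leqnn _) c Kc ca' cb'.
  move=> c Kc ca cb; split; first by apply: KE => // m; rewrite ltnS => mn; apply: IH.
  have Knc : (iter n f @` K) (iter n f c) by exists c.
  have sep1 : psep (E1 (X n)).1 (plq (E1 (X n)).1) (iter n f c) (X n) (Y n).
    apply: (grow kM discs sys g2 g1 (@E21 n) (cG n) (@G2 n) (GX n) (GY n) _ irrn abn KnE fgKn sepn Knc).
    - move=> c' t t' Gt Gt' Ec' ct ct'.
      exact: (same_strand g2 g1 (bE1 n) (@B2' n) specG d1r2 d1hG (Gd n t Gt) (Gd n t' Gt') Ec' ct ct').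
    - by move/injn.
    - by move/injn.
  have [g3 _ B3] := hE2 (X n.+1).
  have Dfc : (E2 (X n.+1)).1 (f (iter n f c)) by apply: (KE n.+1) => // m; rewrite ltnS => mn; apply: IH.
  have gfX : g (X n.+1) = X n by rewrite /X iterS fK.
  have En : (E1 (X n)).1 (iter n f c) by apply: E21; exact: KE.
  apply: (shrink sys g3 g1 (bE1e n) _ (cG n.+1) (@G2 n.+1) (GX n.+1) (GY n.+1) En Dfc _ sep1).
    move=> w /B3 /= wd; have [_ B1 _] := hE1 (X n); case: (B1 (g w)) => //=.
    by rewrite -gfX; apply: (hsg 1%N) => //; exact: lt_le_trans wd R2sg.
  move=> t Gt ct; have td := Gd _ t Gt.
  have gt : mdist (g t) (X n) < hS / 2 by rewrite -gfX; apply: (hsg2 1%N) => //; exact: lt_le_trans td d1sg2.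
  have cX := drift n IH' c Kc.
  have [dE dSE fSE _ _] := g1.
  have [||C' [cC' C'c C't C'sub bC']] := specS _ (iter n f c) (g t) (dec_continuum dSE En) (fSE _ En) _ (dec_refl dSE En) ct.
  - by move=> u v cu cv; apply: (bE1 n); exact: (dec_sub dSE En).
  - by rewrite metric_sym in gt; exact: triangle_lt cX gt sighS (lexx _).
  have cfC : continuum (f @` C') by exact: image_continuum'.
  apply: (plaque_max cfC).
  - have := @fwd_image _ _ f e C' 1%N; apply; exact: fwd_sub (fSE _ En).
  - by exists (iter n f c).
  - move=> _ [u C'u <-]; apply: B2' => /=.
    have h5 : mdist (iter 1 f u) (iter 1 f (g t)) < r2 / 2.
      by apply: hsf => //; exact: le_half_lt sf0 (bC' u (g t) C'u C't).
    by move: h5; rewrite /= gK => h5; exact: triangle_lt (ltW h5) td (lexx _) d1r2.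
  - by exists (g t); rewrite ?gK.
apply: ab; apply: (bounded_orbit_trivial sys cK) => //; last exact: (fwd_le e4).
move=> n u v Ku Kv; have hu := drift n (fun m _ => allP m) u Ku; have hv := drift n (fun m _ => allP m) v Kv.
by rewrite metric_sym in hv; exact: le_trans (triangle_le hu hv sige) e4.
Qed.

End Forward.

Local Open Scope card_scope.

(** * From close orbits to expansivity *)

Section Expansive.
Variables (R : realType) (M : metricType R) (f : homeo M).

Lemma iter_homeo_continuous (n : nat) : continuous (iter n f).
Proof. exact: iter_cont (@homeo_fun_continuous _ f). Qed.

(** Replacing [U] by its points that return after [k] steps adds the positive number [k] to the
    return time found by induction. *)
Lemma nonwandering_large_return : nonwandering f = [set: M] ->
  forall (N : nat) (U : set M), open U -> U !=set0 ->
  exists n x, [/\ (N <= n)%N, U x & U (iter n f x)].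
Proof.
move=> fnw; elim=> [|N IH] U oU [x Ux]; first by exists 0%N, x.
have : nonwandering f x by rewrite fnw.
move=> /(_ U (open_nbhs_nbhs (conj oU Ux))) [k [k0 [_ [[y Uy <-] Uky]]]].
have oU1 : open (U `&` iter k f @^-1` U).
  apply: openI => //; apply: open_comp => // z _; exact: iter_homeo_continuous.
have U1y : (U `&` iter k f @^-1` U) !=set0 by exists y.
have [n [z [Nn [Uz _] [_ Ukz]]]] := IH _ oU1 U1y.
exists (k + n)%N, z; split=> //; last by rewrite iterD.
by rewrite -addn1 addnC leq_add.
Qed.

Lemma system_of_two_expansive : n_expansive 2 f -> nonwandering f = [set: M] ->
  exists e, system f (homeo_inv f) e.
Proof.
(* With this choice [4 * e] is the given expansivity constant. *)
move=> [al al0 h2] fnw; exists (al / 4); split.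
- exact: homeo_fun_continuous.
- exact: homeo_inv_continuous.
- exact: homeo_funK.
- exact: homeo_invK.
- by rewrite divr_gt0.
- rewrite mulrCA divff ?mulr1 ?pnatr_eq0 // => a b c hf hg.
  have inG z : [\/ z = a, z = b | z = c] -> Gamma f al a z.
    (* [Negz n] stands for the exponent [- (n + 1)], hence the successor. *)
    by move=> hz [n|n]; [apply: hf | apply: (hg n.+1)] => //; apply: Or31.
  have Ga : Gamma f al a a by apply: inG; apply: Or31.
  have Gb : Gamma f al a b by apply: inG; apply: Or32.
  have Gc : Gamma f al a c by apply: inG; apply: Or33.
  have /pcard_leP [g] := h2 a.
  have g2 u : Gamma f al a u -> (g u < 2)%N by move=> Gu; exact: (@funS _ _ _ _ g _ Gu).
  have gi u v : Gamma f al a u -> Gamma f al a v -> g u = g v -> u = v.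
    by move=> Gu Gv; exact: (@inj _ _ _ g _ _ (mem_set Gu) (mem_set Gv)).
  have := gi _ _ Ga Gb; have := gi _ _ Ga Gc; have := gi _ _ Gb Gc.
  move: (g2 _ Ga) (g2 _ Gb) (g2 _ Gc).
  case: (g a) => [|[|//]]; case: (g b) => [|[|//]]; case: (g c) => [|[|//]] _ _ _ h1 h3 h4;
  by [apply: Or31; exact: h4 | apply: Or32; exact: h3 | apply: Or33; exact: h1].
- exact: nonwandering_large_return.
Qed.

End Expansive.

Theorem theorem1 (R : realType) (M : metricType R)
    (M_compact : compact [set: M]) (M_surface : boundaryless_surface M)
    (f : homeo M) (f_2expansive : n_expansive 2 f)
    (f_nonwandering : nonwandering f = [set: M]) :
  expansive f.
Proof.
have [e sys] := system_of_two_expansive f_2expansive f_nonwandering.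
have discs (x : M) O : open O -> O x ->
    exists D bd, [/\ is_disc D bd, D `<=` O & (D `\` bd) x] by exact: disc_nbhd.
have [rho rho0 gu] := good_uniform M_compact discs sys.
have [r r0 hr] := gu rho rho0 (lexx _).
have [d1 d10 h1] := forward_close M_compact discs sys r0.
have [d2 d20 h2] := forward_close M_compact discs (system_sym sys) r0.
exists (Num.min d1 d2); first by rewrite lt_min d10.
move=> x; apply/seteqP; split=> y; last by move=> -> n; rewrite mdistxx ltW // lt_min d10.
move=> xy; have [|C [cC Cx Cy fC CB]] := h1 x y.
  by move=> n; apply: le_trans (xy n%:Z) _; rewrite ge_min lexx.
have [|C' [cC' C'x C'y fC' CB']] := h2 x y.
  move=> [|n]; first by apply: le_trans (xy 0) _; rewrite ge_min lexx orbT.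
  by apply: le_trans (xy (Negz n)) _; rewrite ge_min lexx orbT.
have [D [bd [gD BD _]]] := hr x.
have BD' w : mdist w x < r -> D w by move=> /BD [].
have Dx : D x by apply: BD'; rewrite mdistxx.
apply/esym; apply: (good_nolens M_compact discs sys gD Dx).
  by apply: (plaque_max cC fC Cx) => // w /CB /BD'.
by apply: (plaque_max cC' fC' C'x) => // w /CB' /BD'.
Qed.
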